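(* Let $\eta>0$ be a constant such that $\|B(u,v)\|_{\mathcal X}\le\eta\|u\|_{\mathcal X}\|v\|_{\mathcal X}$ for all $u,v\in\mathcal X=\mathcal C_w([0,\infty),\mathcal{PM}^2)$ (such a constant exists). Assume that $u_0\in\mathcal{PM}^2$ and $F\in\mathcal C_w([0,\infty),\mathcal{PM})$ satisfy $\|u_0\|_{\mathcal{PM}^2}+\|F\|_{\mathcal C_w([0,\infty),\mathcal{PM})}<\varepsilon$ for some $0<\varepsilon<1/(4\eta)$. Then there exists a global-in-time solution $u\in\mathcal X$ of the Navier--Stokes problem with initial datum $u_0$ and external force $F$. This is the unique solution satisfying the condition $\|u\|_{\mathcal X}\le 2\varepsilon$. Moreover, this solution depends continuously on the initial data and external forces in the following sense: put $y(t)=S(t)u_0+\int_0^tS(t-\tau)\mathbb{P}F(\tau)\,d\tau$; if $\tilde u_0\in\mathcal{PM}^2$, $\tilde F\in\mathcal C_w([0,\infty),\mathcal{PM})$, $\tilde y(t)=S(t)\tilde u_0+\int_0^tS(t-\tau)\mathbb{P}\tilde F(\tau)\,d\tau$, $\|\tilde y\|_{\mathcal X}\le\varepsilon$, $\tilde u=\tilde y+B(\tilde u,\tilde u)$ and $\|\tilde u\|_{\mathcal X}\le2\varepsilon$, then $$\|u-\tilde u\|_{\mathcal X}\le\frac{1}{1-4\eta\varepsilon}\|y-\tilde y\|_{\mathcal X}.$$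
   Context: The Fourier transform on $\mathbb{R}^3$ is $\widehat v(\xi)=(2\pi)^{-3/2}\int_{\mathbb{R}^3}e^{-ix\cdot\xi}v(x)\,dx$, extended to tempered distributions. For $a\ge0$, $\mathcal{PM}^a=\{v\in\mathcal S'(\mathbb{R}^3):\widehat v\in L^1_{loc}(\mathbb{R}^3),\ \|v\|_{\mathcal{PM}^a}=\operatorname{ess\,sup}_{\xi\in\mathbb{R}^3}|\xi|^a|\widehat v(\xi)|<\infty\}$, and $\mathcal{PM}=\mathcal{PM}^0$. The same notation is used for $\mathbb{R}^3$-valued $v=(v_1,v_2,v_3)$, with $|\widehat v(\xi)|$ the Euclidean norm. All of $u_0,F,u$ are vector valued with three components. $\mathcal C_w([0,\infty),\mathcal{PM}^a)$ is the space of bounded functions $u:[0,\infty)\to\mathcal{PM}^a$ that are weakly continuous as distributions ($t\mapsto\langle u(t),\varphi\rangle$ is continuous for every Schwartz function $\varphi$), with norm $\sup_{t\ge0}\|u(t)\|_{\mathcal{PM}^a}$. $S(t)$ is the heat semigroup, $\widehat{S(t)v}(\xi)=e^{-t|\xi|^2}\widehat v(\xi)$. $\mathbb{P}$ is the Leray projector, the Fourier multiplier with matrix symbol $(\widehat{\mathbb{P}}(\xi))_{j,k}=\delta_{jk}-\xi_j\xi_k/|\xi|^2$. For $u,v\in\mathcal{PM}^2$, $\widehat{u_kv_j}=(2\pi)^{-3/2}\,\widehat u_k*\widehat v_j$ (an absolutely convergent convolution for $\xi\ne0$), $u\otimes v$ is the matrix with entries $u_kv_j$, and $i\xi\cdot\widehat{(u\otimes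 v)}$ is the vector with $j$-th component $\sum_k i\xi_k\widehat{u_kv_j}$. The bilinear operator $B(u,v)(t)=-\int_0^tS(t-\tau)\mathbb{P}\nabla\cdot(u\otimes v)(\tau)\,d\tau$ is defined in Fourier variables by $\widehat{B(u,v)}(\xi,t)=-\int_0^te^{-(t-\tau)|\xi|^2}\widehat{\mathbb{P}}(\xi)\,i\xi\cdot\widehat{(u\otimes v)}(\xi,\tau)\,d\tau$. All time integrals are understood in Fourier variables (pointwise in $\xi$), e.g. $\int_0^tS(t-\tau)\mathbb{P}F(\tau)\,d\tau$ has Fourier transform $\int_0^te^{-(t-\tau)|\xi|^2}\widehat{\mathbb{P}}(\xi)\widehat F(\xi,\tau)\,d\tau$. The Navier--Stokes problem is $u_t-\Delta u+(u\cdot\nabla)u+\nabla p=F$, $\nabla\cdot u=0$, $u(0)=u_0$ on $\mathbb{R}^3$. By a solution with datum $u_0$ and force $F$ we mean $u\in\mathcal C_w([0,\infty),\mathcal{PM}^2)$ such that for all $t\ge0$ $$\widehat u(\xi,t)=e^{-t|\xi|^2}\widehat u_0(\xi)-\int_0^te^{-(t-\tau)|\xi|^2}\widehat{\mathbb{P}}(\xi)\,i\xi\cdot\widehat{(u\otimes u)}(\xi,\tau)\,d\tau+\int_0^te^{-(t-\tau)|\xi|^2}\widehat{\mathbb{P}}(\xi)\widehat F(\xi,\tau)\,d\tau .$$ *)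

(* Defs.v *)
From HB Require Import structures.
From mathcomp Require Import all_boot all_order all_algebra.
From mathcomp Require Import all_classical all_reals all_analysis.
From mathcomp Require Import ess_sup_inf.
From mathcomp Require Export complex.

Set Implicit Arguments.
Unset Strict Implicit.
Unset Printing Implicit Defensive.

Import Order.TTheory GRing.Theory Num.Theory.
Import numFieldNormedType.Exports.

Local Open Scope classical_set_scope.
Local Open Scope ring_scope.
Local Open Scope complex_scope.

(* Re and Im would otherwise denote the R[i]-valued operations of Num. *)
Local Notation Re := complex.Re.
Local Notation Im := complex.Im.
Local Notation normc := Normc.normc.

Section Euclidean.
Context {R : realType}.
Local Notation R3 := (R * R * R)%type.
Local Notation leb3 := ((@lebesgue_measure R \x @lebesgue_measure R)
                        \x @lebesgue_measure R)%E.
Local Notation RRR :=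
  (measurableTypeR R * measurableTypeR R * measurableTypeR R)%type.

Definition coord (x : R3) (i : 'I_3) : R := tnth [tuple x.1.1; x.1.2; x.2] i.

Definition basis_vec (i : 'I_3) : R3 :=
  ((i == 0%N :> nat)%:R, (i == 1%N :> nat)%:R, (i == 2%N :> nat)%:R).

Definition dot (x y : R3) : R := \sum_(i < 3) coord x i * coord y i.

(* The norm that the library puts on a product is the sup norm. *)
Definition enorm (x : R3) : R := Num.sqrt (dot x x).

Definition cvnorm (z : 'I_3 -> R[i]) : R :=
  Num.sqrt (\sum_(i < 3) normc (z i) ^+ 2).

Definition cmeasurable d (T : measurableType d) (f : T -> R[i]) : Prop :=
  measurable_fun [set: T] (fun x => Re (f x)) /\
  measurable_fun [set: T] (fun x => Im (f x)).

Definition cintegral d (T : measurableType d) (mu : {measure set T -> \bar R})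
    (D : set T) (f : T -> R[i]) : R[i] :=
  Rintegral mu D (fun x => Re (f x)) +i*
  Rintegral mu D (fun x => Im (f x)).

Definition L1loc (f : R3 -> R[i]) : Prop :=
  @cmeasurable _ RRR f /\
  forall K : set R3, compact K ->
    (\int[leb3]_(x in K) (normc (f x))%:E < +oo)%E.

End Euclidean.

Section Tempered.
Context {R : realType}.
Local Notation R3 := (R * R * R)%type.
Local Notation leb3 := ((@lebesgue_measure R \x @lebesgue_measure R)
                        \x @lebesgue_measure R)%E.
Local Notation C := (R[i]).

(* Iterated partial derivatives in the directions listed in s, the last entry
   of s being applied first. *)
Fixpoint pderivs (s : seq 'I_3) (f : R3 -> R) : R3 -> R :=
  if s is i :: s' then fun x => 'D_(basis_vec i) (pderivs s' f) x else f.

Definition smooth (f : R3 -> R) : Prop :=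
  forall s i x, derivable (pderivs s f) x (basis_vec i).

Definition cpderivs (s : seq 'I_3) (phi : R3 -> C) (x : R3) : C :=
  pderivs s (fun y => Re (phi y)) x +i*
  pderivs s (fun y => Im (phi y)) x.

Definition schwartz (phi : R3 -> C) : Prop :=
  [/\ smooth (fun x => Re (phi x)),
      smooth (fun x => Im (phi x)) &
   forall s k, exists M : R,
     forall x, enorm x ^+ k * normc (cpderivs s phi x) <= M].

(* A distribution v is applied to arbitrary functions; only its values on
   Schwartz functions are meaningful. *)
Definition distr : Type := (R3 -> C) -> C.

Definition tempered (v : distr) : Prop :=
  (forall (a : C) (phi psi : R3 -> C), schwartz phi -> schwartz psi ->
     v (fun x => a * phi x + psi x) = a * v phi + v psi) /\
  (* continuity for the Schwartz seminorms *)
  exists (N : nat) (A : R), forall (phi : R3 -> C) (M : R), schwartz phi ->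
    (forall s k x, (size s <= N)%N -> (k <= N)%N ->
       enorm x ^+ k * normc (cpderivs s phi x) <= M) ->
    normc (v phi) <= A * M.

Definition real_distr (v : distr) : Prop :=
  forall phi, schwartz phi ->
    (forall x, Im (phi x) = 0) -> Im (v phi) = 0.

Definition fourier (phi : R3 -> C) (xi : R3) : C :=
  ((2 * pi) `^ (- (3 / 2)))%:C *
  cintegral leb3 setT
    (fun x => (cos (dot x xi) -i* sin (dot x xi)) * phi x).

(* The transform of v is the function f: <v^, phi> = <v, phi^>.  For f with
   |xi|^a |f| bounded, f phi is integrable for every Schwartz phi. *)
Definition is_fourier (v : distr) (f : R3 -> C) : Prop :=
  L1loc f /\
  forall phi, schwartz phi ->
    v (fourier phi) = cintegral leb3 setT (fun xi => f xi * phi xi).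

(* A representative of the transform of v, when v^ is locally integrable. *)
Definition hat (v : distr) : R3 -> C :=
  xget (fun=> 0) [set f | is_fourier v f].

(* The tempered distribution with transform f. *)
Definition of_hat (f : R3 -> C) : distr :=
  xget (fun=> 0) [set v | tempered v /\ is_fourier v f].

Definition vdistr : Type := 'I_3 -> distr.

(* Only the values at t >= 0 are meaningful. *)
Definition curve : Type := R -> vdistr.

Definition pm_norm (a : R) (v : vdistr) : \bar R :=
  ess_sup leb3
    (fun xi => (enorm xi `^ a * cvnorm (fun i => hat (v i) xi))%:E).

(* Vector fields are R^3-valued, hence the reality condition. *)
Definition PM (a : R) (v : vdistr) : Prop :=
  (forall i, [/\ tempered (v i), real_distr (v i) &
                 exists f, is_fourier (v i) f]) /\
  (pm_norm a v < +oo)%E.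

Definition cw_norm (a : R) (u : curve) : \bar R :=
  ereal_sup [set pm_norm a (u t) | t in `[0, +oo[%classic].

Definition Cw (a : R) (u : curve) : Prop :=
  [/\ forall t, 0 <= t -> PM a (u t),
      (cw_norm a u < +oo)%E &
      forall i phi, schwartz phi ->
        {within `[0, +oo[%classic, continuous (fun t => Re (u t i phi))} /\
        {within `[0, +oo[%classic, continuous (fun t => Im (u t i phi))}].

Definition curve_eq (u v : curve) : Prop :=
  forall t, 0 <= t -> forall i phi, schwartz phi -> u t i phi = v t i phi.

Definition curve_add (u v : curve) : curve :=
  fun t i phi => u t i phi + v t i phi.

Definition curve_sub (u v : curve) : curve :=
  fun t i phi => u t i phi - v t i phi.

End Tempered.

Arguments distr : clear implicits.
Arguments vdistr : clear implicits.
Arguments curve : clear implicits.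

Section NavierStokes.
Context {R : realType}.
Local Notation R3 := (R * R * R)%type.
Local Notation leb1 := (@lebesgue_measure R).
Local Notation leb3 := ((@lebesgue_measure R \x @lebesgue_measure R)
                        \x @lebesgue_measure R)%E.
Local Notation RRR :=
  (measurableTypeR R * measurableTypeR R * measurableTypeR R)%type.
Local Notation C := (R[i]).
Implicit Types (u v F : curve R) (t : R) (xi : R3).

(* Each u(t)^ is only defined up to a null set of xi depending on t, so that
   integrating u(t)^(xi) over t for fixed xi requires a jointly measurable
   representative.  Any bounded weakly continuous curve in PM^a, a < 3, has
   one, and by Fubini two of them give the same time integrals for almost
   every xi. *)
Definition st_hat (w : R -> distr R) : R -> R3 -> C :=
  xget (fun _ _ => 0)
    [set f | cmeasurable (fun p : measurableTypeR R * RRR => f p.1 p.2) /\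
             {ae leb1, forall t, 0 <= t ->
                {ae leb3, forall xi, f t xi = hat (w t) xi}}].

Definition heat_symbol t xi : C := (expR (- (t * enorm xi ^+ 2)))%:C.

(* At xi = 0 the quotient is 0 by the convention x / 0 = 0. *)
Definition leray_symbol xi (j k : 'I_3) : C :=
  ((j == k)%:R - coord xi j * coord xi k / enorm xi ^+ 2)%:C.

Definition leray xi (z : 'I_3 -> C) : 'I_3 -> C :=
  fun j => \sum_(k < 3) leray_symbol xi j k * z k.

Definition conv (f g : R3 -> C) xi : C :=
  cintegral leb3 setT (fun zeta => f (xi - zeta) * g zeta).

Definition prod_hat (f g : R3 -> C) xi : C :=
  ((2 * pi) `^ (- (3 / 2)))%:C * conv f g xi.

(* j-th component of i xi . (u (x) v)^ at time tau. *)
Definition div_tensor_hat u v (tau : R) xi (j : 'I_3) : C :=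
  \sum_(k < 3) (0 +i* 1) * (coord xi k)%:C *
    prod_hat (st_hat (fun s => u s k) tau) (st_hat (fun s => v s j) tau) xi.

Definition B_hat u v t (j : 'I_3) xi : C :=
  - cintegral leb1 `[0, t]%classic (fun tau =>
      heat_symbol (t - tau) xi * leray xi (div_tensor_hat u v tau xi) j).

Definition duhamel_hat F t (j : 'I_3) xi : C :=
  cintegral leb1 `[0, t]%classic (fun tau =>
    heat_symbol (t - tau) xi *
    leray xi (fun k => st_hat (fun s => F s k) tau xi) j).

Definition B u v : curve R := fun t j => of_hat (B_hat u v t j).

Definition duhamel F : curve R := fun t j => of_hat (duhamel_hat F t j).

Definition heat (u0 : vdistr R) : curve R :=
  fun t j => of_hat (fun xi => heat_symbol t xi * hat (u0 j) xi).

Definition linear_part (u0 : vdistr R) F : curve R :=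
  curve_add (heat u0) (duhamel F).

Definition NS_solution (u0 : vdistr R) F u : Prop :=
  Cw 2 u /\
  forall t, 0 <= t ->
    {ae leb3, forall xi j,
       hat (u t j) xi = heat_symbol t xi * hat (u0 j) xi
                        + B_hat u u t j xi + duhamel_hat F t j xi}.

Definition bilinear_bound (eta : R) : Prop :=
  forall u v, Cw 2 u -> Cw 2 v ->
    Cw 2 (B u v) /\
    (cw_norm 2 (B u v) <= eta%:E * cw_norm 2 u * cw_norm 2 v)%E.

End NavierStokes.

(* Main.v *)
(* In Fourier variables PM^2 is the space of functions bounded by a multiple of
   |xi|^-2, and the mild formulation is a fixed point equation u = y + B(u, u)
   there.  The convolution of |xi|^-2 with itself is a multiple of |xi|^-1 by
   homogeneity, the divergence turns this into a bounded function, and the heat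
   kernel gains |xi|^-2 because int_0^t e^{-(t-tau)|xi|^2} dtau <= |xi|^-2; hence
   B is bounded.  For 4 eta eps < 1 the Picard iterates converge geometrically
   and differences of fixed points are controlled by those of the linear parts.

   Jointly measurable representatives need not be constructed for arbitrary
   curves: a component without one contributes zero to all time integrals, which
   only helps the bounds, and every curve for which the value of an integral
   matters satisfies the mild formula, which provides its representative.  The
   dictionary between distributions and their transforms rests on Fourier
   inversion for Schwartz functions, obtained by regularising with
   e^{-eps(|xi_1| + |xi_2| + |xi_3|)}. *)

From HB Require Import structures.
From mathcomp Require Import all_boot all_order all_algebra.
From mathcomp Require Import all_classical all_reals all_analysis.
From mathcomp Require Import measurable_realfun ess_sup_inf.
From mathcomp Require Import ring lra.
Require Import Defs.

Set Implicit Arguments.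
Unset Strict Implicit.
Unset Printing Implicit Defensive.

Import Order.TTheory GRing.Theory Num.Theory.
Import numFieldNormedType.Exports.

Local Open Scope classical_set_scope.
Local Open Scope ring_scope.

(** The constant [eta] is given only for curves in [Cw 2], whereas [hat] and [of_hat] are choices
    determined up to null sets, so estimates are made on jointly measurable fields of (t, k, xi) and
    [eta] is transported to them. The pointwise limit of the iterates exists off a null set that
    depends on t; its continuity in time is therefore not at hand and [eta] cannot be applied to it.
    There the cruder explicit constant [cdiv], valid for bounded measurable fields, takes over: one
    more application of the map restores continuity in time, and the sharp radius 2 eps comes back
    in the limit. The smallness hypothesis adds two norms without any constant, so the bound of the
    force term must lose nothing; this is why Minkowski's inequality for vector integrals is proved.
    Reality of the vector fields becomes Hermitian symmetry of their transforms and accompanies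
    every construction. The regularising exponential is a product of one-dimensional functions with
    elementary primitives, and its transform is a product of Poisson kernels. Transforms are handled
    through real cosine integrals with a phase: sines, derivatives and the factor i are all shifts
    of the phase by pi/2. *)

Section RealIntegrals.
Context d (T : measurableType d) (R : realType) (mu : {measure set T -> \bar R}).
Implicit Types f g h : T -> R.

Definition intg (mu : {measure set T -> \bar R}) f := mu.-integrable setT (EFin \o f).
Definition Int (mu : {measure set T -> \bar R}) f : R := Rintegral mu setT f.

Lemma intg_meas f : intg mu f -> measurable_fun setT f.
Proof. by move=> /integrableP[/measurable_EFinP]. Qed.

Lemma intg_ae_le f g : measurable_fun setT f -> intg mu g ->
  {ae mu, forall x, `|f x| <= g x} -> intg mu f.
Proof.
move=> mf ig fg; apply/integrableP; split; first exact/measurable_EFinP.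
have mg := intg_meas ig.
have /integrableP[_ gfin] := ig.
apply: le_lt_trans gfin.
apply: ae_ge0_le_integral => //=.
- by apply/measurable_EFinP; apply: measurableT_comp.
- by apply/measurable_EFinP; apply: measurableT_comp.
- move: fg; apply: filterS => x fg _; rewrite lee_fin.
  exact: (le_trans fg (ler_norm _)).
Qed.

Lemma intg_le f g : measurable_fun setT f -> intg mu g ->
  (forall x, `|f x| <= g x) -> intg mu f.
Proof. by move=> mf ig fg; apply: (intg_ae_le mf ig); exact: aeW. Qed.

Lemma intgD f g : intg mu f -> intg mu g -> intg mu (fun x => f x + g x).
Proof. by move=> fi gi; have := integrableD measurableT fi gi. Qed.

Lemma intgZ (c : R) f : intg mu f -> intg mu (fun x => c * f x).
Proof. by move=> fi; apply: (integrableZl measurableT c fi). Qed.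

Lemma intgN f : intg mu f -> intg mu (fun x => - f x).
Proof. by move=> fi; have := integrableN fi. Qed.

Lemma intgB f g : intg mu f -> intg mu g -> intg mu (fun x => f x - g x).
Proof. by move=> fi gi; apply: intgD => //; exact: intgN. Qed.

Lemma intg_norm f : intg mu f -> intg mu (fun x => `|f x|).
Proof. by move=> fi; have := integrable_norm fi. Qed.

Lemma intg0 : intg mu (fun=> 0).
Proof. exact: integrable0. Qed.

Lemma IntD f g : intg mu f -> intg mu g ->
  Int mu (fun x => f x + g x) = Int mu f + Int mu g.
Proof. by move=> fi gi; rewrite /Int RintegralD. Qed.

Lemma IntB f g : intg mu f -> intg mu g ->
  Int mu (fun x => f x - g x) = Int mu f - Int mu g.
Proof. by move=> fi gi; rewrite /Int RintegralB. Qed.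

Lemma IntZ c f : intg mu f -> Int mu (fun x => c * f x) = c * Int mu f.
Proof. by move=> fi; rewrite /Int RintegralZl. Qed.

Lemma Int_eq f g : f =1 g -> Int mu f = Int mu g.
Proof. by move=> /funext ->. Qed.

Lemma Int_ae f g : measurable_fun setT f -> measurable_fun setT g ->
  {ae mu, forall x, f x = g x} -> Int mu f = Int mu g.
Proof.
move=> mf mg fg; congr fine; apply: ae_eq_integral => //; try exact/measurable_EFinP.
by move: fg; apply: filterS => x -> _.
Qed.

Lemma Int_ge0 f : (forall x, 0 <= f x) -> 0 <= Int mu f.
Proof. by move=> f0; apply: Rintegral_ge0. Qed.

Lemma Int_le f g : intg mu f -> intg mu g -> (forall x, f x <= g x) ->
  Int mu f <= Int mu g.
Proof. by move=> fi gi fg; apply: le_Rintegral. Qed.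

Lemma Int_norm f : intg mu f -> `|Int mu f| <= Int mu (fun x => `|f x|).
Proof. by move=> fi; apply: le_normr_Rintegral. Qed.

Lemma Int_norm_le f g : intg mu g -> measurable_fun setT f ->
  {ae mu, forall x, `|f x| <= g x} -> `|Int mu f| <= Int mu g.
Proof.
move=> ig mf fg; have fi := intg_ae_le mf ig fg.
apply: (le_trans (Int_norm fi)).
have mg := intg_meas ig.
rewrite /Int /Rintegral fine_le //.
- exact: (integrable_fin_num _ (intg_norm fi)).
- exact: (integrable_fin_num _ ig).
(* Dominating [|f|] makes [g] nonnegative almost everywhere, so replacing it by [|g|] does not
   change the integral and gives the everywhere nonnegative integrand that monotonicity asks for. *)
- have -> : (\int[mu]_x (g x)%:E = \int[mu]_x (`|g x|)%:E)%E.
    apply: ae_eq_integral => //; try exact/measurable_EFinP.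
      by apply/measurable_EFinP; exact: measurableT_comp.
    move: fg; apply: filterS => x fg _; congr EFin.
    by rewrite ger0_norm // (le_trans _ fg).
  apply: ae_ge0_le_integral => //=.
  + by apply/measurable_EFinP; exact: measurableT_comp.
  + by apply/measurable_EFinP; exact: measurableT_comp.
  + move: fg; apply: filterS => x fg _; rewrite lee_fin.
    exact: (le_trans fg (ler_norm _)).
Qed.

Lemma EFin_Int f : intg mu f -> (Int mu f)%:E = (\int[mu]_x (f x)%:E)%E.
Proof. by move=> fi; rewrite /Int /Rintegral fineK // integrable_fin_num. Qed.

Lemma Int_dct (F : nat -> T -> R) f g :
  (forall n, measurable_fun setT (F n)) -> measurable_fun setT f -> intg mu g ->
  (forall n, {ae mu, forall x, `|F n x| <= g x}) ->
  {ae mu, forall x, F n x @[n --> \oo] --> f x} ->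
  Int mu (F n) @[n --> \oo] --> Int mu f.
Proof.
move=> mF mf ig Fg Ff.
have Fg' : {ae mu, forall x n, `|F n x| <= g x} by apply/ae_foralln.
have Ff' : {ae mu, forall x, setT x -> (EFin \o F n) x @[n --> \oo] --> (EFin \o f) x}.
  by apply: filterS Ff => x Ff _; apply/fine_cvgP; split=> //; exact: nearW.
have Fg2 : {ae mu, forall x n, setT x -> (`|(EFin \o F n) x| <= (EFin \o g) x)%E}.
  by apply: filterS Fg' => x Fg2 n _; rewrite lee_fin.
have [fi _ cv] := @dominated_convergence _ _ _ mu setT measurableT
  (fun n => EFin \o F n) (EFin \o f) (EFin \o g)
  (fun n => (measurable_EFinP _ _).2 (mF n)) ((measurable_EFinP _ _).2 mf)
  Ff' ig Fg2.
by apply: fine_cvg; rewrite EFin_Int.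
Qed.

End RealIntegrals.

(** * Product measures and Fubini's theorem *)

Section SigmaFiniteProduct.
Context d1 d2 (T1 : measurableType d1) (T2 : measurableType d2) (R : realType).
Variables (m1 : {sigma_finite_measure set T1 -> \bar R})
  (m2 : {sigma_finite_measure set T2 -> \bar R}).

Lemma product_sigma_finite : sigma_finite setT (m1 \x m2)%E.
Proof.
have /sigma_finiteP[F [TF ndF Foo]] := sigma_finiteT m1.
have /sigma_finiteP[G [TG ndG Goo]] := sigma_finiteT m2.
exists (fun n => F n `*` G n).
  rewrite -setXTT TF TG predeqE => -[x y]; split.
    move=> [/= [n _ Fnx] [k _ Gky]]; exists (maxn n k) => //; split.
    - by move: x Fnx; exact/subsetPset/ndF/leq_maxl.
    - by move: y Gky; exact/subsetPset/ndG/leq_maxr.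
  by move=> [n _ []/= ? ?]; split; exists n.
move=> k; have [mFk Fkoo] := Foo k; have [mGk Gkoo] := Goo k.
split; first exact: measurableX.
by rewrite product_measure1E // lte_mul_pinfty // ge0_fin_numE.
Qed.

(* The library's canonical sigma-finite structure on [\x] is keyed on products
   of subprobabilities, so it is not inferred for Lebesgue measure. *)
Definition sfprod : {sigma_finite_measure set (T1 * T2)%type -> \bar R} :=
  HB.pack (m1 \x m2)%E (Measure_isSigmaFinite.Build _ _ _ (m1 \x m2)%E product_sigma_finite).

End SigmaFiniteProduct.

Section ProductIntegrals.
Context d1 d2 (T1 : measurableType d1) (T2 : measurableType d2) (R : realType).
Variables (m1 : {sigma_finite_measure set T1 -> \bar R})
  (m2 : {sigma_finite_measure set T2 -> \bar R}).

(** Tonelli makes the integrals of the positive and negative parts measurable in x, and [fine] sends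
    infinite values of their difference to 0. Convolutions and time integrals of measurable fields
    are thus measurable before any bound on them is known. *)
Lemma measurable_Int (f : T1 * T2 -> R) : measurable_fun setT f ->
  measurable_fun setT (fun x => Int m2 (fun y => f (x, y))).
Proof.
move=> mf; apply: measurableT_comp => //=.
have -> : (fun x => \int[m2]_y (f (x, y))%:E)%E = (fun x =>
    fubini_F m2 (EFin \o f)^\+ x - fubini_F m2 (EFin \o f)^\- x)%E.
  apply/funext => x; rewrite integralE /fubini_F.
  by congr (adde _ (oppe _)); apply: eq_integral => y _; rewrite ?funeposE ?funenegE /=.
have mF : measurable_fun setT (EFin \o f) by exact/measurable_EFinP.
apply: emeasurable_funB; apply: measurable_fun_fubini_tonelli_F => //.
- exact: measurable_funepos.
- exact: measurable_funeneg.
Qed.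

Lemma intg_prod (g1 : T1 -> R) (g2 : T2 -> R) : intg m1 g1 -> intg m2 g2 ->
  intg (m1 \x m2)%E (fun p => g1 p.1 * g2 p.2).
Proof.
move=> i1 i2.
have mg1 := intg_meas i1; have mg2 := intg_meas i2.
have mg : measurable_fun setT (fun p : T1 * T2 => g1 p.1 * g2 p.2).
  by apply: measurable_funM; apply: measurableT_comp.
apply/(integrable12ltyP m1 m2); first exact/measurable_EFinP.
have -> : (fun x => \int[m2]_y `|(EFin \o (fun p => g1 p.1 * g2 p.2)%R) (x, y)|)%E =
    (fun x => (`|g1 x|)%:E * (Int m2 (fun y => `|g2 y|))%:E)%E.
  apply/funext => x; rewrite EFin_Int; last exact: intg_norm.
  rewrite -integralZl //; last exact: intg_norm.
  by apply: eq_integral => y _ /=; rewrite normrM EFinM.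
rewrite ge0_integralZr //; last 2 first.
- by apply/measurable_EFinP; exact: measurableT_comp.
- by rewrite lee_fin; apply: Int_ge0 => y.
by rewrite -EFin_Int ?ltry //; exact: intg_norm.
Qed.

Lemma Int_fubini1 (f : T1 * T2 -> R) : intg (m1 \x m2)%E f ->
  Int (m1 \x m2)%E f = Int m1 (fun x => Int m2 (fun y => f (x, y))).
Proof.
move=> fi; rewrite /Int /Rintegral -integral12_prod_meas1 //; congr fine.
have mf := intg_meas fi.
apply: ae_eq_integral => //.
- exact: (measurable_fubini_F fi).
- by apply/measurable_EFinP; exact: measurable_Int.
- have := ae_integrable1 fi; apply: filterS => x ix _.
  by rewrite fineK //; exact: integrable_fin_num.
Qed.

Lemma Int_fubini2 (f : T1 * T2 -> R) : intg (m1 \x m2)%E f ->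
  Int (m1 \x m2)%E f = Int m2 (fun y => Int m1 (fun x => f (x, y))).
Proof.
move=> fi; rewrite /Int /Rintegral -integral21_prod_meas1 //; congr fine.
have mf := intg_meas fi.
apply: ae_eq_integral => //.
- exact: (measurable_fubini_G fi).
- apply/measurable_EFinP.
  apply: measurableT_comp => //=.
  have mF : measurable_fun setT (EFin \o f) by exact/measurable_EFinP.
  have -> : (fun x => \int[m1]_y (f (y, x))%:E)%E = (fun x =>
    fubini_G m1 (EFin \o f)^\+ x - fubini_G m1 (EFin \o f)^\- x)%E.
    apply/funext => x; rewrite integralE /fubini_G.
    by congr (adde _ (oppe _)); apply: eq_integral => y _; rewrite ?funeposE ?funenegE /=.
  apply: emeasurable_funB; apply: measurable_fun_fubini_tonelli_G => //.
  + exact: measurable_funepos.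
  + exact: measurable_funeneg.
- have := ae_integrable2 fi; apply: filterS => x ix _.
  by rewrite fineK //; exact: integrable_fin_num.
Qed.

Lemma Int_prod (g1 : T1 -> R) (g2 : T2 -> R) : intg m1 g1 -> intg m2 g2 ->
  Int (m1 \x m2)%E (fun p => g1 p.1 * g2 p.2) = Int m1 g1 * Int m2 g2.
Proof.
move=> i1 i2; rewrite Int_fubini1 /=; last exact: intg_prod.
under eq_fun do rewrite IntZ //.
rewrite mulrC -IntZ //; apply: Int_eq => x; exact: mulrC.
Qed.

Lemma Int_swap (f : T1 * T2 -> R) (g1 : T1 -> R) (g2 : T2 -> R) :
  measurable_fun setT f -> intg m1 g1 -> intg m2 g2 ->
  (forall x y, `|f (x, y)| <= g1 x * g2 y) ->
  Int m1 (fun x => Int m2 (fun y => f (x, y))) =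
  Int m2 (fun y => Int m1 (fun x => f (x, y))).
Proof.
move=> mf i1 i2 fg.
have fi : intg (m1 \x m2)%E f.
  by apply: (intg_le mf (intg_prod i1 i2)) => -[x y]; exact: fg.
by rewrite -Int_fubini1 // Int_fubini2.
Qed.

End ProductIntegrals.

(** * Affine changes of variables *)

Section Scaling.
Context (R : realType).

(* [phi] divides the measure [m] by [k]; this covers translations, reflections
   and dilations at once. *)
Definition scales d (T : measurableType d) (m : {measure set T -> \bar R})
    (phi : T -> T) (k : R) :=
  [/\ measurable_fun setT phi, 0 < k &
  forall f : T -> \bar R, measurable_fun setT f -> (forall x, 0 <= f x)%E ->
  (\int[m]_x f x = k%:E * \int[m]_x f (phi x))%E].

Lemma scales_prod d1 d2 (T1 : measurableType d1) (T2 : measurableType d2)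
    (m1 : {sigma_finite_measure set T1 -> \bar R})
    (m2 : {sigma_finite_measure set T2 -> \bar R}) phi1 phi2 k1 k2 :
  scales m1 phi1 k1 -> scales m2 phi2 k2 ->
  scales (m1 \x m2)%E (fun p => (phi1 p.1, phi2 p.2)) (k1 * k2).
Proof.
move=> [mp1 k10 h1] [mp2 k20 h2].
have mphi : measurable_fun setT (fun p : T1 * T2 => (phi1 p.1, phi2 p.2)).
  apply/measurable_fun_pairP; split => /=.
  - exact: (measurableT_comp mp1 measurable_fst).
  - exact: (measurableT_comp mp2 measurable_snd).
split=> //; first exact: mulr_gt0.
move=> f mf f0.
have mff := measurableT_comp mf mphi.
rewrite (fubini_tonelli1 f mf f0) (fubini_tonelli1 _ mff (fun x => f0 _)).
rewrite (h1 (fubini_F m2 f)); last 2 first.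
- exact: measurable_fun_fubini_tonelli_F.
- by move=> x; apply: integral_ge0.
rewrite EFinM -muleA; congr (_ * _)%E.
rewrite -ge0_integralZl //; last 3 first.
- by have := measurable_fun_fubini_tonelli_F (m2 := m2) _ mff (fun x => f0 _).
- by move=> x _; apply: integral_ge0 => y _; apply: f0.
- by rewrite lee_fin ltW.
apply: eq_integral => x _; rewrite /fubini_F h2 //.
exact: (measurableT_comp mf (pair1_measurable _)).
Qed.

Lemma scales_prod3 d1 d2 d3 (T1 : measurableType d1) (T2 : measurableType d2)
    (T3 : measurableType d3)
    (m1 : {sigma_finite_measure set T1 -> \bar R})
    (m2 : {sigma_finite_measure set T2 -> \bar R})
    (m3 : {sigma_finite_measure set T3 -> \bar R}) phi1 phi2 phi3 k1 k2 k3 :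
  scales m1 phi1 k1 -> scales m2 phi2 k2 -> scales m3 phi3 k3 ->
  scales ((m1 \x m2) \x m3)%E (fun p => (phi1 p.1.1, phi2 p.1.2, phi3 p.2)) (k1 * k2 * k3).
Proof.
move=> s1 s2 s3; have s12 := scales_prod s1 s2.
exact: (@scales_prod _ _ _ _ (sfprod m1 m2) m3 _ _ _ _ s12 s3).
Qed.

Section ScalesInt.
Context d (T : measurableType d) (m : {measure set T -> \bar R}).
Variables (phi : T -> T) (k : R).
Hypothesis sc : scales m phi k.

Lemma intg_scales f : intg m f -> intg m (fun x => f (phi x)).
Proof.
have [mp k0 h] := sc; move=> fi; have mf := intg_meas fi.
apply/integrableP; split; first by apply/measurable_EFinP; exact: measurableT_comp.
have /integrableP[_] := fi.
rewrite h //=; last by apply/measurable_EFinP; exact: measurableT_comp.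
have : (0 <= \int[m]_x `|f (phi x)|%:E)%E by apply: integral_ge0.
set I := (\int[m]_x _)%E.
case: I => [r|//|//] _; first by rewrite !ltry.
by rewrite gt0_muley ?lte_fin // ltxx.
Qed.

Lemma Int_scales f : intg m f -> Int m f = k * Int m (fun x => f (phi x)).
Proof.
have [mp k0 h] := sc; move=> fi.
have fpi := intg_scales fi.
have mf := intg_meas fi.
have mF : measurable_fun setT (EFin \o f) by exact/measurable_EFinP.
rewrite -[k]/(fine k%:E) /Int /Rintegral -fineM //; last exact: (integrable_fin_num _ fpi).
congr fine.
pose A := (\int[m]_x (EFin \o f)^\+ (phi x))%E.
pose B := (\int[m]_x (EFin \o f)^\- (phi x))%E.
have E1 : (\int[m]_x (f x)%:E = k%:E * A - k%:E * B)%E.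
  rewrite integralE; congr (adde _ (oppe _)).
    by rewrite -h //; exact: measurable_funepos.
  by rewrite -h //; exact: measurable_funeneg.
have EA : (\int[m]_x (EFin \o (fun x => f (phi x)))^\+ x = A)%E.
  by apply: eq_integral => x _; rewrite !funeposE.
have EB : (\int[m]_x (EFin \o (fun x => f (phi x)))^\- x = B)%E.
  by apply: eq_integral => x _; rewrite !funenegE.
have E2 : (\int[m]_x (f (phi x))%:E = A - B)%E by rewrite integralE EA EB.
have Bfin : B \is a fin_num by rewrite -EB; exact: (integrable_neg_fin_num _ fpi).
rewrite E1 E2; apply/esym/muleBr => //.
by apply: fin_num_adde_defl; rewrite fin_numN.
Qed.
End ScalesInt.
End Scaling.

Section Affine.
Context (R : realType).
Notation leb1 := (@lebesgue_measure R).

(** The right-hand side is a scaled push-forward of Lebesgue measure, hence a measure in [A], and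
    Lebesgue measure is determined by its values on half-open intervals. For c < 0 the preimage of
    such an interval is half-open at the other end, which leaves its length unchanged. *)
Lemma lebesgue_affine (c b : R) (A : set (measurableTypeR R)) : c != 0 -> measurable A ->
  leb1 A = ((`|c|)%:E * leb1 ((fun x => c * x + b)%R @^-1` A))%E.
Proof.
move=> c0 mA.
have mphi : measurable_fun setT (fun x : measurableTypeR R => (c * x + b) : measurableTypeR R).
  by apply: measurable_funD => //; apply: measurable_funM.
pose c' : {nonneg R} := NngNum (normr_ge0 c).
pose phi := (fun x : measurableTypeR R => (c * x + b) : measurableTypeR R).
pose mu : {measure set (measurableTypeR R) -> \bar R} :=
  mscale c' (measure_function_pushforward__canonical__measure_function_Measure leb1 mphi).
suff H : forall X, ocitv X -> leb1 X = mu X by exact: (lebesgue_measure_unique (mu := mu) H).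
move=> _ [[p q] _ <-]; rewrite /mu /= /mscale /= /pushforward lebesgue_measure_itv /=.
have [cpos|cneg|c00] := ltgtP 0 c; last by rewrite -c00 eqxx in c0.
  have -> : phi @^-1` `]p, q] = `](p - b) / c, (q - b) / c]%classic.
    apply/seteqP; split => x /=; rewrite !in_itv /= /phi ltr_pdivrMr // ler_pdivlMr //;
    by rewrite ltrBlDr lerBrDr mulrC.
  rewrite lebesgue_measure_itv /= !lte_fin ltr_pM2r ?invr_gt0 // ltrD2r.
  case: ifP => pq; last by rewrite mule0.
  by rewrite -!EFinB -EFinM gtr0_norm //; congr EFin; field.
have -> : phi @^-1` `]p, q] = `[(q - b) / c, (p - b) / c[%classic.
    apply/seteqP; split => x /=; rewrite !in_itv /= /phi ltr_ndivlMr // ler_ndivrMr //;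
    by rewrite ltrBlDr lerBrDr mulrC andbC.
rewrite lebesgue_measure_itv /= !lte_fin ltr_nM2r ?invr_lt0 // ltrD2r.
case: ifP => pq; last by rewrite mule0.
by rewrite -!EFinB -EFinM ltr0_norm //; congr EFin; field.
Qed.

Lemma ge0_integral_affine (c b : R) (f : measurableTypeR R -> \bar R) : c != 0 ->
  measurable_fun setT f -> (forall x, 0 <= f x)%E ->
  (\int[leb1]_x f x = (`|c|)%:E * \int[leb1]_x f (c * x + b)%R)%E.
Proof.
move=> c0 mf f0.
have mphi : measurable_fun setT (fun x : measurableTypeR R => (c * x + b) : measurableTypeR R).
  by apply: measurable_funD => //; apply: measurable_funM.
pose c' : {nonneg R} := NngNum (normr_ge0 c).
pose mu : {measure set (measurableTypeR R) -> \bar R} :=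
  mscale c' (measure_function_pushforward__canonical__measure_function_Measure leb1 mphi).
rewrite (@eq_measure_integral _ _ _ _ mu); last first.
  by move=> A mA _; exact: (lebesgue_affine b c0 mA).
rewrite ge0_integral_mscale //= ge0_integral_pushforward //.
Qed.

Lemma scales_affine (c b : R) : c != 0 ->
  scales leb1 ((fun x => c * x + b) : measurableTypeR R -> measurableTypeR R) `|c|.
Proof.
move=> c0; split; last by move=> f mf f0; exact: ge0_integral_affine.
- by apply: measurable_funD => //; apply: measurable_funM.
- by rewrite normr_gt0.
Qed.

Notation leb3 := ((leb1 \x leb1) \x leb1)%E.
Notation R3 := (R * R * R)%type.
Notation RRR :=
  (measurableTypeR R * measurableTypeR R * measurableTypeR R)%type.

Lemma scales_affine3 (c : R) (b : R3) : c != 0 ->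
  @scales R _ RRR leb3 (fun x : R3 => c *: x + b) (`|c| * `|c| * `|c|).
Proof.
move=> c0.
have H := scales_prod3 (scales_affine b.1.1 c0) (scales_affine b.1.2 c0)
  (scales_affine b.2 c0).
exact: H.
Qed.

End Affine.

(** * Almost everywhere statements *)

Section AlmostEverywhere.
Context d (T : measurableType d) (R : realType) (mu : {measure set T -> \bar R}).
Implicit Types P Q : T -> Prop.

Lemma ae_imp P Q : {ae mu, forall x, P x} -> (forall x, P x -> Q x) -> {ae mu, forall x, Q x}.
Proof. by move=> aP PQ; apply: filterS aP => x; exact: PQ. Qed.

Lemma ae_imp2 P Q P' : {ae mu, forall x, P x} -> {ae mu, forall x, Q x} ->
  (forall x, P x -> Q x -> P' x) -> {ae mu, forall x, P' x}.
Proof. by move=> aP aQ PQ; apply: filterS2 aP aQ => x; exact: PQ. Qed.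

Lemma ae_intg0 (f : T -> R) : intg mu f ->
  (forall A, measurable A -> Int mu (fun x => f x * \1_A x) = 0) -> {ae mu, forall x, f x = 0}.
Proof.
move=> fi f0.
have : ae_eq mu setT (EFin \o f) (cst 0%E).
  apply: integral_ae_eq => //.
  move=> A _ mA; rewrite integral0 integral_mkcond.
  transitivity (Int mu (fun x => f x * \1_A x))%:E; last by rewrite f0.
  rewrite EFin_Int; last first.
    apply: (intg_le (measurable_funM (intg_meas fi) (measurable_indic mA)) (intg_norm fi)) => x.
    by rewrite normrM ler_piMr // indicE; case: (_ \in _); rewrite ?normr1 ?normr0.
  by apply: eq_integral => x _; rewrite patchE indicE; case: (_ \in _); rewrite /= ?mulr1 ?mulr0.
by move/ae_imp; apply => x /(_ Logic.I) [].
Qed.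

Lemma intg_mkcond (D : set T) (f : T -> R) : measurable D -> measurable_fun setT f ->
  (\int[mu]_(x in D) `|f x|%:E < +oo)%E -> intg mu (fun x => f x * \1_D x).
Proof.
move=> mD mf fD; apply/integrableP; split.
  by apply/measurable_EFinP; apply: measurable_funM => //; exact: measurable_indic.
apply: le_lt_trans fD; rewrite (integral_mkcond D) le_eqVlt; apply/orP; left; apply/eqP.
apply: eq_integral => x _; rewrite patchE /= indicE.
by case: (_ \in _); rewrite ?mulr1 // mulr0 normr0.
Qed.

Lemma intg_mkcond_lty (D : set T) (f : T -> R) : measurable D ->
  intg mu (fun x => f x * \1_D x) -> (\int[mu]_(x in D) `|f x|%:E < +oo)%E.
Proof.
move=> mD /integrableP[_]; apply: le_lt_trans.
rewrite (integral_mkcond D) le_eqVlt; apply/orP; left; apply/eqP.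
apply: eq_integral => x _; rewrite patchE /= indicE.
by case: (_ \in _); rewrite ?mulr1 // mulr0 normr0.
Qed.

End AlmostEverywhere.

Notation leb1 := (@lebesgue_measure _).
Notation leb3 := ((leb1 \x leb1) \x leb1)%E.
Notation R3 R := (R * R * R)%type.
Notation RRR R :=
  (measurableTypeR R * measurableTypeR R * measurableTypeR R)%type.

(** * Coordinates and partial derivatives in three dimensions *)

Section Coordinates.
Context {R : realType}.
Implicit Types (x y v : R3 R) (i j : 'I_3).

Lemma coordD x y i : coord (x + y) i = coord x i + coord y i.
Proof. by case: i => -[|[|[|//]]] ?; rewrite /coord !(tnth_nth 0). Qed.

Lemma coordZ (c : R) x i : coord (c *: x) i = c * coord x i.
Proof. by case: i => -[|[|[|//]]] ?; rewrite /coord !(tnth_nth 0). Qed.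

Lemma coord_basis i j : coord (basis_vec i) j = (i == j)%:R :> R.
Proof.
by case: i => -[|[|[|//]]] ?; case: j => -[|[|[|//]]] ?; rewrite /coord !(tnth_nth 0).
Qed.

Lemma coordE x : [/\ coord x 0 = x.1.1, coord x 1 = x.1.2 & coord x 2 = x.2].
Proof. by rewrite /coord !(tnth_nth 0). Qed.

Lemma big3 (V : nmodType) (F : 'I_3 -> V) : \sum_(i < 3) F i = F 0 + F 1 + F 2.
Proof.
rewrite !big_ord_recl big_ord0 addr0 addrA.
by congr (_ + _ + _); congr F; apply: val_inj.
Qed.

Lemma dotE x y : dot x y = x.1.1 * y.1.1 + x.1.2 * y.1.2 + x.2 * y.2.
Proof.
have [h0 h1 h2] := coordE x; have [k0 k1 k2] := coordE y.
by rewrite /dot big3 h0 h1 h2 k0 k1 k2.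
Qed.

Lemma R3_coord_eq x y : (forall i, coord x i = coord y i) -> x = y.
Proof.
have [h0 h1 h2] := coordE x; have [k0 k1 k2] := coordE y => H.
have := H 0; have := H 1; have := H 2; rewrite h0 h1 h2 k0 k1 k2.
by case: x {h0 h1 h2 H} => -[a b] c; case: y {k0 k1 k2} => -[a' b'] c' /= -> -> ->.
Qed.

Lemma dotC x y : dot x y = dot y x.
Proof. by rewrite !dotE; ring. Qed.

Lemma dotDl x y z : dot (x + y) z = dot x z + dot y z.
Proof. by rewrite !dotE /=; ring. Qed.

Lemma dotZl (c : R) x z : dot (c *: x) z = c * dot x z.
Proof.
by rewrite /dot mulr_sumr; apply: eq_bigr => i _; rewrite coordZ mulrA.
Qed.

Lemma dot_basis i x : dot (basis_vec i) x = coord x i.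
Proof.
rewrite /dot big3 !coord_basis.
by case: i => -[|[|[|//]]] ? /=; rewrite !(mul1r, mul0r, addr0, add0r); congr coord; apply: val_inj.
Qed.

Lemma dot_ge0 x : 0 <= dot x x.
Proof. by rewrite dotE -!expr2 !addr_ge0 ?sqr_ge0. Qed.

Lemma enorm_ge0 x : 0 <= enorm x.
Proof. exact: sqrtr_ge0. Qed.

Lemma enorm_sqr x : enorm x ^+ 2 = dot x x.
Proof. by rewrite /enorm sqr_sqrtr // dot_ge0. Qed.

Lemma coord_le_enorm x i : `|coord x i| <= enorm x.
Proof.
rewrite -(@ler_pXn2r _ 2) ?nnegrE ?enorm_ge0 //.
rewrite real_normK ?num_real // enorm_sqr /dot (bigD1 i) //= -expr2 lerDl.
by apply: sumr_ge0 => j _; rewrite -expr2 sqr_ge0.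
Qed.

Lemma enorm_le_sum x : enorm x <= \sum_(i < 3) `|coord x i|.
Proof.
rewrite -(@ler_pXn2r _ 2) ?nnegrE ?enorm_ge0 //; last by apply: sumr_ge0.
rewrite enorm_sqr /dot !big3.
have h i : coord x i * coord x i = `|coord x i| ^+ 2 by rewrite real_normK ?num_real // expr2.
rewrite !h; move: (normr_ge0 (coord x 0)) (normr_ge0 (coord x 1)) (normr_ge0 (coord x 2)).
by move: `|coord x 0| `|coord x 1| `|coord x 2| => a b c a0 b0 c0; nra.
Qed.

Lemma enorm0 : enorm (0 : R3 R) = 0.
Proof. by rewrite /enorm dotE /= !mul0r !addr0 sqrtr0. Qed.

Lemma enormN x : enorm (- x) = enorm x.
Proof. by rewrite /enorm !dotE /= !mulrNN. Qed.

Lemma enorm_gt0 x : x != 0 -> 0 < enorm x.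
Proof.
move=> x0; rewrite lt_neqAle enorm_ge0 andbT; apply: contra x0 => /eqP h.
apply/eqP/R3_coord_eq => i.
have -> : coord (0 : R3 R) i = 0 by case: i => -[|[|[|//]]] ?; rewrite /coord !(tnth_nth 0).
by apply/eqP; rewrite -normr_eq0 eq_le normr_ge0 andbT (le_trans (coord_le_enorm x i)) // -h.
Qed.

Lemma measurable_coord i : measurable_fun setT (fun x : RRR R => coord x i).
Proof.
case: i => -[|[|[|//]]] h; rewrite /coord.
- rewrite (_ : (fun x : RRR R => _) = (fun x : RRR R => x.1.1)); last first.
    by apply/funext => x; rewrite !(tnth_nth 0).
  exact: (measurableT_comp measurable_fst measurable_fst).
- rewrite (_ : (fun x : RRR R => _) = (fun x : RRR R => x.1.2)); last first.
    by apply/funext => x; rewrite !(tnth_nth 0).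
  exact: (measurableT_comp measurable_snd measurable_fst).
- rewrite (_ : (fun x : RRR R => _) = (fun x : RRR R => x.2)); last first.
    by apply/funext => x; rewrite !(tnth_nth 0).
  exact: measurable_snd.
Qed.

End Coordinates.

Section Lines.
Context {R : realType}.
Implicit Types (f g : R3 R -> R) (x y v : R3 R) (i j : 'I_3).

(** The two difference quotients are the same function of h. All partial derivatives are thereby
    reduced to functions of one real variable, for which the chain rule and the mean value theorem
    are at hand. *)
Lemma is_derive_lineP f x v (t d : R) :
  is_derive (x + t *: v) v f d <-> is_derive t 1 (fun s => f (x + s *: v)) d.
Proof.
have E : (fun h : R => h^-1 *: ((f \o shift (x + t *: v)) (h *: v) - f (x + t *: v))) =
  (fun h : R => h^-1 *: (((fun s => f (x + s *: v)) \o shift t) (h *: 1) - f (x + t *: v))).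
  apply/funext => h /=; congr (_ *: (f _ - _)).
  by rewrite scaler1 [h%R + t]addrC scalerDl [LHS]addrC addrA.
by split=> -[h1 h2]; split; move: h1 h2; rewrite /derivable /derive ?E // => h1 h2;
  rewrite E.
Qed.

Lemma is_derive_add f g x v df dg : is_derive x v f df -> is_derive x v g dg ->
  is_derive x v (fun y => f y + g y) (df + dg).
Proof. exact: is_deriveD. Qed.

Lemma is_derive_mul f g x v df dg : is_derive x v f df -> is_derive x v g dg ->
  is_derive x v (fun y => f y * g y) (f x * dg + g x * df).
Proof. exact: is_deriveM. Qed.

Lemma is_derive_scale (c : R) f x v df : is_derive x v f df ->
  is_derive x v (fun y => c * f y) (c * df).
Proof. exact: is_deriveZ. Qed.

Lemma is_derive_coord i j x : is_derive x (basis_vec j) (fun y => coord y i) (j == i)%:R.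
Proof.
have : (fun h : R => h^-1 *: (((fun y => coord y i) \o shift x) (h *: basis_vec j) - coord x i))
    @ 0^' --> ((j == i)%:R : R).
  apply: (@cvg_trans _ ((fun=> (j == i)%:R : R) @ 0^')); last exact: cvg_cst.
  apply: near_eq_cvg; near=> h => /=.
  rewrite coordD coordZ coord_basis addrK scalerA mulVf ?scale1r //.
  by near: h; exact: nbhs_dnbhs_neq.
by move=> H; apply: DeriveDef; [apply: cvgP H|exact: cvg_lim H].
Unshelve. all: by end_near. Qed.

Lemma is_derive_pderivs s f i x : smooth f ->
  is_derive x (basis_vec i) (pderivs s f) (pderivs (i :: s) f x).
Proof. by move=> sf; apply: DeriveDef => //; exact: sf. Qed.

Lemma is_derive_line0 f x v d : is_derive x v f d ->
  is_derive (0 : R) 1 (fun s => f (x + s *: v)) d.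
Proof. by move=> h; apply/is_derive_lineP; rewrite scale0r addr0. Qed.

Lemma line_continuous f x v : (forall y, derivable f y v) ->
  continuous (fun t : R => f (x + t *: v)).
Proof.
move=> df t; apply: differentiable_continuous; apply/derivable1_diffP.
have h : is_derive (x + t *: v) v f ('D_v f (x + t *: v)) by exact: DeriveDef.
by case: (proj1 (is_derive_lineP _ _ _ _ _) h).
Qed.

Lemma line_lipschitz f v M x (t : R) : (forall y, derivable f y v) ->
  (forall y, `|'D_v f y| <= M) -> `|f (x + t *: v) - f x| <= M * `|t|.
Proof.
move=> df DM.
have D (s : R) : is_derive s 1 (fun t : R => f (x + t *: v)) ('D_v f (x + s *: v)).
  by apply/is_derive_lineP; exact: DeriveDef.
have C := line_continuous (x := x) df.
have [t0|t0] := leP 0 t.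
  have [c _] := MVT_segment t0 (fun s _ => D s) (continuous_subspaceT C).
  by rewrite scale0r addr0 subr0 => ->; rewrite normrM ler_wpM2r.
have [c _] := MVT_segment (ltW t0) (fun s _ => D s) (continuous_subspaceT C).
by rewrite scale0r addr0 sub0r distrC => ->; rewrite normrM normrN ler_wpM2r.
Qed.

Lemma R3_expand x y :
  y = x + (coord y 0 - coord x 0) *: basis_vec 0 + (coord y 1 - coord x 1) *: basis_vec 1
      + (coord y 2 - coord x 2) *: basis_vec 2.
Proof.
apply: R3_coord_eq => i; rewrite !coordD !coordZ !coord_basis.
by case: i => -[|[|[|//]]] h /=; rewrite !(mulr0, mulr1, addr0) addrC subrK; congr coord; apply: val_inj.
Qed.

(** The segment from x to y is replaced by three segments parallel to the axes, with the mean value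
    theorem on each; partial derivatives suffice for this. *)
Lemma partials_lipschitz f M x y : (forall y i, derivable f y (basis_vec i)) ->
  (forall y i, `|'D_(basis_vec i) f y| <= M) ->
  `|f y - f x| <= M * \sum_(i < 3) `|coord y i - coord x i|.
Proof.
move=> df DM; rewrite big3 [in f y](R3_expand x y).
set t0 := coord y 0 - _; set t1 := coord y 1 - _; set t2 := coord y 2 - _.
have h i z t := @line_lipschitz f (basis_vec i) M z t (df^~ i) (DM^~ i).
have h0 := h 0 x t0; have h1 := h 1 (x + t0 *: basis_vec 0) t1.
have h2 := h 2 (x + t0 *: basis_vec 0 + t1 *: basis_vec 1) t2.
rewrite !mulrDr; apply: le_trans (lerD (lerD h0 h1) h2).
apply: le_trans (lerD (ler_normD _ _) (lexx _)).
by apply: le_trans (ler_normD _ _); rewrite le_eqVlt; apply/orP; left; apply/eqP; congr (`|_|); ring.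
Qed.

Lemma measurable_countable_comp d (T : measurableType d) (K : countType) (h : T -> K)
    (g : K -> R) : (forall k, measurable (h @^-1` [set k])) ->
  measurable_fun setT (g \o h).
Proof.
move=> mh _ B mB; rewrite setTI.
have -> : (g \o h) @^-1` B = \bigcup_(k : K) (h @^-1` [set k] `&` [set _ | B (g k)]).
  apply/seteqP; split => x /=; first by move=> Bx; exists (h x).
  by move=> [k _ [/= -> //]].
apply: countable_bigcupT_measurable => // k.
apply: measurableI => //.
have [Bk|Bk] := pselect (B (g k)).
  by rewrite (_ : [set _ | _] = setT) //; apply/seteqP; split.
by rewrite (_ : [set _ | _] = set0) //; apply/seteqP; split.
Qed.

Lemma cvg_harmonic_bound (u : nat -> R) (l C : R) :
  (forall n, `|u n - l| <= C * n.+1%:R^-1) -> u n @[n --> \oo] --> l.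
Proof.
move=> h.
have H : C * n.+1%:R^-1 @[n --> \oo] --> (0 : R).
  by rewrite -[X in _ --> X](mulr0 C); apply: cvgM; [exact: cvg_cst|exact: cvg_harmonic].
apply: (@squeeze_cvgr _ _ _ _ (fun n => l - C * n.+1%:R^-1) (fun n => l + C * n.+1%:R^-1)).
- near=> n; have := h n; move: (C / _) => e; rewrite ler_norml => /andP[? ?].
  by apply/andP; split; lra.
- by rewrite -[X in _ --> X]subr0; apply: cvgB => //; exact: cvg_cst.
- by rewrite -[X in _ --> X]addr0; apply: cvgD => //; exact: cvg_cst.
Unshelve. all: by end_near. Qed.

(** Rounding the coordinates down to a grid of mesh 1/(n+1) gives functions that factor through
    triples of integers, hence are measurable for the product sigma-algebra, and the Lipschitz bound
    makes them converge to [f] pointwise. Functions that are only known to have bounded partial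
    derivatives become measurable in this way. *)
Lemma measurable_lipschitz (f : R3 R -> R) M :
  (forall x y, `|f y - f x| <= M * \sum_(i < 3) `|coord y i - coord x i|) ->
  @measurable_fun _ _ (RRR R) _ setT f.
Proof.
move=> lf.
pose q (n : nat) (x : R) : R := (Num.floor (n.+1%:R * x))%:~R / n.+1%:R.
pose F n (x : R3 R) := f (q n x.1.1, q n x.1.2, q n x.2).
have qx n (x : R) : `|q n x - x| <= n.+1%:R^-1.
  rewrite /q; have n0 : 0 < n.+1%:R :> R by rewrite ltr0n.
  rewrite -(ler_pM2r n0) mulVf ?gt_eqF // -[X in _ * X](gtr0_norm n0) -normrM mulrBl.
  rewrite divfK ?gt_eqF // [x * _]mulrC.
  move: (n.+1%:R * x) => z; have /andP[z1 z2] := Num.Theory.floor_itv z.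
  by rewrite intrD in z2; rewrite ler_norml; apply/andP; split; lra.
have mF n : @measurable_fun _ _ (RRR R) _ setT (F n).
  pose h (x : R3 R) : (int * int * int)%type := (Num.floor (n.+1%:R * x.1.1),
    Num.floor (n.+1%:R * x.1.2), Num.floor (n.+1%:R * x.2)).
  pose g (k : int * int * int) := f (k.1.1%:~R / n.+1%:R, k.1.2%:~R / n.+1%:R, k.2%:~R / n.+1%:R).
  apply: (@measurable_countable_comp _ (RRR R) _ h g) => -[[a b] c].
  have mfl (p : RRR R -> R) (k : int) : measurable_fun setT p ->
      measurable [set x : RRR R | Num.floor (n.+1%:R * p x) = k].
    move=> mp; pose S := [set y : R | k%:~R <= y < (k + 1)%:~R].
    have -> : [set x : RRR R | Num.floor (n.+1%:R * p x) = k] =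
        (fun x => n.+1%:R * p x) @^-1` S.
      by apply/seteqP; split => x; rewrite /S /= -Num.Theory.floor_eq => /eqP.
    rewrite -[X in measurable X]setTI.
    have mp' : measurable_fun setT (fun x => n.+1%:R * p x) by exact: measurable_funM.
    apply: mp' => //; have -> : S = `[k%:~R, (k+1)%:~R[%classic by [].
    exact: measurable_itv.
  have -> : h @^-1` [set (a, b, c)] = [set x : RRR R | Num.floor (n.+1%:R * x.1.1) = a] `&`
      [set x : RRR R | Num.floor (n.+1%:R * x.1.2) = b] `&`
      [set x : RRR R | Num.floor (n.+1%:R * x.2) = c].
    apply/seteqP; split => x /=; first by move=> [<- <- <-].
    by rewrite /h => -[[-> ->] ->].
  apply: measurableI; first apply: measurableI; apply: mfl.
  - exact: (measurableT_comp measurable_fst measurable_fst).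
  - exact: (measurableT_comp measurable_snd measurable_fst).
  - exact: measurable_snd.
apply: (@measurable_realfun.measurable_fun_cvg _ _ _ _ F) => // x _.
apply: (@cvg_harmonic_bound _ _ (`|M| * 3)) => n.
apply: (le_trans (lf _ _)); rewrite -mulrA.
apply: (@le_trans _ _ (`|M| * \sum_(i < 3) `|coord (q n x.1.1, q n x.1.2, q n x.2) i - coord x i|)).
  by apply: ler_wpM2r; [exact: sumr_ge0|exact: ler_norm].
apply: ler_wpM2l => //; rewrite big3; set y := (_, _, _).
have [-> -> ->] := coordE y; have [-> -> ->] := coordE x; rewrite /y /=.
have := qx n x.1.1; have := qx n x.1.2; have := qx n x.2.
by move: (n.+1%:R^-1) => e; lra.
Qed.

End Lines.

(** * Real Schwartz functions *)

Section RealSchwartz.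
Context {R : realType}.
Implicit Types (f g : R3 R -> R) (x y v : R3 R) (i j : 'I_3) (s w : seq 'I_3).

Definition rdecay f := forall k : nat, exists M : R, forall x, enorm x ^+ k * `|f x| <= M.
Definition rsch f := smooth f /\ forall s, rdecay (pderivs s f).

(** Naming a family indexed by words and closed under differentiation identifies all iterated
    derivatives at once, by induction on the word. The closure properties of Schwartz functions
    under sums, coordinates, reflection and Fourier integrals are each obtained by writing down such
    a family. *)
Lemma smooth_family (G : seq 'I_3 -> R3 R -> R) :
  (forall s i x, is_derive x (basis_vec i) (G s) (G (i :: s) x)) ->
  smooth (G [::]) /\ forall s, pderivs s (G [::]) = G s.
Proof.
move=> H; have E s : pderivs s (G [::]) = G s.
  elim: s => //= i s ->; apply/funext => x.
  by case: (H s i x).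
by split=> // s i x; rewrite E; case: (H s i x).
Qed.

Lemma rsch_family (G : seq 'I_3 -> R3 R -> R) :
  (forall s i x, is_derive x (basis_vec i) (G s) (G (i :: s) x)) ->
  (forall s, rdecay (G s)) -> rsch (G [::]).
Proof. by move=> /smooth_family[h E] d; split=> // s; rewrite E. Qed.

Lemma rdecayD f g : rdecay f -> rdecay g -> rdecay (fun x => f x + g x).
Proof.
move=> hf hg k; have [M hM] := hf k; have [N hN] := hg k; exists (M + N) => x.
apply: le_trans (lerD (hM x) (hN x)); rewrite -mulrDr ler_wpM2l ?ler_normD //.
exact/exprn_ge0/enorm_ge0.
Qed.

Lemma rdecayZ (c : R) f : rdecay f -> rdecay (fun x => c * f x).
Proof.
move=> hf k; have [M hM] := hf k; exists (`|c| * M) => x.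
by rewrite normrM mulrCA ler_wpM2l.
Qed.

Lemma rdecay0 : rdecay (fun=> 0).
Proof. by move=> k; exists 0 => x; rewrite normr0 mulr0. Qed.

Lemma rdecay_coord j f : rdecay f -> rdecay (fun x => coord x j * f x).
Proof.
move=> hf k; have [M hM] := hf k.+1; exists M => x; apply: le_trans (hM x).
rewrite normrM exprSr -mulrA ler_wpM2l ?exprn_ge0 ?enorm_ge0 //.
by rewrite ler_wpM2r // coord_le_enorm.
Qed.

Lemma rschD f g : rsch f -> rsch g -> rsch (fun x => f x + g x).
Proof.
move=> [sf df] [sg dg].
apply: (rsch_family (G := fun s x => pderivs s f x + pderivs s g x)).
  by move=> s i x; apply: is_derive_add; exact: is_derive_pderivs.
by move=> s; exact: rdecayD.
Qed.

Lemma rschZ (c : R) f : rsch f -> rsch (fun x => c * f x).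
Proof.
move=> [sf df].
apply: (rsch_family (G := fun s x => c * pderivs s f x)).
  by move=> s i x; apply: is_derive_scale; exact: is_derive_pderivs.
by move=> s; exact: rdecayZ.
Qed.

Lemma rschN f : rsch f -> rsch (fun x => - f x).
Proof.
by move=> /(rschZ (-1)); under [X in rsch X]eq_fun do rewrite mulN1r.
Qed.

Lemma rsch_coord j f : rsch f -> rsch (fun x => coord x j * f x).
Proof.
move=> [sf df].
(* Leibniz rule for the product of a coordinate and [f]: differentiating along the word [s] leaves,
   besides the main term, the derivatives of [f] along the words obtained by deleting one occurrence
   of [j] from [s]; [L s] lists these words. *)
pose L := fix L s : seq (seq 'I_3) := if s is i :: s' then
  (if i == j then [:: s'] else [::]) ++ map (cons i) (L s') else [::].
have key : rsch (fun x => coord x j * pderivs [::] f x + \sum_(w <- L [::]) pderivs w f x).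
  apply: (rsch_family (G := fun s x => coord x j * pderivs s f x + \sum_(w <- L s) pderivs w f x)).
    move=> s i x.
    have h1 := is_derive_mul (is_derive_coord j i x) (is_derive_pderivs s i x sf).
    have h2 (l : seq (seq 'I_3)) : is_derive x (basis_vec i) (fun y => \sum_(w <- l) pderivs w f y)
        (\sum_(w <- map (cons i) l) pderivs w f x).
      elim: l => [|w l IH].
        rewrite big_nil (_ : (fun y => _) = cst 0); first exact: is_derive_cst.
        by apply/funext => y; rewrite big_nil.
      rewrite /= big_cons (_ : (fun y => _) = (fun y => pderivs w f y + \sum_(w <- l) pderivs w f y)).
        by apply: is_derive_add => //; exact: is_derive_pderivs.
      by apply/funext => y; rewrite big_cons.
    have := is_derive_add h1 (h2 (L s)); congr is_derive.
    rewrite /= big_cat /= addrA; congr (_ + _); congr (_ + _).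
    by case: eqP => _; rewrite ?big_seq1 ?big_nil ?mulr1 ?mulr0.
  move=> s; apply: rdecayD; first exact: rdecay_coord.
  elim: (L s) => [|w l IH].
    by under [X in rdecay X]eq_fun do rewrite big_nil; exact: rdecay0.
  by under [X in rdecay X]eq_fun do rewrite big_cons; exact: rdecayD.
by move: key => /=; under [X in rsch X -> _]eq_fun do rewrite big_nil addr0.
Qed.

Lemma pderivs_cat s w f : pderivs s (pderivs w f) = pderivs (s ++ w) f.
Proof. by elim: s => //= i s ->. Qed.

Lemma rsch_pderivs s f : rsch f -> rsch (pderivs s f).
Proof.
by move=> [sf df]; split=> [w i x|w]; rewrite pderivs_cat //; exact: sf.
Qed.

Lemma rsch_bounded f : rsch f -> exists M : R, forall x, `|f x| <= M.
Proof. by move=> [_ /(_ [::] 0%N)] [M hM]; exists M => x; rewrite -[X in X <= _]mul1r -(expr0 (enorm x)). Qed.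

Lemma rsch_lipschitz f : rsch f -> exists M : R, forall x y,
  `|f y - f x| <= M * \sum_(i < 3) `|coord y i - coord x i|.
Proof.
move=> rf.
have [M0 h0] := rsch_bounded (rsch_pderivs [:: 0] rf).
have [M1 h1] := rsch_bounded (rsch_pderivs [:: 1] rf).
have [M2 h2] := rsch_bounded (rsch_pderivs [:: 2] rf).
exists (Num.max M0 (Num.max M1 M2)) => x y; apply: partials_lipschitz => {x y}.
  by move=> x i; exact: (proj1 rf [::]).
move=> x i; rewrite !le_max.
have [->|->|->] : [\/ i = 0, i = 1 | i = 2].
  by case: i => -[|[|[|//]]] ?; [constructor 1|constructor 2|constructor 3]; apply: val_inj.
- by rewrite h0.
- by rewrite h1 orbT.
- by rewrite h2 !orbT.
Qed.

Lemma rsch_measurable f : rsch f -> @measurable_fun _ _ (RRR R) _ setT f.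
Proof. by move=> /rsch_lipschitz[M h]; exact: measurable_lipschitz h. Qed.

Lemma rsch_opp f : rsch f -> rsch (fun x => f (- x)).
Proof.
move=> [sf df].
have : rsch (fun x => (-1) ^+ size (Nil 'I_3) * pderivs [::] f (- x)).
  apply: (rsch_family (G := fun s x => (-1) ^+ size s * pderivs s f (- x))).
    move=> s i x /=.
    rewrite exprSr -mulrA; apply: is_derive_scale.
    have := is_derive_pderivs s i (- x) sf.
    move=> /is_derive_line0 H.
    rewrite -[x in is_derive x _ _ _]addr0 -(scale0r (basis_vec i)).
    apply/is_derive_lineP.
    have N : is_derive (0 : R) 1 (fun t : R => - t) (-1) by exact: is_deriveN.
    have H' : is_derive (- 0 : R) 1 (fun s0 : R => pderivs s f (- x + s0 *: basis_vec i))
       (pderivs (i :: s) f (- x)) by rewrite oppr0.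
    have := is_derive1_comp H' N; rewrite mulrC; congr is_derive.
    by apply/funext => t /=; rewrite opprD scaleNr.
  move=> s k; have [M hM] := df s k; exists M => x.
  by rewrite normrM normrX normrN1 expr1n mul1r -enormN.
by rewrite /=; under [X in rsch X -> _]eq_fun do rewrite mul1r.
Qed.

End RealSchwartz.

Section Weights.
Context {R : realType}.
Implicit Types (f g : R3 R -> R) (x y v : R3 R).

(** The Cauchy density up to the factor 1/pi, and half of the Poisson kernel at height 1. The
    product of three copies is the integrable majorant of nearly all the dominated convergence
    arguments, and its integral pi^3 is explicit. *)
Definition lor (t : R) : R := (1 + t ^+ 2)^-1.

Lemma lor_gt0 t : 0 < lor t.
Proof. by rewrite invr_gt0 ltr_wpDr ?sqr_ge0. Qed.

Lemma lor_ge0 t : 0 <= lor t.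
Proof. exact/ltW/lor_gt0. Qed.

Lemma intg_lor_pi : intg (@lebesgue_measure R) lor /\ Int (@lebesgue_measure R) lor = pi.
Proof.
have E : (\int[@lebesgue_measure R]_x (lor x)%:E)%E = (pi : R)%:E.
  rewrite ge0_symfun_integralT.
  - have -> : [set x : R | 0 <= x] = `[0, +oo[%classic.
      by apply/seteqP; split => x /=; rewrite in_itv /= andbT.
    have -> : (\int[@lebesgue_measure R]_(x in `[0%R, +oo[) (lor x)%:E = (pi / 2)%:E)%E.
      exact: integral0y_oneDsqr.
    by rewrite -EFinM; congr EFin; field.
  - exact: lor_ge0.
  - exact: continuous_oneDsqrV.
  - by move=> x; rewrite /lor /= sqrrN.
split; last by rewrite /Int /Rintegral E.
apply/integrableP; split.
  apply/measurable_EFinP; apply: continuous_measurable_fun; exact: continuous_oneDsqrV.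
have -> : (\int[@lebesgue_measure R]_x `|(EFin \o lor) x| = \int[@lebesgue_measure R]_x (lor x)%:E)%E.
  by apply: eq_integral => x _ /=; rewrite ger0_norm // lor_ge0.
by rewrite E ltry.
Qed.

Lemma intg_lor : intg (@lebesgue_measure R) lor.
Proof. by case: intg_lor_pi. Qed.

Definition prod3 (g : R -> R) x : R := g x.1.1 * g x.1.2 * g x.2.

Lemma intg_prod3 (g : R -> R) : intg leb1 g -> @intg _ (RRR R) R leb3 (prod3 g).
Proof.
move=> ig.
exact: (intg_prod (m1 := sfprod leb1 leb1) (intg_prod ig ig) ig).
Qed.

Lemma Int_prod3 (g : R -> R) : intg leb1 g -> @Int _ (RRR R) R leb3 (prod3 g) = Int leb1 g ^+ 3.
Proof.
move=> ig.
have H := (Int_prod (m1 := sfprod leb1 leb1) (intg_prod ig ig) ig).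
by rewrite !exprS expr0 mulr1 mulrA -(Int_prod ig ig) -H.
Qed.

(** The product of the three factors 1 + x_i^2 is at most (1 + |x|^2)^3, and expanding this cube
    gives the coefficients 1, 3, 3, 1 and the weights up to order 6. *)
Lemma decay_lor f M0 M2 M4 M6 : (forall x, enorm x ^+ 0 * `|f x| <= M0) ->
  (forall x, enorm x ^+ 2 * `|f x| <= M2) -> (forall x, enorm x ^+ 4 * `|f x| <= M4) ->
  (forall x, enorm x ^+ 6 * `|f x| <= M6) ->
  forall x, `|f x| <= (M0 + 3 * M2 + 3 * M4 + M6) * prod3 lor x.
Proof.
move=> h0 h2 h4 h6 x.
have p0 t : 0 < 1 + t ^+ 2 :> R by rewrite ltr_wpDr ?sqr_ge0.
rewrite /prod3 /lor -!invfM ler_pdivlMr ?mulr_gt0 //.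
have := h0 x; have := h2 x; have := h4 x; have := h6 x.
rewrite (exprM _ 2 2) (exprM _ 2 3) expr0 mul1r enorm_sqr.
move: (normr_ge0 (f x)); move: `|f x| => F F0 k6 k4 k2 k0.
apply: (@le_trans _ _ ((1 + dot x x) ^+ 3 * F)); last first.
  rewrite (_ : _ ^+ 3 * F = F + 3 * (dot x x * F) + 3 * (dot x x ^+ 2 * F) + dot x x ^+ 3 * F).
    lra.
  by ring.
rewrite mulrC ler_wpM2r //.
have q t : t ^+ 2 <= dot x x -> 0 <= t ^+ 2 -> 0 <= 1 + t ^+ 2 <= 1 + dot x x.
  by move=> a b; apply/andP; split; lra.
have sq (a : R) := sqr_ge0 a.
have /andP[a0 a1] : 0 <= 1 + x.1.1 ^+ 2 <= 1 + dot x x.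
  by apply: q => //; rewrite dotE -!expr2; have := sq x.1.2; have := sq x.2; lra.
have /andP[b0 b1] : 0 <= 1 + x.1.2 ^+ 2 <= 1 + dot x x.
  by apply: q => //; rewrite dotE -!expr2; have := sq x.1.1; have := sq x.2; lra.
have /andP[c0 c1] : 0 <= 1 + x.2 ^+ 2 <= 1 + dot x x.
  by apply: q => //; rewrite dotE -!expr2; have := sq x.1.1; have := sq x.1.2; lra.
have -> : (1 + dot x x) ^+ 3 = (1 + dot x x) * (1 + dot x x) * (1 + dot x x) by ring.
apply: ler_pM => //; first exact: mulr_ge0.
exact: ler_pM.
Qed.

Lemma rdecay_lor f : rdecay f -> exists M, forall x, `|f x| <= M * prod3 lor x.
Proof.
move=> df.
have [M0 h0] := df 0%N; have [M2 h2] := df 2%N; have [M4 h4] := df 4%N; have [M6 h6] := df 6%N.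
by exists (M0 + 3 * M2 + 3 * M4 + M6); exact: decay_lor.
Qed.

Lemma intg_prod3_lor (M : R) : @intg _ (RRR R) R leb3 (fun x => M * prod3 lor x).
Proof. by apply: intgZ; apply: intg_prod3; exact: intg_lor. Qed.

Lemma intg_rdecay f : measurable_fun setT (f : RRR R -> R) -> rdecay f -> @intg _ (RRR R) R leb3 f.
Proof.
by move=> mf /rdecay_lor[M h]; apply: (intg_le mf (intg_prod3_lor M)).
Qed.

Lemma rsch_intg f : rsch f -> @intg _ (RRR R) R leb3 f.
Proof. by move=> rf; apply: intg_rdecay; [exact: rsch_measurable|exact: (proj2 rf [::])]. Qed.

End Weights.

Notation intg3 f := (@intg _ (RRR _) _ leb3 f).
Notation Int3 f := (@Int _ (RRR _) _ leb3 f).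
Notation meas3 f := (@measurable_fun _ _ (RRR _) _ setT f).

(** * Trigonometric integrals of Schwartz functions *)

Section TrigIntegrals.
Context {R : realType}.
Implicit Types (f g : R3 R -> R) (x y v xi : R3 R) (i j : 'I_3) (s w : seq 'I_3).

(** The phase covers both real Fourier integrals: [th] = 0 is the cosine transform and [th] = - pi/2
    the sine transform. Differentiation and integration by parts only move the phase by pi/2, so one
    family of lemmas serves for all of them. *)
Definition trigint (th : R) f xi : R := Int3 (fun x => cos (dot x xi + th) * f x).

Lemma measurable_dot xi : meas3 (fun x => dot x xi).
Proof.
rewrite /dot; under eq_fun do rewrite big3.
by apply: measurable_funD; first apply: measurable_funD; apply: measurable_funM => //;
  exact: measurable_coord.
Qed.

Lemma measurable_cos_dot th xi : meas3 (fun x => cos (dot x xi + th)).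
Proof.
apply: (@measurableT_comp _ _ _ _ _ _ (cos : R -> R)).
  by apply: continuous_measurable_fun; exact: continuous_cos.
by apply: measurable_funD => //; exact: measurable_dot.
Qed.

Lemma cos_le1n (t : R) : `|cos t| <= 1.
Proof. by rewrite ler_norml cos_geN1 cos_le1. Qed.

Lemma meas_trig th xi f : meas3 f -> meas3 (fun x => cos (dot x xi + th) * f x).
Proof. by move=> mf; apply: measurable_funM => //; exact: measurable_cos_dot. Qed.

Lemma intg_trig th xi f : intg3 f -> intg3 (fun x => cos (dot x xi + th) * f x).
Proof.
move=> fi; apply: (intg_le (meas_trig th xi (intg_meas fi)) (intg_norm fi)) => x.
by rewrite normrM ler_piMl // cos_le1n.
Qed.

Lemma trigint_bound th f xi : intg3 f -> `|trigint th f xi| <= Int3 (fun x => `|f x|).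
Proof.
move=> fi; apply: Int_norm_le; first exact: intg_norm.
  exact: (meas_trig th xi (intg_meas fi)).
by apply: aeW => x; rewrite normrM ler_piMl // cos_le1n.
Qed.

Lemma trigint_add th f g xi : intg3 f -> intg3 g ->
  trigint th (fun x => f x + g x) xi = trigint th f xi + trigint th g xi.
Proof.
move=> fi gi; rewrite /trigint -IntD; try exact: intg_trig.
by apply: Int_eq => x; rewrite mulrDr.
Qed.

Lemma trigint_scale th (c : R) f xi : intg3 f ->
  trigint th (fun x => c * f x) xi = c * trigint th f xi.
Proof.
move=> fi; rewrite /trigint -IntZ; last exact: intg_trig.
by apply: Int_eq => x; rewrite mulrCA.
Qed.

Lemma lor_shift (t h : R) : `|h| <= 1 -> lor (t + h) <= 3 * lor t.
Proof.
move=> h1; have p0 (u : R) : 0 < 1 + u ^+ 2 by rewrite ltr_wpDr ?sqr_ge0.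
rewrite /lor ler_pdivlMr // mulrC ler_pdivrMr // mulrC.
have : h ^+ 2 <= 1 by rewrite -[X in X <= _]real_normK ?num_real // expr_le1.
have := sqr_ge0 (t + 2 * h); nra.
Qed.

(** Compares all translates by at most 1 with one function, so that a single majorant serves for
    every h in ]-1, 1[ when the translated integral is differentiated. *)
Lemma prod3_lor_shift x i (h : R) : `|h| <= 1 ->
  prod3 lor (x + h *: basis_vec i) <= 27 * prod3 lor x.
Proof.
move=> h1.
have H (t : R) (b : bool) : lor (t + h * b%:R) <= 3 * lor t.
  apply: lor_shift; case: b; first by rewrite mulr1.
  by rewrite mulr0 normr0.
rewrite /prod3 /=.
have -> : 27 * (lor x.1.1 * lor x.1.2 * lor x.2) =
   (3 * lor x.1.1) * (3 * lor x.1.2) * (3 * lor x.2) :> R by ring.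
by apply: ler_pM; [exact/mulr_ge0/lor_ge0/lor_ge0|exact: lor_ge0| |exact: H];
  apply: ler_pM; try exact: lor_ge0; exact: H.
Qed.

(* The integral is invariant under translation, so its derivative along
   [basis_vec i] vanishes. *)
Lemma Int_deriv0 (g g' : R3 R -> R) i (M : R) :
  (forall x, is_derive x (basis_vec i) g (g' x)) -> meas3 g -> meas3 g' ->
  (forall x, `|g x| <= M * prod3 lor x) -> (forall x, `|g' x| <= M * prod3 lor x) ->
  Int3 g' = 0.
Proof.
move=> dg mg mg' bg bg'.
have gi : intg3 g by apply: (intg_le mg (intg_prod3_lor M)).
pose F (h : R) (x : R3 R) := g (x + h *: basis_vec i).
have sc h := scales_affine3 (h *: basis_vec i) (oner_neq0 R).
have E h x : F h x = g (1 *: x + h *: basis_vec i) by rewrite scale1r.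
have Fi h : intg3 (F h).
  rewrite (_ : F h = fun x => g (1 *: x + h *: basis_vec i)); last by apply/funext.
  exact: (intg_scales (sc h) gi).
have FE h : Int3 (F h) = Int3 g.
  rewrite (_ : F h = fun x => g (1 *: x + h *: basis_vec i)); last by apply/funext.
  by rewrite [RHS](Int_scales (sc h) gi) !normr1 !mul1r.
have D (h : R) x : is_derive h 1 (F ^~ x) (g' (x + h *: basis_vec i)).
  by apply/is_derive_lineP.
have M0 : 0 <= M.
  have := bg 0; have : 0 < prod3 (@lor R) 0 by rewrite !mulr_gt0 // lor_gt0.
  by move=> p /(le_trans (normr_ge0 _)); rewrite pmulr_lge0.
have p1E h x : partial1of2 F h x = g' (x + h *: basis_vec i).
  by rewrite partial1of2E; case: (D h x).
have := @differentiation_under_integral R _ (RRR R) leb3 F setT measurableT 0 (-1) 1 _ _ _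
   (fun x => 27 * (M * prod3 lor x)) _ _ _.
have -> : (fun x' : R => \int[leb3]_(y in [set: RRR R]) F x' y) = cst (Int3 g).
  by apply/funext => h; exact: FE.
rewrite derive1_cst => H; rewrite [RHS]H.
- by apply: Int_eq => x; rewrite p1E scale0r addr0.
- by rewrite /= in_itv /= ltrN10 ltr01.
- by move=> h _; exact: Fi.
- by move=> h x _ _; case: (D h x).
- by move=> x; rewrite !mulr_ge0 // lor_ge0.
- exact/intgZ/intg_prod3_lor.
- move=> h x; rewrite /= in_itv /= => /andP[h1 h2] _; rewrite p1E.
  apply: (le_trans (bg' _)); rewrite [leRHS]mulrCA ler_wpM2l //.
  by apply: prod3_lor_shift; rewrite ler_norml !ltW.
Qed.

Lemma is_derive_cos_dot th xi i x :
  is_derive x (basis_vec i) (fun y => cos (dot y xi + th))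
    (cos (dot x xi + th + pi / 2) * coord xi i).
Proof.
rewrite -[x in is_derive x _ _ _]addr0 -(scale0r (basis_vec i)).
apply/is_derive_lineP.
have H1 : is_derive (0 : R) 1 (fun t : R => dot (x + t *: basis_vec i) xi + th) (coord xi i).
  have -> : (fun t : R => dot (x + t *: basis_vec i) xi + th) =
      (fun t : R => coord xi i * t + (dot x xi + th)).
    by apply/funext => t; rewrite dotDl dotZl dot_basis; ring.
  rewrite -[X in is_derive _ _ _ X]addr0 -[X in is_derive _ _ _ (X + _)]mulr1.
  by apply: is_deriveD.
have H2 := @is_derive1_comp R cos _ 0 _ _ (is_derive_cos _) H1.
move: H2; rewrite /= scale0r addr0; congr is_derive.
by rewrite cosDpihalf.
Qed.

(** Integration by parts without boundary terms: the integral of the derivative of cos(x.xi + th -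
    pi/2) f(x) vanishes by [Int_deriv0]. The phase is lowered by pi/2 beforehand because
    differentiating the cosine raises it again to [th]. *)
Lemma trigint_mul_coord th f xi i : rsch f ->
  coord xi i * trigint th f xi = - trigint (th - pi / 2) (pderivs [:: i] f) xi.
Proof.
move=> rf; have rf' := rsch_pderivs [:: i] rf.
have [M hM] := rdecay_lor (proj2 rf [::]); have [M' hM'] := rdecay_lor (proj2 rf' [::]).
have L0 x : 0 <= prod3 lor x :> R by rewrite !mulr_ge0 // lor_ge0.
have M0 : 0 <= M.
  have := hM 0; have : 0 < prod3 (@lor R) 0 by rewrite !mulr_gt0 // lor_gt0.
  by move=> p /(le_trans (normr_ge0 _)); rewrite pmulr_lge0.
have M'0 : 0 <= M'.
  have := hM' 0; have : 0 < prod3 (@lor R) 0 by rewrite !mulr_gt0 // lor_gt0.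
  by move=> p /(le_trans (normr_ge0 _)); rewrite pmulr_lge0.
pose g x := cos (dot x xi + (th - pi / 2)) * f x.
pose g' x := cos (dot x xi + (th - pi / 2)) * pderivs [:: i] f x + coord xi i * (cos (dot x xi + th) * f x).
have I0 : Int3 g' = 0; last first.
  move: I0; rewrite /g' IntD; last 2 first.
  - exact/intg_trig/rsch_intg.
  - exact/intgZ/intg_trig/rsch_intg.
  rewrite IntZ; last exact/intg_trig/rsch_intg.
  by move=> H; apply/eqP; rewrite -subr_eq0 opprK addrC /trigint H.
apply: (@Int_deriv0 g g' i (M + M' + `|coord xi i| * M)).
- move=> x; have := is_derive_mul (is_derive_cos_dot (th - pi / 2) xi i x)
    (is_derive_pderivs [::] i x (proj1 rf)).
  congr is_derive; rewrite /g'.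
  have -> : dot x xi + (th - pi / 2) + pi / 2 = dot x xi + th by ring.
  by rewrite /=; ring.
- exact: (meas_trig _ _ (rsch_measurable rf)).
- apply: measurable_funD; first exact: (meas_trig _ _ (rsch_measurable rf')).
  by apply: measurable_funM => //; exact: (meas_trig _ _ (rsch_measurable rf)).
- move=> x; rewrite normrM; apply: (@le_trans _ _ `|f x|); first by rewrite ler_piMl // cos_le1n.
  apply: (le_trans (hM x)); rewrite ler_wpM2r // -addrA lerDl addr_ge0 // mulr_ge0 //.
- move=> x; apply: (le_trans (ler_normD _ _)); rewrite !normrM.
  apply: (@le_trans _ _ (`|pderivs [:: i] f x| + `|coord xi i| * `|f x|)).
    by apply: lerD; [rewrite ler_piMl // cos_le1n|rewrite ler_wpM2l // ler_piMl // cos_le1n].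
  have a := hM' x; have b : `|coord xi i| * `|f x| <= `|coord xi i| * (M * prod3 lor x).
    by rewrite ler_wpM2l.
  apply: (le_trans (lerD a b)); rewrite !mulrDl -mulrA lerD2r lerDr mulr_ge0 //.
Qed.

(** Differentiation under the integral sign; |x_i f(x)| dominates the derivative of the integrand
    for all xi simultaneously. *)
Lemma is_derive_trigint th f xi i : rsch f ->
  is_derive xi (basis_vec i) (trigint th f) (trigint (th + pi / 2) (fun x => coord x i * f x) xi).
Proof.
move=> rf; have rf' := rsch_coord i rf.
rewrite -[xi in is_derive xi _ _ _]addr0 -(scale0r (basis_vec i)).
apply/is_derive_lineP.
pose F (h : R) (x : R3 R) := cos (dot x (xi + h *: basis_vec i) + th) * f x.
have D (h : R) x : is_derive h 1 (F ^~ x) (cos (dot x (xi + h *: basis_vec i) + th + pi / 2) * (coord x i * f x)).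
  have := @is_derive_cos_dot th x i (xi + h *: basis_vec i).
  move=> /is_derive_lineP /(is_deriveZ (f x)).
  rewrite mulrA [_ * f x]mulrC; congr is_derive.
  by apply/funext => t; rewrite /F dotC mulrC.
  by rewrite dotC.
have p1E h x : partial1of2 F h x = cos (dot x (xi + h *: basis_vec i) + th + pi / 2) * (coord x i * f x).
  by rewrite partial1of2E; case: (D h x).
have P1 : forall x : R, `]-1, 1[%classic x -> intg3 (F x) by move=> h _; exact/intg_trig/rsch_intg.
have P2 : forall (x : R) y, `]-1, 1[%classic x -> [set: R3 R] y -> derivable (F^~ y) x 1.
  by move=> h x _ _; case: (D h x).
have P3 : intg3 (fun x => `|coord x i * f x|) by exact/intg_norm/rsch_intg.
have P4 (x : R) y : `]-1, 1[%classic x -> [set: R3 R] y -> `|partial1of2 F x y| <= `|coord y i * f y|.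
  by move=> _ _; rewrite p1E normrM ler_piMl // cos_le1n.
have I0 : `]-1, 1[%classic (0 : R) by rewrite /= in_itv /= ltrN10 ltr01.
have dF := @derivable_under_integral R _ (RRR R) leb3 F setT measurableT 0 (-1) 1 I0 P1 P2
   (fun x => `|coord x i * f x|) (fun=> normr_ge0 _) P3 P4.
have eF := @differentiation_under_integral R _ (RRR R) leb3 F setT measurableT 0 (-1) 1 I0 P1 P2
   (fun x => `|coord x i * f x|) (fun=> normr_ge0 _) P3 P4.
apply: DeriveDef; first exact: dF.
rewrite -derive1E; apply: (etrans eF).
by apply: Int_eq => x; rewrite p1E scale0r addr0 addrA.
Qed.

(** Each derivative in xi multiplies [f] by a coordinate and raises the phase by pi/2, so the
    derivatives are again trigonometric integrals of Schwartz functions and only the decay of such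
    integrals remains to be shown. *)
Lemma rsch_trigint th f : rsch f -> rsch (trigint th f).
Proof.
move=> rf.
pose X := fix X s : R3 R -> R := if s is i :: s' then (fun x => coord x i * X s' x) else f.
have rX s : rsch (X s) by elim: s => //= i s IH; exact: rsch_coord.
pose G s := trigint (th + (size s)%:R * (pi / 2)) (X s).
suff : rsch (G [::]) by rewrite /G /= mul0r addr0.
apply: rsch_family.
  move=> s i x; have := is_derive_trigint (th + (size s)%:R * (pi / 2)) x i (rX s).
  rewrite /G [size (_ :: _)]/=.
  have -> : th + (size s).+1%:R * (pi / 2) = th + (size s)%:R * (pi / 2) + pi / 2 by rewrite -natr1; ring.
  by [].
move=> s; rewrite /G; move: (th + _) => th'; move: (rX s); move: (X s) => f0 rf0 k.
(* Each power of |xi| is bounded by the sum of the |xi_i|, and every xi_i is traded for one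
   derivative of the integrated function; the induction therefore has to range over all phases and
   all Schwartz functions. *)
elim: k th' f0 rf0 => [|k IH] th' f' rf'.
  exists (Int3 (fun x => `|f' x|)) => xi; rewrite expr0 mul1r.
  exact/trigint_bound/rsch_intg.
have H i : exists M, forall xi, enorm xi ^+ k * (`|coord xi i| * `|trigint th' f' xi|) <= M.
  have [M hM] := IH (th' - pi / 2) _ (rsch_pderivs [:: i] rf'); exists M => xi.
  by rewrite -normrM trigint_mul_coord // normrN.
have [M0 h0] := H 0; have [M1 h1] := H 1; have [M2 h2] := H 2.
exists (M0 + M1 + M2) => xi.
apply: le_trans (lerD (lerD (h0 xi) (h1 xi)) (h2 xi)).
have := enorm_le_sum xi; rewrite big3.
have := exprn_ge0 k (enorm_ge0 xi); have := normr_ge0 (trigint th' f' xi); rewrite exprSr.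
move: `|trigint _ _ _| `|coord xi 0| `|coord xi 1| `|coord xi 2| => T a b c T0 e0 eabc.
have -> : enorm xi ^+ k * (a * T) + enorm xi ^+ k * (b * T) + enorm xi ^+ k * (c * T) =
  enorm xi ^+ k * (a + b + c) * T by ring.
by rewrite ler_wpM2r // ler_wpM2l.
Qed.

End TrigIntegrals.

(** * Poisson kernels and the inversion formula *)

Section PoissonKernel.
Context {R : realType}.
Implicit Types (a th e t : R).

(** The two-sided exponential and, in [poisson], its cosine transform. The primitive of the
    exponential times a cosine is elementary, and dilating the transform by e gives a multiple of
    the fixed profile [lor]. *)
Definition dexp e t : R := expR (- (e * `|t|)).
Definition poisson e a : R := 2 * e / (e ^+ 2 + a ^+ 2).

Lemma continuous_dexp e : continuous (dexp e).
Proof.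
move=> t; rewrite /dexp; apply: continuous_comp; last exact: continuous_expR.
apply: continuousN; apply: continuousM; first exact: cst_continuous.
exact: norm_continuous.
Qed.

Lemma measurable_dexp e : measurable_fun setT (dexp e).
Proof. by apply: continuous_measurable_fun; exact: continuous_dexp. Qed.

Lemma continuous_cosM a : continuous (fun t => cos (a * t)).
Proof.
move=> t; apply: continuous_comp; last exact: continuous_cos.
by apply: continuousM; first exact: cst_continuous.
Qed.

Lemma cvg_expRN e : 0 < e -> expR (- (e * t)) @[t --> +oo] --> (0 : R).
Proof.
move=> e0.
exact: (cvg_comp _ _ (gt0_cvgMry e0 cvg_id) (@cvgr_expR R)).
Qed.

Lemma der_add (f g : R -> R) t df dg : is_derive t 1 f df -> is_derive t 1 g dg ->
  is_derive t 1 (fun y => f y + g y) (df + dg).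
Proof. exact: is_deriveD. Qed.

Lemma der_mul (f g : R -> R) t df dg : is_derive t 1 f df -> is_derive t 1 g dg ->
  is_derive t 1 (fun y => f y * g y) (f t * dg + g t * df).
Proof. exact: is_deriveM. Qed.

Lemma der_scale (c : R) f t df : is_derive t 1 f df ->
  is_derive t 1 (fun y => c * f y) (c * df).
Proof. exact: is_deriveZ. Qed.

Lemma der_lin (c : R) t : is_derive t 1 (fun y => c * y) c.
Proof. by rewrite -[X in is_derive _ _ _ X]mulr1; apply: der_scale; exact: is_derive_id. Qed.

(** The 1 added to the cosine makes the integrand nonnegative, so that evenness and the fundamental
    theorem of calculus on a half-line apply before integrability is known. The extra term is
    subtracted again in [cos_dexp_int]. *)
Lemma integral_dexp_cos e a : 0 < e ->
  (\int[@lebesgue_measure R]_t (dexp e t * (1 + cos (a * t)))%:E =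
    (2 * (e^-1 + e / (e ^+ 2 + a ^+ 2)))%:E)%E.
Proof.
move=> e0.
have e2 : e ^+ 2 + a ^+ 2 != 0 by rewrite gt_eqF // ltr_wpDr ?sqr_ge0 // exprn_gt0.
rewrite ge0_symfun_integralT; last 3 first.
- by move=> t; rewrite mulr_ge0 ?expR_ge0 // -lerBlDl sub0r cos_geN1.
- move=> t; apply: continuousM; first exact: continuous_dexp.
  by apply: continuousD; [exact: cst_continuous|exact: continuous_cosM].
- by move=> t /=; rewrite /dexp normrN mulrN cosN.
have -> : [set x : R | 0 <= x] = `[0, +oo[%classic.
  by apply/seteqP; split => x /=; rewrite in_itv /= andbT.
pose F t : R := (- e^-1) * expR (- e * t) +
  (e ^+ 2 + a ^+ 2)^-1 * (expR (- e * t) * (a * sin (a * t) + - e * cos (a * t))).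
have D t : is_derive t 1 F (expR (- e * t) * (1 + cos (a * t))).
  have D1 : is_derive t 1 (fun t => expR (- e * t)) (expR (- e * t) * - e).
    exact: (is_derive1_comp (is_derive_expR _) (der_lin _ _)).
  have D2 : is_derive t 1 (fun t => sin (a * t)) (cos (a * t) * a).
    exact: (is_derive1_comp (is_derive_sin _) (der_lin _ _)).
  have D3 : is_derive t 1 (fun t => cos (a * t)) (- sin (a * t) * a).
    exact: (is_derive1_comp (is_derive_cos _) (der_lin _ _)).
  have := der_add (der_scale (- e^-1) D1) (der_scale (e ^+ 2 + a ^+ 2)^-1
    (der_mul D1 (der_add (der_scale a D2) (der_scale (- e) D3)))).
  by congr is_derive; field; rewrite e2 gt_eqF.
have -> : (\int[@lebesgue_measure R]_(t in `[0%R, +oo[) (dexp e t * (1 + cos (a * t)))%:E =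
    \int[@lebesgue_measure R]_(t in `[0%R, +oo[) (expR (- e * t) * (1 + cos (a * t)))%:E)%E.
  apply: eq_integral => t; rewrite inE /= in_itv /= andbT => t0.
  by rewrite /dexp ger0_norm // mulNr.
have E0 : expR (- e * t) @[t --> +oo] --> (0 : R).
  by under eq_fun do rewrite mulNr; exact: cvg_expRN.
rewrite (@ge0_continuous_FTC2y _ _ F 0 0).
- have -> : F 0 = - e^-1 - e / (e ^+ 2 + a ^+ 2).
    by rewrite /F !mulr0 expR0 sin0 cos0; field; rewrite e2 gt_eqF.
  by rewrite sub0e -EFinN -EFinM; congr EFin; rewrite opprD !opprK.
- by move=> t _; rewrite mulr_ge0 ?expR_ge0 // -lerBlDl sub0r cos_geN1.
- have C : continuous (fun t => expR (- e * t) * (1 + cos (a * t))).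
    have C1 : continuous (fun t => expR (- e * t)).
      move=> t; apply: continuous_comp; last exact: continuous_expR.
      by apply: continuousM; first exact: cst_continuous.
    have C2 : continuous (fun t => 1 + cos (a * t)).
      by move=> t; apply: continuousD; [exact: cst_continuous|exact: continuous_cosM].
    by move=> t; exact: (continuousM (C1 t) (C2 t)).
  exact: (continuous_subspaceT C).
- rewrite /F.
  have -> : (0 : R) = (- e^-1) * 0 + (e ^+ 2 + a ^+ 2)^-1 * 0 by rewrite !mulr0 addr0.
  apply: cvgD; apply: cvgM; try exact: cvg_cst; first exact: E0.
  have B t : `|a * sin (a * t) + - e * cos (a * t)| <= `|a| + `|e|.
    apply: (le_trans (ler_normD _ _)); rewrite !normrM normrN.
    apply: lerD; rewrite ler_piMr // ?cos_le1n //.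
    by rewrite ler_norml sin_geN1 sin_le1.
  apply: (@squeeze_cvgr _ _ _ _ (fun t => - ((`|a| + `|e|) * expR (- e * t)))
    (fun t => (`|a| + `|e|) * expR (- e * t))).
  + near=> t; rewrite -ler_norml normrM mulrC ler_pM //.
    by rewrite ger0_norm ?expR_ge0.
  + have -> : (0 : R) = - ((`|a| + `|e|) * 0) by rewrite mulr0 oppr0.
    by apply: cvgN; apply: cvgM; first exact: cvg_cst.
  + have -> : (0 : R) = ((`|a| + `|e|) * 0) by rewrite mulr0.
    by apply: cvgM; first exact: cvg_cst.
- by move=> t _; case: (D t).
- apply: cvg_at_right_filter; apply: differentiable_continuous; apply/derivable1_diffP.
  by case: (D 0).
- by move=> t _; rewrite derive1E; case: (D t).
Unshelve. all: by end_near. Qed.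

Lemma intg_dexp_ge0 e (f : R -> R) (c : R) : measurable_fun setT f -> (forall t, 0 <= f t) ->
  (\int[@lebesgue_measure R]_t (f t)%:E = c%:E)%E ->
  intg (@lebesgue_measure R) f /\ Int (@lebesgue_measure R) f = c.
Proof.
move=> mf f0 E; split; last by rewrite /Int /Rintegral E.
apply/integrableP; split; first exact/measurable_EFinP.
have -> : (\int[@lebesgue_measure R]_x `|(EFin \o f) x| = \int[@lebesgue_measure R]_x (f x)%:E)%E.
  by apply: eq_integral => x _ /=; rewrite ger0_norm.
by rewrite E ltry.
Qed.

Lemma dexp_int e : 0 < e -> intg leb1 (dexp e) /\ Int leb1 (dexp e) = 2 / e.
Proof.
move=> e0.
have [i h] : intg (@lebesgue_measure R) (fun t => 2 * dexp e t) /\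
    Int (@lebesgue_measure R) (fun t => 2 * dexp e t) = 4 / e.
  apply: (intg_dexp_ge0 e).
  - by apply: measurable_funM => //; exact: measurable_dexp.
  - by move=> t; rewrite mulr_ge0 ?expR_ge0.
  - have := integral_dexp_cos 0 e0.
    under eq_integral do rewrite mul0r cos0 mulrC -[1 + 1]/(2%:R).
    by move=> ->; congr EFin; field; rewrite gt_eqF.
have i' : intg leb1 (dexp e).
  have := intgZ 2^-1 i; congr intg; apply/funext => t.
  by rewrite mulKf.
split=> //; apply: (@mulfI _ 2) => //.
by rewrite -IntZ // h; field; rewrite gt_eqF.
Qed.

Lemma cos_dexp_int e a th : 0 < e ->
  intg leb1 (fun t => cos (a * t + th) * dexp e t) /\
  Int leb1 (fun t => cos (a * t + th) * dexp e t) = cos th * poisson e a.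
Proof.
move=> e0; have [ie Ee] := dexp_int e0.
have mcos th' : measurable_fun setT (fun t => cos (a * t + th')).
  apply: continuous_measurable_fun => t; apply: continuous_comp; last exact: continuous_cos.
  apply: continuousD; last exact: cst_continuous.
  by apply: continuousM; first exact: cst_continuous.
have I th' : intg leb1 (fun t => cos (a * t + th') * dexp e t).
  have m := measurable_funM (mcos th') (measurable_dexp e).
  apply: (@intg_le _ (measurableTypeR R) R leb1 _ _ m ie) => t.
  by  rewrite normrM [`|dexp e t|]ger0_norm ?expR_ge0 // ler_piMl ?expR_ge0 // cos_le1n.
split; first exact: I.
have E0 : Int leb1 (fun t => cos (a * t + 0) * dexp e t) = poisson e a.
  have [i h] : intg (@lebesgue_measure R) (fun t => dexp e t * (1 + cos (a * t))) /\
    Int (@lebesgue_measure R) (fun t => dexp e t * (1 + cos (a * t))) =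
      2 * (e^-1 + e / (e ^+ 2 + a ^+ 2)).
    apply: (intg_dexp_ge0 e).
    - apply: measurable_funM; first exact: measurable_dexp.
      by apply: measurable_funD => //; have := mcos 0; under eq_fun do rewrite addr0.
    - by move=> t; rewrite mulr_ge0 ?expR_ge0 // -lerBlDl sub0r cos_geN1.
    - exact: integral_dexp_cos.
  have -> : (fun t => cos (a * t + 0) * dexp e t) = (fun t => dexp e t * (1 + cos (a * t)) - dexp e t).
    by apply/funext => t; rewrite addr0; ring.
  rewrite IntB // h Ee /poisson; field.
  by rewrite !gt_eqF // ltr_wpDr ?sqr_ge0 // exprn_gt0.
have N1 : (-1 : R) != 0 by rewrite oppr_eq0 oner_eq0.
have sc := scales_affine 0 N1.
(* Reflecting t changes the sign of the phase. The average of the integrals with phases th and - th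
   contains cos(a t + th) + cos(a t - th) = 2 cos(a t) cos th, which separates the factor cos th. *)
have ER : Int leb1 (fun t => cos (a * t + th) * dexp e t) =
    Int leb1 (fun t => cos (a * t - th) * dexp e t).
  rewrite (Int_scales sc (I th)) normrN normr1 mul1r; apply: Int_eq => t.
  rewrite addr0 mulN1r /dexp normrN mulrN -cosN; congr (cos _ * _); ring.
apply: (@mulfI _ 2) => //; rewrite mulr_natl mulr2n {2}ER -IntD // -E0 mulrA -IntZ //.
by apply: Int_eq => t; rewrite addr0 cosD cosB; ring.
Qed.

End PoissonKernel.

Section Inversion.
Context {R : realType}.
Implicit Types (f g : R3 R -> R) (x y v xi : R3 R) (th e : R).

Lemma Int3_fubini f : intg3 f ->
  Int3 f = @Int _ (measurableTypeR R * measurableTypeR R)%type R (leb1 \x leb1)%E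
    (fun p => Int leb1 (fun z => f (p, z))).
Proof. exact: (Int_fubini1 (m1 := sfprod leb1 leb1)). Qed.

(** Because the phase is arbitrary, the coordinates are integrated one at a time, the contributions
    of the remaining ones being absorbed in the phase. *)
Lemma cos_dexp3_int e a th : 0 < e ->
  Int3 (fun xi => cos (dot a xi + th) * prod3 (dexp e) xi) = cos th * prod3 (poisson e) a.
Proof.
move=> e0; have [ie Ee] := dexp_int e0.
have I : intg3 (fun xi => cos (dot a xi + th) * prod3 (dexp e) xi).
  have := intg_trig th a (intg_prod3 ie); congr intg; apply/funext => x.
  by rewrite dotC.
rewrite (Int3_fubini I) /prod3 /=.
have st (th' a' : R) (k : R) : Int leb1 (fun z => cos (a' * z + th') * (k * dexp e z)) =
    k * (cos th' * poisson e a').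
  have [i1 <-] := cos_dexp_int a' th' e0.
  by rewrite -IntZ //; apply: Int_eq => z; rewrite mulrCA.
have E1 p : Int leb1 (fun z => cos (dot a (p, z) + th) * (dexp e p.1 * dexp e p.2 * dexp e z)) =
    poisson e a.2 * (cos (a.1.1 * p.1 + (a.1.2 * p.2 + th)) * (dexp e p.1 * dexp e p.2)).
  transitivity (Int leb1 (fun z => cos (a.2 * z + (a.1.1 * p.1 + (a.1.2 * p.2 + th))) *
      (dexp e p.1 * dexp e p.2 * dexp e z))).
    by apply: Int_eq => z; rewrite dotE /=; congr (cos _ * _); ring.
  by rewrite st; ring.
pose I2 := @Int _ (measurableTypeR R * measurableTypeR R)%type R (leb1 \x leb1)%E.
pose i2 := @intg _ (measurableTypeR R * measurableTypeR R)%type R (leb1 \x leb1)%E.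
pose h (p : R * R) := cos (a.1.1 * p.1 + (a.1.2 * p.2 + th)) * (dexp e p.1 * dexp e p.2).
have ih : i2 h.
  have mlin : @measurable_fun _ _ (measurableTypeR R * measurableTypeR R)%type _ setT
      (fun p : R * R => a.1.1 * p.1 + (a.1.2 * p.2 + th)).
    apply: measurable_funD; first by apply: measurable_funM => //; exact: measurable_fst.
    by apply: measurable_funD => //; apply: measurable_funM => //; exact: measurable_snd.
  have mc : @measurable_fun _ _ (measurableTypeR R * measurableTypeR R)%type _ setT
      (fun p : R * R => cos (a.1.1 * p.1 + (a.1.2 * p.2 + th))).
    apply: (measurableT_comp _ mlin).
    by apply: continuous_measurable_fun; exact: continuous_cos.
  have id2 := intg_prod ie ie.
  apply: (intg_le (measurable_funM mc (intg_meas id2)) id2) => p.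
  rewrite normrM [`|dexp e p.1 * dexp e p.2|]ger0_norm ?mulr_ge0 ?expR_ge0 //.
  by rewrite ler_piMl ?mulr_ge0 ?expR_ge0 ?cos_le1n.
transitivity (I2 (fun p => poisson e a.2 * h p)); first exact: Int_eq.
rewrite /I2 IntZ // (Int_fubini1 ih).
have E2 (x : R) : Int leb1 (fun y : R => h (x, y)) =
    poisson e a.1.2 * (cos (a.1.1 * x + th) * dexp e x).
  transitivity (Int leb1 (fun y : R => cos (a.1.2 * y + (a.1.1 * x + th)) * (dexp e x * dexp e y))).
    by apply: Int_eq => y; rewrite /h /=; congr (cos _ * _); ring.
  by rewrite st; ring.
transitivity (poisson e a.2 * Int leb1 (fun x : R => poisson e a.1.2 * (cos (a.1.1 * x + th) * dexp e x))).
  by congr (_ * _); exact: Int_eq.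
have [i1 E3] := cos_dexp_int a.1.1 th e0.
by rewrite IntZ // E3; ring.
Qed.

Notation RRR' := (measurableTypeR R * measurableTypeR R * measurableTypeR R)%type.

Lemma measurable_dot2 : @measurable_fun _ _ (RRR' * RRR')%type _ setT
  (fun p : R3 R * R3 R => dot p.1 p.2).
Proof.
rewrite /dot; under eq_fun do rewrite big3.
have m1 i : @measurable_fun _ _ (RRR' * RRR')%type _ setT (fun p : R3 R * R3 R => coord p.1 i).
  exact: (measurableT_comp (measurable_coord i) measurable_fst).
have m2 i : @measurable_fun _ _ (RRR' * RRR')%type _ setT (fun p : R3 R * R3 R => coord p.2 i).
  exact: (measurableT_comp (measurable_coord i) measurable_snd).
by apply: measurable_funD; first apply: measurable_funD; apply: measurable_funM.
Qed.

(** The addition formula for the cosine: this is the real form of multiplying the transform of [f]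
    at xi by an exponential, the phase [th] choosing the component that is read off. *)
Lemma trig_bracket f x xi th : intg3 f ->
  cos (dot xi x - th) * trigint 0 f xi + cos (dot xi x - th - pi / 2) * trigint (- (pi / 2)) f xi =
  Int3 (fun y => cos (dot y xi + (th - dot x xi)) * f y).
Proof.
move=> fi; rewrite /trigint -!IntZ; try exact: intg_trig.
rewrite -IntD; try by apply: intgZ; exact: intg_trig.
apply: Int_eq => y; rewrite addr0 !mulrA -mulrDl; congr (_ * _).
rewrite (dotC x); move: (dot xi x) (dot y xi) => A B.
have -> : B + (th - A) = B - (A - th) by ring.
have h t : cos (t - pi / 2) = sin t :> R by rewrite cosB cos_pihalf sin_pihalf; ring.
by rewrite !h (cosB B); ring.
Qed.

(** After Fubini, the integral over xi gives the product of Poisson kernels centred at x. The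
    substitution y = e z + x turns it into a fixed profile, since e times [poisson e (e * t)] is 2
    [lor t]; the three factors 2 make the 8, and e survives only in the argument of [f]. *)
Lemma cos_gauss_swap f x th e : 0 < e -> rsch f ->
  Int3 (fun xi => prod3 (dexp e) xi * Int3 (fun y => cos (dot y xi + (th - dot x xi)) * f y)) =
  Int3 (fun z => f (e *: z + x) * (cos th * 8 * prod3 lor z)).
Proof.
move=> e0 rf; have fi := rsch_intg rf; have [ie Ee] := dexp_int e0; have ie3 := intg_prod3 ie.
have mfst : @measurable_fun _ _ (RRR' * RRR')%type RRR' setT fst by exact: measurable_fst.
have msnd : @measurable_fun _ _ (RRR' * RRR')%type RRR' setT snd by exact: measurable_snd.
have sw := @Int_swap _ _ RRR' RRR' R (sfprod (sfprod leb1 leb1) leb1) (sfprod (sfprod leb1 leb1) leb1)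
  (fun p => prod3 (dexp e) p.1 * (cos (dot p.2 p.1 + (th - dot x p.1)) * f p.2))
  (prod3 (dexp e)) (fun y => `|f y|) _ ie3 (intg_norm fi) _.
transitivity (Int3 (fun xi => Int3 (fun y =>
    prod3 (dexp e) xi * (cos (dot y xi + (th - dot x xi)) * f y)))).
  by apply: Int_eq => xi; rewrite IntZ //; exact: intg_trig.
rewrite {}sw; last 2 first.
- apply: measurable_funM; first exact: (measurableT_comp (intg_meas ie3) mfst).
  apply: measurable_funM; last exact: (measurableT_comp (intg_meas fi) msnd).
  apply: (measurableT_comp (f := (cos : R -> R))).
    by apply: continuous_measurable_fun; exact: continuous_cos.
  apply: measurable_funD.
    by under eq_fun do rewrite dotC; exact: measurable_dot2.
  apply: measurable_funB => //.
  have := measurableT_comp (measurable_dot x) mfst.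
  by congr measurable_fun; apply/funext => p /=; rewrite dotC.
- move=> xi y /=; rewrite normrM ger0_norm ?mulr_ge0 ?expR_ge0 //.
  by rewrite ler_wpM2l ?mulr_ge0 ?expR_ge0 // normrM ler_piMl // cos_le1n.
have I1 y : Int3 (fun xi => prod3 (dexp e) xi * (cos (dot y xi + (th - dot x xi)) * f y)) =
    f y * (cos th * prod3 (poisson e) (y - x)).
  rewrite -cos_dexp3_int // -IntZ.
    apply: Int_eq => xi; rewrite dotDl -[- x]scaleN1r dotZl mulN1r.
    have -> : dot y xi + (th - dot x xi) = dot y xi - dot x xi + th by ring.
    by ring.
  have := intg_trig th (y - x) ie3; congr intg; apply/funext => xi.
  by rewrite dotC.
transitivity (Int3 (fun y => f y * (cos th * prod3 (poisson e) (y - x)))).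
  exact: Int_eq.
have ne0 : e != 0 by rewrite gt_eqF.
have sc := scales_affine3 x ne0.
have mpo : meas3 (fun y => prod3 (poisson e) (y - x)).
  have mp : measurable_fun setT (poisson e).
    apply: continuous_measurable_fun => t; apply: cvgM; first exact: cvg_cst.
    apply: cvgV; first by rewrite gt_eqF // ltr_wpDr ?sqr_ge0 // exprn_gt0.
    by apply: cvgD; [exact: cvg_cst|exact: exprn_continuous].
  have mp3 : meas3 (prod3 (poisson e)).
    apply: measurable_funM; first apply: measurable_funM.
    - exact: (measurableT_comp mp (measurableT_comp measurable_fst measurable_fst)).
    - exact: (measurableT_comp mp (measurableT_comp measurable_snd measurable_fst)).
    - exact: (measurableT_comp mp measurable_snd).
  have [ma _ _] := scales_affine3 (- x) (oner_neq0 R).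
  by have := measurableT_comp mp3 ma; congr measurable_fun; apply/funext => y /=; rewrite scale1r.
have po_le (t : R) : 0 <= poisson e t <= 2 / e.
  rewrite /poisson; have p0 : 0 < e ^+ 2 + t ^+ 2 by rewrite ltr_wpDr ?sqr_ge0 ?exprn_gt0.
  apply/andP; split; first by rewrite divr_ge0 ?ltW // mulr_gt0.
  rewrite ler_pdivrMr // mulrAC ler_pdivlMr // -mulrA ler_pM2l // -expr2 lerDl sqr_ge0 //.
have Ig : intg3 (fun y => f y * (cos th * prod3 (poisson e) (y - x))).
  apply: (@intg_le _ (RRR R) R leb3 _ (fun y => (2 / e) ^+ 3 * `|f y|)).
  - by apply: measurable_funM; [exact: (intg_meas fi)|exact: measurable_funM].
  - exact/intgZ/intg_norm.
  - move=> y; rewrite normrM mulrC ler_wpM2r // normrM.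
    rewrite (@le_trans _ _ `|prod3 (poisson e) (y - x)|) ?ler_piMl ?cos_le1n //.
    rewrite /prod3; have /andP[a0 a1] := po_le (y - x).1.1.
    have /andP[b0 b1] := po_le (y - x).1.2; have /andP[c0 c1] := po_le (y - x).2.
    have -> : (2 / e) ^+ 3 = 2 / e * (2 / e) * (2 / e) by ring.
    rewrite ger0_norm; last by apply: mulr_ge0 => //; exact: mulr_ge0.
    by apply: ler_pM => //; [exact: mulr_ge0|exact: ler_pM].
rewrite (Int_scales sc Ig) gtr0_norm //.
rewrite -IntZ; last exact: (intg_scales sc Ig).
apply: Int_eq => z; rewrite addrK /prod3 /= /poisson /lor.
have pz (t : R) : e ^+ 2 + (e * t) ^+ 2 = e ^+ 2 * (1 + t ^+ 2) by ring.
have n0 (t : R) : 1 + t ^+ 2 != 0 by rewrite gt_eqF // ltr_wpDr ?sqr_ge0.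
rewrite /GRing.scale /= !pz; field.
by rewrite ne0 !n0.
Qed.

(** Both sides of [cos_gauss_swap] are taken along e = 1/(n+1). The regularising factor tends to 1
    under the integral on the left; on the right [f] is evaluated at points tending to x, and 8
    times the integral pi^3 of the profile is (2 pi)^3. *)
Lemma fourier_inversion_real f x th : rsch f ->
  Int3 (fun xi => cos (dot xi x - th) * trigint 0 f xi +
    cos (dot xi x - th - pi / 2) * trigint (- (pi / 2)) f xi) =
  (2 * pi) ^+ 3 * cos th * f x.
Proof.
move=> rf; have fi := rsch_intg rf.
pose K xi := cos (dot xi x - th) * trigint 0 f xi +
    cos (dot xi x - th - pi / 2) * trigint (- (pi / 2)) f xi.
have KE xi : K xi = Int3 (fun y => cos (dot y xi + (th - dot x xi)) * f y) by exact: trig_bracket.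
have Ki : intg3 K.
  apply: intgD; first exact/intg_trig/rsch_intg/rsch_trigint.
  have := intg_trig (- th - pi / 2) x (rsch_intg (rsch_trigint (- (pi / 2)) rf)).
  by congr intg; apply/funext => xi; rewrite addrA.
pose ep (n : nat) : R := n.+1%:R^-1.
have ep0 n : 0 < ep n by rewrite invr_gt0 ltr0n.
have cep : ep n @[n --> \oo] --> (0 : R) by exact: cvg_harmonic.
have c1 : Int3 (fun xi => prod3 (dexp (ep n)) xi * K xi) @[n --> \oo] --> Int3 K.
  apply: (@Int_dct _ (RRR R) R leb3 _ K (fun xi => `|K xi|)).
  - move=> n; apply: measurable_funM; last exact: (intg_meas Ki).
    exact: (intg_meas (intg_prod3 (proj1 (dexp_int (ep0 n))))).
  - exact: (intg_meas Ki).
  - exact: intg_norm.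
  - move=> n; apply: aeW => xi; rewrite normrM ler_piMl //.
    have d1 (t : R) : 0 <= dexp (ep n) t <= 1.
      by rewrite expR_ge0 -expR0 ler_expR oppr_le0 mulr_ge0 // ltW.
    rewrite /prod3; have /andP[a0 a1] := d1 xi.1.1.
    have /andP[b0 b1] := d1 xi.1.2; have /andP[e0 e1] := d1 xi.2.
    by rewrite ger0_norm ?mulr_ge0 // !mulr_ile1 // mulr_ge0.
  - apply: aeW => xi; rewrite -[X in _ --> X]mul1r; apply: cvgM; last exact: cvg_cst.
    have d1 (t : R) : dexp (ep n) t @[n --> \oo] --> (1 : R).
      rewrite -expR0; apply: (@cvg_comp _ _ _ (fun n => - (ep n * `|t|)) expR); last exact: continuous_expR.
      rewrite -oppr0; apply: cvgN; rewrite -(mul0r `|t|); apply: cvgM => //; exact: cvg_cst.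
    have -> : (1 : R) = 1 * 1 * 1 by rewrite !mulr1.
    rewrite /prod3.
    by apply: cvgM; first apply: cvgM; exact: d1.
have [M hM] := rsch_bounded rf.
have [L hL] := rsch_lipschitz rf.
have c2 : Int3 (fun xi => prod3 (dexp (ep n)) xi * K xi) @[n --> \oo] -->
    Int3 (fun z => f x * (cos th * 8 * prod3 lor z)).
  have -> : (fun n => Int3 (fun xi => prod3 (dexp (ep n)) xi * K xi)) =
      (fun n => Int3 (fun z => f (ep n *: z + x) * (cos th * 8 * prod3 lor z))).
    apply/funext => n; rewrite -cos_gauss_swap //.
    by apply: Int_eq => xi; rewrite KE.
  have ml : meas3 (fun z => cos th * 8 * prod3 lor z) by exact: (intg_meas (intg_prod3_lor _)).
  apply: (@Int_dct _ (RRR R) R leb3 _ _ (fun z => (M * 8) * prod3 lor z)).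
  - move=> n; apply: measurable_funM => //.
    have en0 : ep n != 0 by rewrite gt_eqF.
    have [ma _ _] := scales_affine3 x en0.
    exact: (measurableT_comp (intg_meas fi) ma).
  - exact: measurable_funM.
  - exact: intg_prod3_lor.
  - move=> n; apply: aeW => z; rewrite normrM -(mulrA M) ler_pM //.
    rewrite (normrM (cos th * 8)) (normrM (cos th)) (@ger0_norm _ (prod3 lor z)) ?mulr_ge0 ?lor_ge0 // ler_wpM2r ?mulr_ge0 ?lor_ge0 //.
    by rewrite (@ger0_norm _ 8) // ler_piMl // cos_le1n.
  - apply: aeW => z; apply: cvgM; last exact: cvg_cst.
    apply: (@cvg_harmonic_bound _ _ _ (L * \sum_(i < 3) `|coord z i|)) => n.
    apply: (le_trans (hL _ _)); rewrite -mulrA mulr_suml le_eqVlt; apply/orP; left; apply/eqP.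
    congr (_ * _); apply: eq_bigr => i _; by rewrite coordD coordZ addrK normrM mulrC (gtr0_norm (ep0 n)).
rewrite -/K (cvg_unique _ c1 c2) //.
rewrite IntZ; last exact: intg_prod3_lor.
rewrite IntZ; last exact: (intg_prod3 intg_lor).
rewrite (Int_prod3 intg_lor) (proj2 intg_lor_pi); ring.
Qed.

End Inversion.

Local Open Scope complex_scope.

Local Notation Re := complex.Re.
Local Notation Im := complex.Im.
Local Notation normc := Normc.normc.

(** * Fourier inversion *)

Section ComplexBasics.
Context {R : realType}.
Implicit Types (z w : R[i]).

Lemma ReD z w : Re (z + w) = Re z + Re w. Proof. by case: z; case: w. Qed.
Lemma ImD z w : Im (z + w) = Im z + Im w. Proof. by case: z; case: w. Qed.
Lemma ReN z : Re (- z) = - Re z. Proof. by case: z. Qed.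
Lemma ImN z : Im (- z) = - Im z. Proof. by case: z. Qed.
Lemma ReM z w : Re (z * w) = Re z * Re w - Im z * Im w. Proof. by case: z; case: w. Qed.
Lemma ImM z w : Im (z * w) = Re z * Im w + Im z * Re w. Proof. by case: z; case: w. Qed.
Lemma complex_eq z w : Re z = Re w -> Im z = Im w -> z = w.
Proof. by case: z => a b; case: w => c d /= -> ->. Qed.

Lemma normc_sqr z : normc z ^+ 2 = Re z ^+ 2 + Im z ^+ 2.
Proof. by case: z => a b /=; rewrite sqr_sqrtr // addr_ge0 ?sqr_ge0. Qed.

Lemma normc_ge0 z : 0 <= normc z.
Proof. by case: z => a b; exact: sqrtr_ge0. Qed.

Lemma Re_le_normc z : `|Re z| <= normc z.
Proof.
rewrite -(@ler_pXn2r _ 2) ?nnegrE ?normc_ge0 // normc_sqr real_normK ?num_real //.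
by rewrite lerDl sqr_ge0.
Qed.

Lemma Im_le_normc z : `|Im z| <= normc z.
Proof.
rewrite -(@ler_pXn2r _ 2) ?nnegrE ?normc_ge0 // normc_sqr real_normK ?num_real //.
by rewrite lerDr sqr_ge0.
Qed.

Lemma normc_le_ReIm z : normc z <= `|Re z| + `|Im z|.
Proof.
rewrite -(@ler_pXn2r _ 2) ?nnegrE ?normc_ge0 ?addr_ge0 // normc_sqr.
rewrite sqrrD !real_normK ?num_real // lerD2r lerDl.
by rewrite mulrn_wge0 // mulr_ge0.
Qed.

Lemma normc_real (r : R) : normc r%:C = `|r|.
Proof. by rewrite /= expr0n /= addr0 sqrtr_sqr. Qed.

Lemma normcMr (r : R) z : normc (r%:C * z) = `|r| * normc z.
Proof. by rewrite Normc.normcM normc_real. Qed.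

End ComplexBasics.

Section ComplexSchwartz.
Context {R : realType}.
Local Notation C := (R[i]).
Implicit Types (phi psi : R3 R -> C) (x xi : R3 R).

Lemma schwartzP phi : schwartz phi <-> rsch (fun x => Re (phi x)) /\ rsch (fun x => Im (phi x)).
Proof.
split.
  move=> [sr si H]; split; split => // s k; have [M hM] := H s k; exists M => x;
    apply: le_trans (hM x); rewrite ler_wpM2l ?exprn_ge0 ?enorm_ge0 //.
  - exact: (Re_le_normc (cpderivs s phi x)).
  - exact: (Im_le_normc (cpderivs s phi x)).
move=> [[sr dr] [si di]]; split=> // s k.
have [M hM] := dr s k; have [N hN] := di s k; exists (M + N) => x.
apply: le_trans (lerD (hM x) (hN x)); rewrite -mulrDr ler_wpM2l ?exprn_ge0 ?enorm_ge0 //.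
exact: (normc_le_ReIm (cpderivs s phi x)).
Qed.

Lemma schwartz_opp phi : schwartz phi -> schwartz (fun x => phi (- x)).
Proof.
move=> /schwartzP[r i]; apply/schwartzP; split; [exact: (rsch_opp r)|exact: (rsch_opp i)].
Qed.

Definition conjf phi x : C := Re (phi x) -i* Im (phi x).

Lemma schwartz_conj phi : schwartz phi -> schwartz (conjf phi).
Proof. by move=> /schwartzP[r i]; apply/schwartzP; split => //=; exact: rschN. Qed.

Definition fc : R := (2 * pi) `^ (- (3 / 2)).

Lemma fc_gt0 : 0 < fc.
Proof. by rewrite powR_gt0 // mulr_gt0 // pi_gt0. Qed.

Lemma fc_sqr : fc ^+ 2 * (2 * pi) ^+ 3 = 1.
Proof.
have p0 : 0 < 2 * pi :> R by rewrite mulr_gt0 // pi_gt0.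
rewrite /fc -!powR_mulrn ?powR_ge0 ?ltW // -powRrM -powRD; last by rewrite (gt_eqF p0) implybT.
by rewrite (_ : - (3 / 2) * 2 + 3 = 0 :> R) ?powRr0 //; field.
Qed.

Lemma Re_fourier phi xi : schwartz phi -> Re (fourier phi xi) =
  fc * (trigint 0 (fun x => Re (phi x)) xi + trigint (- (pi / 2)) (fun x => Im (phi x)) xi).
Proof.
move=> /schwartzP[r i].
rewrite /fourier ReM /= mul0r subr0; congr (_ * _).
rewrite -IntD; try exact/intg_trig/rsch_intg.
apply: Int_eq => x; rewrite ReM /= addr0 cosB cos_pihalf sin_pihalf; ring.
Qed.

Lemma Im_fourier phi xi : schwartz phi -> Im (fourier phi xi) =
  fc * (trigint 0 (fun x => Im (phi x)) xi - trigint (- (pi / 2)) (fun x => Re (phi x)) xi).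
Proof.
move=> /schwartzP[r i].
rewrite /fourier ImM /= mul0r addr0; congr (_ * _).
rewrite -IntB; try exact/intg_trig/rsch_intg.
apply: Int_eq => x; rewrite ImM /= addr0 cosB cos_pihalf sin_pihalf; ring.
Qed.

Lemma schwartz_fourier phi : schwartz phi -> schwartz (fourier phi).
Proof.
move=> sp; have /schwartzP[r i] := sp; apply/schwartzP; split.
  under [X in rsch X]eq_fun do rewrite (Re_fourier _ sp).
  by apply: rschZ; apply: rschD; exact: rsch_trigint.
under [X in rsch X]eq_fun do rewrite (Im_fourier _ sp).
by apply: rschZ; apply: rschD; last apply: rschN; exact: rsch_trigint.
Qed.

Lemma trigint_opp th (f : R3 R -> R) xi : trigint th f (- xi) = trigint (- th) f xi.
Proof.
apply: Int_eq => x; congr (_ * _); rewrite -cosN; congr cos.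
by rewrite dotC -[- xi]scaleN1r dotZl dotC; ring.
Qed.

Lemma trigint_pi th (f : R3 R -> R) xi : rsch f -> trigint (th - pi) f xi = - trigint th f xi.
Proof.
move=> rf; rewrite -[RHS]mulN1r -IntZ; last exact/intg_trig/rsch_intg.
by apply: Int_eq => x; rewrite addrA cosB cospi sinpi; ring.
Qed.

Lemma trig_inversion f x th : rsch f ->
  trigint (- th) (trigint 0 f) x + trigint (- th - pi / 2) (trigint (- (pi / 2)) f) x =
  (2 * pi) ^+ 3 * cos th * f x.
Proof.
move=> rf; rewrite -fourier_inversion_real // -IntD; last 2 first.
- exact/intg_trig/rsch_intg/rsch_trigint.
- exact/intg_trig/rsch_intg/rsch_trigint.
by apply: Int_eq => xi; rewrite addrA.
Qed.

Lemma trigintN th (f : R3 R -> R) xi : rsch f -> trigint th (fun x => - f x) xi = - trigint th f xi.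
Proof.
move=> rf; rewrite -[RHS]mulN1r -trigint_scale; last exact: rsch_intg.
by apply: Int_eq => y; rewrite mulN1r.
Qed.

(** Separates the bookkeeping of real and imaginary parts from the analysis. For q = - pi/2 the two
    hypotheses are the inversion formula with phases 0 and - pi/2; what remains is linear algebra in
    eight numbers. *)
Lemma trig_inversion_alg (q K : R) (a b : R3 R -> R) x : rsch a -> rsch b ->
  (forall f, rsch f -> trigint 0 (trigint 0 f) x - trigint q (trigint q f) x = K * f (- x)) ->
  (forall f, rsch f -> trigint 0 (trigint q f) x + trigint q (trigint 0 f) x = 0) ->
  fc * fc * K = 1 ->
  let A y := fc * (trigint 0 a y + trigint q b y) in
  let B y := fc * (trigint 0 b y - trigint q a y) in
  fc * (trigint 0 A x + trigint q B x) = a (- x) /\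
  fc * (trigint 0 B x - trigint q A x) = b (- x).
Proof.
move=> ra rb E0 E1 P A B.
have tD th f g : rsch f -> rsch g -> trigint th (fun y => fc * (f y + g y)) x =
    fc * (trigint th f x + trigint th g x).
  move=> rf rg; rewrite trigint_scale ?trigint_add //; try exact: rsch_intg.
  exact: (rsch_intg (rschD rf rg)).
have tB th f g : rsch f -> rsch g -> trigint th (fun y => fc * (f y - g y)) x =
    fc * (trigint th f x - trigint th g x).
  by move=> rf rg; rewrite (tD th f (fun y => - g y)) ?trigintN //; exact: rschN.
have a0 := rsch_trigint 0 ra; have aq := rsch_trigint q ra.
have b0 := rsch_trigint 0 rb; have bq := rsch_trigint q rb.
have := E0 _ ra; have := E0 _ rb; have := E1 _ ra; have := E1 _ rb.
rewrite /A /B !(tD _ _ _ a0 bq) !(tB _ _ _ b0 aq).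
move: (trigint 0 (trigint 0 a) x) (trigint 0 (trigint 0 b) x) (trigint 0 (trigint q a) x)
  (trigint 0 (trigint q b) x) (trigint q (trigint 0 a) x) (trigint q (trigint 0 b) x)
  (trigint q (trigint q a) x) (trigint q (trigint q b) x) => A1 A2 A3 A4 A5 A6 A7 A8 e1 e2 e3 e4.
split.
  transitivity (fc * fc * ((A1 - A7) + (A4 + A6))); first by ring.
  by rewrite e4 e1 addr0 mulrA P mul1r.
transitivity (fc * fc * ((A2 - A8) - (A3 + A5))); first by ring.
by rewrite e3 e2 subr0 mulrA P mul1r.
Qed.

Lemma fourier_fourier phi x : schwartz phi -> fourier (fourier phi) x = phi (- x).
Proof.
move=> sp; have sf := schwartz_fourier sp; have /schwartzP[r i] := sp.
have E0 f : rsch f -> trigint 0 (trigint 0 f) x - trigint (- (pi / 2)) (trigint (- (pi / 2)) f) x =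
    (2 * pi) ^+ 3 * f (- x).
  move=> rf; have := trig_inversion (- x) 0 rf.
  rewrite cos0 mulr1 !trigint_opp !oppr0 sub0r opprK => <-; congr (_ + _).
  have t := trigint_pi (pi / 2) x (rsch_trigint (- (pi / 2)) rf).
  have h : pi / 2 - pi = - (pi / 2) :> R by field.
  by rewrite h in t; rewrite t opprK.
have E1 f : rsch f -> trigint 0 (trigint (- (pi / 2)) f) x + trigint (- (pi / 2)) (trigint 0 f) x = 0.
  move=> rf; have e := trig_inversion (- x) (- (pi / 2)) rf.
  by rewrite cosN cos_pihalf mulr0 mul0r opprK subrr !trigint_opp oppr0 addrC in e.
have ER : (fun y => Re (fourier phi y)) = fun y => fc * (trigint 0 (fun x => Re (phi x)) y +
    trigint (- (pi / 2)) (fun x => Im (phi x)) y).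
  by apply/funext => y; rewrite Re_fourier.
have EI : (fun y => Im (fourier phi y)) = fun y => fc * (trigint 0 (fun x => Im (phi x)) y -
    trigint (- (pi / 2)) (fun x => Re (phi x)) y).
  by apply/funext => y; rewrite Im_fourier.
have P : fc * fc * (2 * pi) ^+ 3 = 1 :> R by rewrite -expr2 fc_sqr.
have [H1 H2] := trig_inversion_alg r i E0 E1 P.
apply: complex_eq.
  by rewrite (Re_fourier _ sf) -H1 -ER -EI.
by rewrite (Im_fourier _ sf) -H2 -ER -EI.
Qed.

Lemma fourier_opp phi xi : schwartz phi -> fourier (fun x => phi (- x)) xi = fourier phi (- xi).
Proof.
move=> sp; have so := schwartz_opp sp; have /schwartzP[r i] := sp.
have N1 : (-1 : R) != 0 by rewrite oppr_eq0 oner_eq0.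
have sc := scales_affine3 (0 : R3 R) N1.
have tO th f : rsch f -> trigint th (fun x => f (- x)) xi = trigint th f (- xi).
  move=> rf; rewrite /trigint [RHS](Int_scales sc); last exact/intg_trig/rsch_intg.
  rewrite normrN normr1 !mul1r; apply: Int_eq => x.
  rewrite addr0 scaleN1r; congr (cos (_ + _) * _).
  by rewrite !dotE /=; ring.
have r0 := tO 0 _ r; have i0 := tO 0 _ i; have r1 := tO (- (pi / 2)) _ r; have i1 := tO (- (pi / 2)) _ i.
by apply: complex_eq; rewrite ?Re_fourier ?Im_fourier // ?r0 ?i0 ?r1 ?i1.
Qed.

(** Applying the transform twice gives a reflection, so the reflected transform is a preimage. A
    distribution whose values are known on transforms is thereby known on all Schwartz functions. *)
Lemma fourier_inverse psi : schwartz psi ->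
  exists2 phi, schwartz phi & fourier phi = psi /\ (forall x, phi x = fourier psi (- x)).
Proof.
move=> sp; have sf := schwartz_fourier sp.
exists (fun x => fourier psi (- x)); first exact: schwartz_opp.
by split=> //; apply/funext => x; rewrite fourier_opp // fourier_fourier // opprK.
Qed.

(** Two integrations by parts express xi_i^2 times the integral through the second derivative along
    i. Adding the bound without this factor gains the weight 1 + xi_i^2, at the cost of a factor 2
    and two derivatives. *)
Lemma trig_step i xi (w : R) (g : R3 R -> R) (K : R) : rsch g ->
  (forall th, w * `|trigint th g xi| <= K) ->
  (forall th, w * `|trigint th (pderivs [:: i; i] g) xi| <= K) ->
  forall th, (1 + coord xi i ^+ 2) * w * `|trigint th g xi| <= 2 * K.
Proof.
move=> rg h1 h2 th; have rg' := rsch_pderivs [:: i] rg.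
have E : `|trigint (th - pi / 2 - pi / 2) (pderivs [:: i; i] g) xi| =
    coord xi i ^+ 2 * `|trigint th g xi|.
  have := trigint_mul_coord (th - pi / 2) xi i rg'; rewrite pderivs_cat /= => e.
  rewrite -[LHS]normrN -e normrM.
  have := trigint_mul_coord th xi i rg => /(congr1 (fun t => `|t|)); rewrite normrN normrM => <-.
  by rewrite mulrA -expr2 real_normK ?num_real.
have := h1 th; have := h2 (th - pi / 2 - pi / 2); rewrite E.
have -> : (1 + coord xi i ^+ 2) * w * `|trigint th g xi| = w * `|trigint th g xi| +
   w * (coord xi i ^+ 2 * `|trigint th g xi|) by ring.
lra.
Qed.

(** Three uses of [trig_step], one per coordinate, consume six derivatives and contribute 2^3. The
    other factor 8 is 1 + 3 + 3 + 1 from [decay_lor], and pi^3 is the integral of the majorant. *)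
Lemma trig_seminorm (f : R3 R -> R) (M : R) : rsch f ->
  (forall s k x, (size s <= 6)%N -> (k <= 6)%N -> enorm x ^+ k * `|pderivs s f x| <= M) ->
  forall th xi, `|trigint th f xi| <= 64 * pi ^+ 3 * M * prod3 lor xi.
Proof.
move=> rf hM th xi.
have base s th' : (size s <= 6)%N -> 1 * `|trigint th' (pderivs s f) xi| <= 8 * pi ^+ 3 * M.
  move=> ss; rewrite mul1r.
  have rs := rsch_pderivs s rf.
  have b x : `|pderivs s f x| <= 8 * M * prod3 lor x.
    have := @decay_lor _ (pderivs s f) M M M M.
    rewrite (_ : M + 3 * M + 3 * M + M = 8 * M); last by ring.
    by apply => y; exact: hM.
  apply: (@le_trans _ _ (Int3 (fun x => 8 * M * prod3 lor x))).
    apply: Int_norm_le; first exact: intg_prod3_lor.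
      exact: (meas_trig _ _ (rsch_measurable rs)).
    by apply: aeW => x; rewrite normrM; apply: le_trans (b x); rewrite ler_piMl // cos_le1n.
  rewrite IntZ; last exact: (intg_prod3 intg_lor).
  by rewrite (Int_prod3 intg_lor) (proj2 intg_lor_pi) mulrAC.
have s0 s : (size s <= 4)%N -> forall th', (1 + coord xi 0 ^+ 2) * 1 * `|trigint th' (pderivs s f) xi| <= 2 * (8 * pi ^+ 3 * M).
  move=> ss; apply: trig_step; first exact: rsch_pderivs.
  - by move=> th'; apply: base; rewrite (leq_trans ss).
  - by move=> th'; rewrite pderivs_cat; apply: base; rewrite size_cat /= !ltnS.
have s1 s : (size s <= 2)%N -> forall th', (1 + coord xi 1 ^+ 2) * ((1 + coord xi 0 ^+ 2) * 1) * `|trigint th' (pderivs s f) xi| <= 2 * (2 * (8 * pi ^+ 3 * M)).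
  move=> ss; apply: trig_step; first exact: rsch_pderivs.
  - by move=> th'; apply: s0; rewrite (leq_trans ss).
  - by move=> th'; rewrite pderivs_cat; apply: s0; rewrite size_cat /= !ltnS.
have s2 : forall th', (1 + coord xi 2 ^+ 2) * ((1 + coord xi 1 ^+ 2) * ((1 + coord xi 0 ^+ 2) * 1)) * `|trigint th' (pderivs [::] f) xi| <= 2 * (2 * (2 * (8 * pi ^+ 3 * M))).
  apply: trig_step; first exact: rf.
  - exact: (s1 [::]).
  - exact: (s1 [:: 2; 2]).
have := s2 th; rewrite /=; have [-> -> ->] := coordE xi.
have p0 (t : R) : 0 < 1 + t ^+ 2 by rewrite ltr_wpDr ?sqr_ge0.
rewrite /prod3 /lor -!invfM ler_pdivlMr ?mulr_gt0 // => h.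
apply: (@le_trans _ _ (2 * (2 * (2 * (8 * pi ^+ 3 * M))))).
  by rewrite [leLHS](_ : _ = (1 + xi.2 ^+ 2) * ((1 + xi.1.2 ^+ 2) * ((1 + xi.1.1 ^+ 2) * 1)) *
    `|trigint th f xi|) //; ring.
by rewrite le_eqVlt; apply/orP; left; apply/eqP; ring.
Qed.

Definition fourier_const : R := fc * (4 * (64 * pi ^+ 3)).

(** The real and imaginary parts consist of four trigonometric integrals, whence the 4 in
    [fourier_const]. This bound by finitely many seminorms is what makes the inverse transforms of
    bounded fields tempered. *)
Lemma fourier_seminorm phi (M : R) : schwartz phi ->
  (forall s k x, (size s <= 6)%N -> (k <= 6)%N -> enorm x ^+ k * normc (cpderivs s phi x) <= M) ->
  forall xi, normc (fourier phi xi) <= fourier_const * M * prod3 lor xi.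
Proof.
move=> sp hM xi; have /schwartzP[r i] := sp.
have br th : `|trigint th (fun x => Re (phi x)) xi| <= 64 * pi ^+ 3 * M * prod3 lor xi.
  apply: trig_seminorm => // s k x ss kk; apply: le_trans (hM s k x ss kk).
  by rewrite ler_wpM2l ?exprn_ge0 ?enorm_ge0 //; exact: (Re_le_normc (cpderivs s phi x)).
have bi th : `|trigint th (fun x => Im (phi x)) xi| <= 64 * pi ^+ 3 * M * prod3 lor xi.
  apply: trig_seminorm => // s k x ss kk; apply: le_trans (hM s k x ss kk).
  by rewrite ler_wpM2l ?exprn_ge0 ?enorm_ge0 //; exact: (Im_le_normc (cpderivs s phi x)).
apply: (le_trans (normc_le_ReIm _)); rewrite Re_fourier // Im_fourier // !normrM (gtr0_norm fc_gt0).
rewrite /fourier_const -mulrDr -!mulrA ler_wpM2l ?(ltW fc_gt0) //.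
apply: (le_trans (lerD (ler_normD _ _) (ler_normB _ _))).
have := br 0; have := br (- (pi / 2)); have := bi 0; have := bi (- (pi / 2)).
rewrite -!mulrA; lra.
Qed.

End ComplexSchwartz.

(** * Complex integrals *)

Section ComplexMeasurable.
Context d (T : measurableType d) (R : realType).
Local Notation C := R[i].
Implicit Types f g : T -> C.

Lemma cmeas_cst (c : C) : cmeasurable (fun _ : T => c).
Proof. by split. Qed.

Lemma cmeasD f g : cmeasurable f -> cmeasurable g -> cmeasurable (fun x => f x + g x).
Proof.
move=> [fR fI] [gR gI]; split.
- by under eq_fun do rewrite ReD; exact: measurable_funD.
- by under eq_fun do rewrite ImD; exact: measurable_funD.
Qed.

Lemma cmeasN f : cmeasurable f -> cmeasurable (fun x => - f x).
Proof.
move=> [fR fI]; split.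
- by under eq_fun do rewrite ReN -mulN1r; exact: measurable_funM.
- by under eq_fun do rewrite ImN -mulN1r; exact: measurable_funM.
Qed.

Lemma cmeasB f g : cmeasurable f -> cmeasurable g -> cmeasurable (fun x => f x - g x).
Proof. by move=> mf mg; apply: cmeasD => //; exact: cmeasN. Qed.

Lemma cmeasM f g : cmeasurable f -> cmeasurable g -> cmeasurable (fun x => f x * g x).
Proof.
move=> [fR fI] [gR gI]; split.
- by under eq_fun do rewrite ReM; apply: measurable_funB; exact: measurable_funM.
- by under eq_fun do rewrite ImM; apply: measurable_funD; exact: measurable_funM.
Qed.

Lemma cmeas_real (f : T -> R) : measurable_fun setT f -> cmeasurable (fun x => (f x)%:C).
Proof. by move=> mf; split => //=. Qed.

Lemma cmeas_sum (I : Type) (s : seq I) (F : I -> T -> C) : (forall i, cmeasurable (F i)) ->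
  cmeasurable (fun x => \sum_(i <- s) F i x).
Proof.
move=> mF; elim: s => [|i s IH].
  by under eq_fun do rewrite big_nil; exact: cmeas_cst.
by under eq_fun do rewrite big_cons; exact: cmeasD.
Qed.

Lemma cmeas_conj f : cmeasurable f -> cmeasurable (fun x => (f x)^*%C).
Proof.
move=> [fR fI]; split; first by apply: eq_measurable_fun fR => x _; case: (f x).
have := measurable_funM (measurable_cst (- 1 : R)) fI.
by apply: eq_measurable_fun => x _; rewrite /=; case: (f x) => a b /=; rewrite mulN1r.
Qed.

Lemma measurable_normc f : cmeasurable f -> measurable_fun setT (fun x => normc (f x)).
Proof.
move=> [mR mI]; rewrite (_ : (fun x => _) = (fun x => Num.sqrt (Re (f x) ^+ 2 + Im (f x) ^+ 2))); last first.
  by apply/funext => x; rewrite -normc_sqr sqrtr_sqr ger0_norm ?normc_ge0.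
apply: (measurableT_comp (continuous_measurable_fun (@sqrt_continuous R))).
exact: (measurable_funD (measurable_funX 2 mR) (measurable_funX 2 mI)).
Qed.

End ComplexMeasurable.

Lemma cmeas_comp d1 d2 (T1 : measurableType d1) (T2 : measurableType d2) (R : realType)
    (f : T2 -> R[i]) (phi : T1 -> T2) : cmeasurable f -> measurable_fun setT phi ->
  cmeasurable (fun x => f (phi x)).
Proof. by move=> [mR mI] mphi; split; [exact: (measurableT_comp mR mphi)|exact: (measurableT_comp mI mphi)]. Qed.

(** The sum of the squares of s a_i + t b_i is nonnegative; (s, t) = (B, A) and (B, - A) give the
    two bounds after division by A B. If A B = 0, letting the other parameter vary forces the mixed
    sum to vanish. The form with upper bounds A, B in place of norms is the one that can be used
    pointwise under an integral. *)
Lemma sum_sqr_CS (R : realType) (I : finType) (a b : I -> R) (A B : R) : 0 <= A -> 0 <= B ->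
  \sum_i a i ^+ 2 <= A ^+ 2 -> \sum_i b i ^+ 2 <= B ^+ 2 -> `|\sum_i a i * b i| <= A * B.
Proof.
move=> A0 B0 aA bB.
have key (s t : R) : 0 <= s ^+ 2 * A ^+ 2 + 2 * (s * t) * (\sum_i a i * b i) + t ^+ 2 * B ^+ 2.
  apply: (@le_trans _ _ (\sum_i (s * a i + t * b i) ^+ 2)).
    by apply: sumr_ge0 => i _; exact: sqr_ge0.
  have -> : \sum_i (s * a i + t * b i) ^+ 2 = s ^+ 2 * (\sum_i a i ^+ 2) + 2 * (s * t) * (\sum_i a i * b i) + t ^+ 2 * (\sum_i b i ^+ 2).
    by rewrite !mulr_sumr -!big_split; apply: eq_bigr => i _ /=; ring.
  by rewrite !lerD // ler_wpM2l // sqr_ge0.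
move: (\sum_i a i * b i) key => S key.
have [AB|AB] := eqVneq (A * B) 0; last first.
  have AB0 : 0 < A * B by rewrite lt_neqAle eq_sym AB mulr_ge0.
  have k1 := key B A; have k2 := key B (- A).
  rewrite ler_norml; apply/andP; split.
    by rewrite -(ler_pM2l AB0); lra.
  by rewrite -(ler_pM2l AB0); lra.
have small (X : R) : 0 <= X -> (forall s, 0 <= 2 * s * S + X) -> S = 0.
  move=> X0 H; apply/eqP/negP => /negP S0.
  have := H (- (X + 1) / S); rewrite (_ : 2 * (- (X + 1) / S) * S = - 2 * (X + 1)); last by field.
  lra.
rewrite AB normr_le0; apply/eqP.
move: AB => /eqP; rewrite mulf_eq0 => /orP[/eqP a0|/eqP b0].
- by apply: (small (B ^+ 2)) => [|s]; [exact: sqr_ge0|have := key s 1; rewrite a0; lra].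
- by apply: (small (A ^+ 2)) => [|s]; [exact: sqr_ge0|have := key 1 s; rewrite b0; lra].
Qed.

Section ComplexIntegral.
Context d (T : measurableType d) (R : realType) (mu : {measure set T -> \bar R}).
Local Notation C := R[i].
Implicit Types f g : T -> C.

Definition cintg f := intg mu (fun x => Re (f x)) /\ intg mu (fun x => Im (f x)).
Definition cInt f : C := cintegral mu setT f.

Lemma Re_cInt f : Re (cInt f) = Int mu (fun x => Re (f x)). Proof. by []. Qed.
Lemma Im_cInt f : Im (cInt f) = Int mu (fun x => Im (f x)). Proof. by []. Qed.

Lemma cintg_meas f : cintg f -> cmeasurable f.
Proof. by move=> [/intg_meas iR /intg_meas iI]. Qed.

Lemma cintg_le f (g : T -> R) : cmeasurable f -> intg mu g ->
  {ae mu, forall x, normc (f x) <= g x} -> cintg f.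
Proof.
move=> [mR mI] ig fg; split.
- by apply: (intg_ae_le mR ig); apply: (ae_imp fg) => x; exact/le_trans/Re_le_normc.
- by apply: (intg_ae_le mI ig); apply: (ae_imp fg) => x; exact/le_trans/Im_le_normc.
Qed.

Lemma cintg_normc f : cintg f -> intg mu (fun x => normc (f x)).
Proof.
move=> fi; apply: (intg_le (measurable_normc (cintg_meas fi)) (intgD (intg_norm fi.1) (intg_norm fi.2))) => x.
by rewrite ger0_norm ?normc_ge0 // normc_le_ReIm.
Qed.

Lemma cIntD f g : cintg f -> cintg g -> cInt (fun x => f x + g x) = cInt f + cInt g.
Proof.
move=> [fR fI] [gR gI]; apply: complex_eq.
- by rewrite ReD !Re_cInt -IntD //; apply: Int_eq => x; rewrite ReD.
- by rewrite ImD !Im_cInt -IntD //; apply: Int_eq => x; rewrite ImD.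
Qed.

Lemma cIntZ (c : C) f : cintg f -> cInt (fun x => c * f x) = c * cInt f.
Proof.
move=> [fR fI]; apply: complex_eq.
- rewrite ReM !Re_cInt Im_cInt -!IntZ // -IntB; try exact: intgZ.
  by apply: Int_eq => x; rewrite ReM.
- rewrite ImM !Im_cInt Re_cInt -!IntZ // -IntD; try exact: intgZ.
  by apply: Int_eq => x; rewrite ImM.
Qed.

Lemma cintgZ (c : C) f : cintg f -> cintg (fun x => c * f x).
Proof.
move=> [fR fI]; split.
- by have := intgB (intgZ (Re c) fR) (intgZ (Im c) fI); congr intg; apply/funext => x; rewrite ReM.
- by have := intgD (intgZ (Re c) fI) (intgZ (Im c) fR); congr intg; apply/funext => x; rewrite ImM.
Qed.

Lemma cIntN f : cintg f -> cInt (fun x => - f x) = - cInt f.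
Proof.
move=> fi; rewrite -[RHS]mulN1r -cIntZ //; congr cInt; apply/funext => x.
by rewrite mulN1r.
Qed.

Lemma cintgN f : cintg f -> cintg (fun x => - f x).
Proof. by move/(cintgZ (-1)); under eq_fun do rewrite mulN1r. Qed.

Lemma cIntB f g : cintg f -> cintg g -> cInt (fun x => f x - g x) = cInt f - cInt g.
Proof. by move=> fi gi; rewrite cIntD ?cIntN //; exact: cintgN. Qed.

Lemma cInt_eq f g : f =1 g -> cInt f = cInt g.
Proof. by move=> /funext->. Qed.

Lemma cInt_ae f g : cmeasurable f -> cmeasurable g -> {ae mu, forall x, f x = g x} ->
  cInt f = cInt g.
Proof.
move=> [fR fI] [gR gI] fg; apply: complex_eq.
- by apply: Int_ae => //; apply: (ae_imp fg) => x ->.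
- by apply: Int_ae => //; apply: (ae_imp fg) => x ->.
Qed.

Lemma Int0 : Int mu (fun=> 0) = 0.
Proof.
by have := IntZ 0 (intg0 mu); under Int_eq do rewrite mulr0; rewrite mul0r.
Qed.

Lemma cInt_conj f : cintg f -> cInt (fun x => (f x)^*%C) = (cInt f)^*%C.
Proof.
move=> [fR fI]; apply: complex_eq.
- by rewrite Re_cInt; case E : (cInt f) => [a b] /=; rewrite -[a]/(Re (a +i* b)) -E Re_cInt; apply: Int_eq => x; case: (f x).
- rewrite Im_cInt; case E : (cInt f) => [a b] /=; rewrite -[b]/(Im (a +i* b)) -E Im_cInt -mulN1r -IntZ //.
  by apply: Int_eq => x; case: (f x) => u v /=; rewrite mulN1r.
Qed.

Lemma cInt_dct (F : nat -> T -> C) f (g : T -> R) :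
  (forall n, cmeasurable (F n)) -> cmeasurable f -> intg mu g ->
  (forall n, {ae mu, forall x, normc (F n x) <= g x}) ->
  {ae mu, forall x, Re (F n x) @[n --> \oo] --> Re (f x) /\ Im (F n x) @[n --> \oo] --> Im (f x)} ->
  Re (cInt (F n)) @[n --> \oo] --> Re (cInt f) /\ Im (cInt (F n)) @[n --> \oo] --> Im (cInt f).
Proof.
move=> mF [fR fI] ig Fg Ff; split.
- apply: (Int_dct (fun n => (mF n).1) fR ig) => [n|].
    by apply: (ae_imp (Fg n)) => x; exact/le_trans/Re_le_normc.
  by apply: (ae_imp Ff) => x [].
- apply: (Int_dct (fun n => (mF n).2) fI ig) => [n|].
    by apply: (ae_imp (Fg n)) => x; exact/le_trans/Im_le_normc.
  by apply: (ae_imp Ff) => x [].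
Qed.

Lemma cInt_scales phi (k : R) f : scales mu phi k -> cintg f ->
  cInt f = k%:C * cInt (fun x => f (phi x)).
Proof.
move=> sc [fR fI]; apply: complex_eq.
- by rewrite ReM /= mul0r subr0; exact: Int_scales.
- by rewrite ImM /= mul0r addr0; exact: Int_scales.
Qed.

Lemma cintg_scales phi (k : R) f : scales mu phi k -> cintg f -> cintg (fun x => f (phi x)).
Proof.
by move=> sc [fR fI]; split; [exact: (intg_scales sc fR)|exact: (intg_scales sc fI)].
Qed.

(* Pairing with the vector of integrals itself reduces Minkowski's inequality
   to the Cauchy-Schwarz inequality under the integral sign. *)
Lemma Int_minkowski (I : finType) (F : I -> T -> R) (g : T -> R) :
  (forall i, intg mu (F i)) -> intg mu g -> (forall x, 0 <= g x) ->
  {ae mu, forall x, \sum_i F i x ^+ 2 <= g x ^+ 2} ->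
  \sum_i Int mu (F i) ^+ 2 <= Int mu g ^+ 2.
Proof.
move=> iF ig g0 Fg.
pose V i := Int mu (F i).
rewrite -/(\sum_i V i ^+ 2); set S := \sum_i V i ^+ 2.
have S0 : 0 <= S by apply: sumr_ge0 => i _; exact: sqr_ge0.
have iS : intg mu (fun x => \sum_i V i * F i x) /\ Int mu (fun x => \sum_i V i * F i x) = \sum_i V i * V i.
  elim: (index_enum I) => [|i s [IH1 IH2]].
    under eq_fun do rewrite big_nil; rewrite big_nil; split; first exact: intg0.
    exact: Int0.
  under eq_fun do rewrite big_cons; rewrite big_cons; split.
    by apply: intgD => //; exact: intgZ.
  by rewrite IntD ?IH2 ?IntZ //; exact: intgZ.
have SI : S = Int mu (fun x => \sum_i V i * F i x).
  by rewrite iS.2; apply: eq_bigr => i _; rewrite expr2.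
have H : S <= Num.sqrt S * Int mu g.
  rewrite -IntZ // {1}SI; apply: (le_trans (ler_norm _)); apply: Int_norm_le.
  - exact: intgZ.
  - exact: (intg_meas iS.1).
  - apply: (ae_imp Fg) => x FX; apply: sum_sqr_CS => //.
    + by rewrite sqr_sqrtr.
have [S00|Sn0] := eqVneq S 0; first by rewrite S00 sqr_ge0.
have sp : 0 < Num.sqrt S by rewrite sqrtr_gt0 lt_neqAle eq_sym Sn0.
have : Num.sqrt S <= Int mu g.
  by rewrite -(ler_pM2l sp) -expr2 sqr_sqrtr.
move=> le1; rewrite -[S](sqr_sqrtr S0) ler_pXn2r // ?nnegrE ?sqrtr_ge0 //.
by apply: Int_ge0.
Qed.

Lemma normc_cInt_le f (g : T -> R) : cmeasurable f -> intg mu g ->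
  {ae mu, forall x, normc (f x) <= g x} -> normc (cInt f) <= Int mu g.
Proof.
move=> mf ig fg; have fi := cintg_le mf ig fg.
have inf := cintg_normc fi.
apply: (@le_trans _ _ (Int mu (fun x => normc (f x)))).
  rewrite -(@ler_pXn2r _ 2) ?nnegrE ?normc_ge0 //; last by apply: Int_ge0 => x; exact: normc_ge0.
  (* The modulus of a complex number is the Euclidean norm of the pair of its real and imaginary
     parts, indexed here by [bool]. *)
  have := @Int_minkowski bool (fun b x => if b then Re (f x) else Im (f x)) _ _ inf (fun x => normc_ge0 _).
  rewrite big_bool normc_sqr; apply; first by case; [exact: fi.1|exact: fi.2].
  by apply: aeW => x; rewrite big_bool normc_sqr.
apply: (le_trans (ler_norm _)); apply: (Int_norm_le ig (intg_meas inf)).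
by apply: (ae_imp fg) => x; rewrite ger0_norm ?normc_ge0.
Qed.

End ComplexIntegral.

Lemma cmeas_cInt d1 d2 (T1 : measurableType d1) (T2 : measurableType d2) (R : realType)
    (m2 : {sigma_finite_measure set T2 -> \bar R}) (f : T1 * T2 -> R[i]) : cmeasurable f ->
  cmeasurable (fun x => cInt m2 (fun y => f (x, y))).
Proof.
by move=> [mR mI]; split; [exact: (measurable_Int m2 mR)|exact: (measurable_Int m2 mI)].
Qed.

Section VectorNorm.
Context {R : realType}.
Local Notation C := R[i].
Implicit Types z w : 'I_3 -> C.

Lemma cvnorm_ge0 z : 0 <= cvnorm z. Proof. exact: sqrtr_ge0. Qed.

Lemma cvnorm_sqr z : cvnorm z ^+ 2 = \sum_(i < 3) normc (z i) ^+ 2.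
Proof. by rewrite sqr_sqrtr // sumr_ge0 // => i _; exact: sqr_ge0. Qed.

Lemma normc_le_cvnorm z i : normc (z i) <= cvnorm z.
Proof.
rewrite -(@ler_pXn2r _ 2) ?nnegrE ?normc_ge0 ?cvnorm_ge0 // cvnorm_sqr (bigD1 i) //= lerDl.
by apply: sumr_ge0 => j _; exact: sqr_ge0.
Qed.

Lemma cvnorm_le_sum z : cvnorm z <= \sum_(i < 3) normc (z i).
Proof.
rewrite -(@ler_pXn2r _ 2) ?nnegrE ?cvnorm_ge0 //; last by apply: sumr_ge0 => i _; exact: normc_ge0.
rewrite cvnorm_sqr !big3; have := normc_ge0 (z 0); have := normc_ge0 (z 1); have := normc_ge0 (z 2).
move: (normc _) (normc _) (normc _) => a b c a0 b0 c0.
have := mulr_ge0 a0 b0; have := mulr_ge0 a0 c0; have := mulr_ge0 b0 c0; nra.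
Qed.

Lemma cvnorm_le z (K : R) : (forall i, normc (z i) <= K) -> cvnorm z <= 3 * K.
Proof.
move=> zK; apply: (le_trans (cvnorm_le_sum z)); rewrite big3.
by have := zK 0; have := zK 1; have := zK 2; lra.
Qed.

(** Views a complex vector as six real coordinates, so that the real inequalities of Cauchy-Schwarz
    and Minkowski apply to [cvnorm] with constant 1. *)
Definition parts z (p : 'I_3 * bool) : R := if p.2 then Re (z p.1) else Im (z p.1).

Lemma sum_parts z : \sum_p parts z p ^+ 2 = cvnorm z ^+ 2.
Proof.
rewrite cvnorm_sqr -(pair_bigA _ (fun i b => parts z (i, b) ^+ 2)) /=.
by apply: eq_bigr => i _; rewrite big_bool normc_sqr.
Qed.

Lemma cvnormD z w : cvnorm (fun i => z i + w i) <= cvnorm z + cvnorm w.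
Proof.
rewrite -(@ler_pXn2r _ 2) ?nnegrE ?addr_ge0 ?cvnorm_ge0 // sqrrD -!sum_parts.
have H := sum_sqr_CS (a := parts z) (b := parts w) (cvnorm_ge0 z) (cvnorm_ge0 w).
rewrite !sum_parts in H; have {}H := le_trans (ler_norm _) (H (lexx _) (lexx _)).
have -> : \sum_p parts (fun i => z i + w i) p ^+ 2 =
    \sum_p parts z p ^+ 2 + \sum_p parts w p ^+ 2 + (\sum_p parts z p * parts w p) *+ 2.
  rewrite -sumrMnl -!big_split; apply: eq_bigr => -[i b] _ /=; rewrite /parts /=.
  by case: b; rewrite ?ReD ?ImD; ring.
by rewrite addrAC lerD2r lerD2l lerMn2r H orbT.
Qed.

Lemma cvnormN z : cvnorm (fun i => - z i) = cvnorm z.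
Proof. by congr Num.sqrt; apply: eq_bigr => i _; rewrite -mulN1r Normc.normcM -(rmorphN1 (real_complex R)) normc_real normrN1 mul1r. Qed.

Lemma cvnormZ (r : R) z : 0 <= r -> cvnorm (fun i => r%:C * z i) = r * cvnorm z.
Proof.
move=> r0; rewrite /cvnorm; under eq_bigr do rewrite normcMr ger0_norm // exprMn.
by rewrite -mulr_sumr sqrtrM ?sqr_ge0 // sqrtr_sqr ger0_norm.
Qed.

Lemma cvnorm0 : cvnorm (fun=> 0 : C) = 0.
Proof.
by rewrite /cvnorm big1 ?sqrtr0 // => i _; rewrite (normc_real 0) normr0 expr0n.
Qed.

End VectorNorm.

(** * Uniqueness of the transform *)

Section TestFunctions.
Context {R : realType}.
Implicit Types (t : R) (x : R3 R).

(** For k = 0 this is the standard smooth function that is flat at 0. The powers of 1/t are included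
    because the family must be closed under differentiation up to linear combinations. *)
Definition bump (k : nat) t : R := if 0 < t then t^-1 ^+ k * expR (- t^-1) else 0.

Lemma bump_ge0 k t : 0 <= bump k t.
Proof.
rewrite /bump; case: ifP => // t0.
by rewrite mulr_ge0 ?expR_ge0 // exprn_ge0 // invr_ge0 ltW.
Qed.

Lemma bump_bound k t : bump k t <= k`!%:R.
Proof.
rewrite /bump; case: ifP => [t0|_]; last exact: ler0n.
rewrite expRN ler_pdivrMr ?expR_gt0 //.
have y0 : 0 <= t^-1 by rewrite invr_ge0 ltW.
case: k => [|k].
  by rewrite expr0 fact0 mul1r; apply: le_trans (expR_ge1Dx _); rewrite lerDl.
have := expR_ge1Dxn k y0 => h; rewrite mulrC -ler_pdivrMr ?ltr0n ?fact_gt0 //.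
by apply: le_trans h; rewrite lerDr.
Qed.

Lemma bump0_le1 t : bump 0 t <= 1.
Proof. exact: (bump_bound 0). Qed.

Lemma bump_shift k t : bump k t = t * bump k.+1 t.
Proof.
rewrite /bump; case: ifP => [t0|_]; last by rewrite mulr0.
by rewrite exprS -!mulrA mulVKf // gt_eqF.
Qed.

Lemma is_derive_inv_expR k t : t != 0 ->
  is_derive t 1 (fun u : R => u^-1 ^+ k * expR (- u^-1))
    (- k%:R * (t^-1 ^+ k.+1 * expR (- t^-1)) + t^-1 ^+ k.+2 * expR (- t^-1)).
Proof.
move=> n0.
have DV : is_derive t 1 (fun u : R => u^-1) (- t^-1 ^+ 2).
  have := is_deriveV n0 (is_derive_id t 1); congr is_derive.
  by rewrite /GRing.scale /= mulr1 exprVn.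
have DN : is_derive t 1 (fun u : R => - u^-1) (t^-1 ^+ 2).
  by rewrite -[X in is_derive _ _ _ X]opprK; exact: is_deriveN.
have DE : is_derive t 1 (fun u : R => expR (- u^-1)) (t^-1 ^+ 2 * expR (- t^-1)).
  by rewrite mulrC; exact: (is_derive1_comp (is_derive_expR _) DN).
elim: k => [|k IH].
  rewrite oppr0 mul0r add0r; move: DE; congr is_derive.
  by apply/funext => u; rewrite expr0 mul1r.
have := der_mul DV IH.
have -> : (fun y : R => y^-1 * (y^-1 ^+ k * expR (- y^-1))) = (fun u : R => u^-1 ^+ k.+1 * expR (- u^-1)).
  by apply/funext => u; rewrite exprS mulrA.
congr is_derive; rewrite -[k.+1%:R]natr1 !exprS; move: (t^-1) (t^-1 ^+ k) (expR _) => v w e.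
by ring.
Qed.

(** Off the origin the function agrees locally with an explicit formula or with 0. At the origin the
    difference quotient is h [bump k.+2 h], which the factorial bound forces to 0. *)
Lemma is_derive_bump k t : is_derive t 1 (bump k) (- k%:R * bump k.+1 t + bump k.+2 t).
Proof.
have [t0|t0|t0] := ltgtP 0 t.
- pose g (u : R) := u^-1 ^+ k * expR (- u^-1).
  apply: (@near_eq_is_derive _ _ _ g).
    near=> u; rewrite /bump ifT //; near: u; exact: lt_nbhsr.
  have n0 : t != 0 by rewrite gt_eqF.
  by have := is_derive_inv_expR k n0; rewrite /bump !ifT.
- apply: (@near_eq_is_derive _ _ _ (cst 0)).
    near=> u; rewrite /bump ifF //; apply/negbTE; rewrite -leNgt ltW //; near: u.
    exact: lt_nbhsl.
  have F j : bump j t = 0 by rewrite /bump ifF //; apply/negbTE; rewrite -leNgt ltW.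
  by rewrite !F mulr0 addr0; exact: is_derive_cst.
- rewrite -t0; have b0 j : bump j 0 = 0 by rewrite /bump ltxx.
  rewrite !b0 mulr0 addr0.
  have N0 : `|h| @[h --> (0 : R)^'] --> (0 : R).
    rewrite -[X in _ --> X](@normr0 _ R); apply: cvg_norm => A; exact: nbhs_dnbhs.
  have cv : h^-1 *: ((bump k \o shift 0) (h *: 1) - bump k 0) @[h --> 0^'] --> (0 : R).
    apply: (@squeeze_cvgr _ _ _ _ (fun h => - ((k.+2)`!%:R * `|h|)) (fun h => (k.+2)`!%:R * `|h|)).
    + near=> h; rewrite -ler_norml b0 subr0 /= addr0 scaler1.
      have h0 : h != 0 by near: h; exact: nbhs_dnbhs_neq.
      rewrite bump_shift bump_shift /GRing.scale /= mulKf // normrM mulrC ler_wpM2r //.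
      by rewrite ger0_norm ?bump_ge0 // bump_bound.
    + rewrite -[X in _ --> X]oppr0 -[X in _ --> - X](mulr0 (k.+2)`!%:R).
      by apply: cvgN; apply: cvgM; first exact: cvg_cst.
    + rewrite -[X in _ --> X](mulr0 (k.+2)`!%:R).
      by apply: cvgM; first exact: cvg_cst.
  by apply: DeriveDef; [apply: cvgP cv|exact: cvg_lim cv].
Unshelve. all: by end_near. Qed.

(** Bounded derivatives up to order n, with the derivatives quantified existentially: closure under
    sums and products is then a plain induction on n, without a Leibniz formula along words. *)
Fixpoint bdiff (n : nat) (f : R3 R -> R) : Prop :=
  (exists M : R, forall x, `|f x| <= M) /\
  (if n is n'.+1 then forall i, exists2 g, (forall x, is_derive x (basis_vec i) f (g x)) & bdiff n' g
   else True).

Lemma bdiff_bounded n f : bdiff n f -> exists M : R, forall x, `|f x| <= M.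
Proof. by case: n => [|n] []. Qed.

Lemma bdiffS n f : bdiff n.+1 f -> bdiff n f.
Proof.
elim: n f => [|n IH] f; first by case.
move=> [b h]; split => // i; have [g gd bg] := h i; exists g => //; exact: IH.
Qed.

Lemma bdiffD n f g : bdiff n f -> bdiff n g -> bdiff n (fun x => f x + g x).
Proof.
elim: n f g => [|n IH] f g [[M hM] h1] [[N hN] h2].
  by split=> //; exists (M + N) => x; apply: le_trans (ler_normD _ _) (lerD (hM x) (hN x)).
split; first by exists (M + N) => x; apply: le_trans (ler_normD _ _) (lerD (hM x) (hN x)).
move=> i; have [f' df bf] := h1 i; have [g' dg bg] := h2 i.
by exists (fun x => f' x + g' x); [move=> x; exact: is_derive_add|exact: IH].
Qed.

Lemma bdiffM n f g : bdiff n f -> bdiff n g -> bdiff n (fun x => f x * g x).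
Proof.
elim: n f g => [|n IH] f g bf bg.
  split=> //; have [M hM] := bdiff_bounded bf; have [N hN] := bdiff_bounded bg.
  by exists (M * N) => x; rewrite normrM ler_pM.
split.
  have [M hM] := bdiff_bounded bf; have [N hN] := bdiff_bounded bg.
  by exists (M * N) => x; rewrite normrM ler_pM.
move=> i; have [_ /(_ i)[f' df bf']] := bf; have [_ /(_ i)[g' dg bg']] := bg.
exists (fun x => f x * g' x + g x * f' x); first by move=> x; exact: is_derive_mul.
by apply: bdiffD; apply: IH => //; exact: bdiffS.
Qed.

Lemma bdiff_cst n (c : R) : bdiff n (fun=> c).
Proof.
elim: n c => [|n IH] c; split=> //; try by exists `|c|.
by move=> i; exists (fun=> 0) => // x; exact: is_derive_cst.
Qed.

Lemma bdiff_bump n k (c d : R) j : bdiff n (fun x => bump k (c * coord x j + d)).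
Proof.
have B k' : exists M : R, forall x, `|bump k' (c * coord x j + d)| <= M.
  by exists (k'`!%:R) => x; rewrite ger0_norm ?bump_ge0 // bump_bound.
elim: n k => [|n IH] k; split=> // i.
exists (fun x => (c * (i == j)%:R) * (- k%:R * bump k.+1 (c * coord x j + d) + bump k.+2 (c * coord x j + d))).
  move=> x; rewrite -[x in is_derive x _ _ _]addr0 -(scale0r (basis_vec i)).
  apply/is_derive_lineP.
  have H1 : is_derive (0 : R) 1 (fun t : R => c * coord (x + t *: basis_vec i) j + d) (c * (i == j)%:R).
    have -> : (fun t : R => c * coord (x + t *: basis_vec i) j + d) =
        (fun t : R => (c * (i == j)%:R) * t + (c * coord x j + d)).
      by apply/funext => t; rewrite coordD coordZ coord_basis; ring.
    rewrite -[X in is_derive _ _ _ X]addr0.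
    by apply: der_add; exact: der_lin.
  have := is_derive1_comp (is_derive_bump k _) H1.
  by rewrite scale0r addr0 mulrC.
apply: bdiffM; first exact: bdiff_cst.
by apply: bdiffD => //; apply: bdiffM => //; exact: bdiff_cst.
Qed.

Lemma bdiff_pderivs n s f : bdiff (n + size s) f -> bdiff n (pderivs s f).
Proof.
elim: s n f => [|i s IH] n f; first by rewrite addn0.
rewrite /= addnS -addSn => /IH[_ /(_ i)[g dg bg]].
by rewrite (_ : (fun x => _) = g) //; apply/funext => x; case: (dg x).
Qed.

(** Bounded derivatives decay rapidly once they have bounded support. They vanish outside the box
    because the condition L < |x_j| is open along every line parallel to an axis, so a derivative
    there is that of a function which is locally 0. *)
Lemma bdiff_rsch f (L : R) : (forall n, bdiff n f) ->
  (forall x, f x != 0 -> forall j, `|coord x j| <= L) -> rsch f.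
Proof.
move=> bf sf.
have sm : smooth f.
  move=> s i x; have /bdiff_pderivs[_ /(_ i)[g dg _]] := bf (1 + size s)%N.
  by case: (dg x).
split=> // s.
have supp : forall x j, L < `|coord x j| -> pderivs s f x = 0.
  elim: s => [|i s IH] x j Lx /=.
    by apply/eqP; apply: contraTT Lx => /sf/(_ j); rewrite -leNgt.
  have D := is_derive_line0 (is_derive_pderivs s i x sm).
  have c : \forall h \near (0 : R), pderivs s f (x + h *: basis_vec i) = 0.
    have cc : `|coord x j + h * (i == j)%:R| @[h --> (0 : R)] --> `|coord x j|.
      apply: cvg_norm; rewrite -[X in _ --> X]addr0; apply: cvgD; first exact: cvg_cst.
      by rewrite -[X in _ --> X](mul0r (i == j)%:R); apply: cvgM; [exact: cvg_id|exact: cvg_cst].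
    near=> h; apply: (IH _ j); rewrite coordD coordZ coord_basis; near: h.
    exact: (cvgr_gt _ cc).
  have D0 : is_derive (0 : R) 1 (fun h : R => pderivs s f (x + h *: basis_vec i)) 0.
    apply: (@near_eq_is_derive _ _ _ (cst 0)) => //.
    by near=> h; apply/esym; near: h.
  case: D => _ H; case: D0 => _ H0.
  by rewrite -[LHS]/(pderivs (i :: s) f x) -H.
have [M hM] := bdiff_bounded (bdiff_pderivs (n := 0) (bf (0 + size s)%N)).
move=> k; exists ((3 * `|L|) ^+ k * `|M|) => x.
have [/forallP h|/forallPn[j]] := boolP [forall j, `|coord x j| <= L].
  apply: ler_pM => //; first exact/exprn_ge0/enorm_ge0.
    rewrite lerXn2r ?nnegrE ?enorm_ge0 ?mulr_ge0 //.
    apply: (le_trans (enorm_le_sum x)); rewrite big3.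
    by have := h 0; have := h 1; have := h 2; have := ler_norm L; lra.
  exact: (le_trans (hM x) (ler_norm M)).
rewrite -ltNge => /supp ->; rewrite normr0 mulr0 mulr_ge0 // exprn_ge0 // mulr_ge0 //.
Unshelve. all: by end_near. Qed.

(* Tends to the indicator of ]a, b] as n tends to infinity. *)
Definition step (a b : R) (n : nat) t : R :=
  bump 0 (n%:R ^+ 2 * (t - a)) * bump 0 (n%:R ^+ 2 * (b - t) + n.+1%:R).

Lemma bump_cvg1 (u : nat -> R) : (\forall n \near \oo, n.+1%:R <= u n) ->
  bump 0 (u n) @[n --> \oo] --> (1 : R).
Proof.
move=> un.
apply: (@squeeze_cvgr _ _ _ _ (fun n => 1 - n.+1%:R^-1) (fun=> 1)); last exact: cvg_cst.
  near=> n; rewrite bump0_le1 andbT.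
  have h : n.+1%:R <= u n by near: n.
  have p : 0 < n.+1%:R :> R by rewrite ltr0n.
  rewrite /bump (lt_le_trans p h) expr0 mul1r.
  apply: le_trans (expR_ge1Dx _); rewrite lerD2l lerN2.
  by rewrite lef_pV2 ?posrE // (lt_le_trans p h).
rewrite -[X in _ --> X]subr0; apply: cvgB; first exact: cvg_cst.
exact: cvg_harmonic.
Unshelve. all: by end_near. Qed.

Lemma near_sqr_ge (c : R) : 0 < c -> \forall n \near \oo, n.+1%:R <= n%:R ^+ 2 * c.
Proof.
move=> c0; near=> n.
have n1 : (1 <= n)%N by near: n; exact: nbhs_infty_gt.
have n2 : 2 / c <= n%:R by near: n; exact: nbhs_infty_ger.
have : 1 <= n%:R :> R by rewrite ler1n.
rewrite -natr1; move: n2; rewrite ler_pdivrMr // => n2 h.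
have := ler_wpM2l (le_trans ler01 h) n2; rewrite expr2; lra.
Unshelve. all: by end_near. Qed.

(** The first factor vanishes for t <= a and tends to 1 beyond. In the second, the offset n + 1
    still tends to infinity at t = b, while n^2 (b - t) outweighs it for t > b; hence b is included
    and a is not. Half-open intervals are the ones that generate the Borel sets and are stable under
    intersection. *)
Lemma step_cvg a b t : step a b n t @[n --> \oo] --> ((a < t <= b)%R%:R : R).
Proof.
have bn0 u : u <= 0 -> bump 0 u = 0 by move=> u0; rewrite /bump ltNge u0.
have [ta|at_] := leP t a.
  rewrite /=; apply: cvg_near_cst; near=> n; rewrite /step bn0 ?mul0r //.
  by rewrite mulr_ge0_le0 ?sqr_ge0 // subr_le0.
have [tb|bt] /= := leP t b.
  rewrite -[X in _ --> X]mulr1; apply: cvgM; apply: bump_cvg1.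
    by apply: near_sqr_ge; rewrite subr_gt0.
  by near=> n; rewrite lerDr mulr_ge0 ?sqr_ge0 // subr_ge0.
apply: cvg_near_cst; near=> n; rewrite /step [X in _ * X]bn0 ?mulr0 //.
rewrite -opprB mulrN addrC subr_le0; near: n.
by apply: near_sqr_ge; rewrite subr_gt0.
Unshelve. all: by end_near. Qed.

Lemma step_ge0 a b n t : 0 <= step a b n t.
Proof. by rewrite mulr_ge0 ?bump_ge0. Qed.

Lemma step_le1 a b n t : step a b n t <= 1.
Proof. by rewrite /step mulr_ile1 ?bump_ge0 ?bump0_le1. Qed.

(** One support for all n is what dominated convergence requires. For n >= 1 and t >= b + 2 the
    second argument is at most - 2 n^2 + n + 1 <= 0, which explains the margin 2. *)
Lemma step_supp a b n t : step a b n t != 0 -> a <= t <= b + 2.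
Proof.
apply: contraR; rewrite negb_and -!ltNge => /orP[h|h].
  rewrite /step {1}/bump ifF ?mul0r //; apply/negbTE; rewrite -leNgt.
  by rewrite mulr_ge0_le0 ?sqr_ge0 // subr_le0 ltW.
(* At n = 0 the first argument is 0, so [step] vanishes identically. *)
case: n => [|n]; first by rewrite /step expr0n mul0r {1}/bump ltxx mul0r.
rewrite /step [X in _ * X]/bump ifF ?mulr0 //; apply/negbTE; rewrite -leNgt.
rewrite -opprB mulrN addrC subr_le0.
have n1 : 1 <= n.+1%:R :> R by rewrite ler1n.
have : 2 <= t - b by lra.
rewrite -[n.+2%:R]natr1; move: (n.+1%:R) n1 => m m1 tb.
have := ler_wpM2l (sqr_ge0 m) tb; nra.
Qed.

Definition step3 (a b : R3 R) (n : nat) x : R :=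
  step a.1.1 b.1.1 n x.1.1 * step a.1.2 b.1.2 n x.1.2 * step a.2 b.2 n x.2.

Lemma step3_neq0 a b n x : step3 a b n x != 0 -> [/\ a.1.1 <= x.1.1 <= b.1.1 + 2,
  a.1.2 <= x.1.2 <= b.1.2 + 2 & a.2 <= x.2 <= b.2 + 2].
Proof.
by rewrite /step3 => h; split; apply: (@step_supp _ _ n); apply: contraNneq h => ->;
  rewrite !(mul0r, mulr0).
Qed.

Lemma rsch_step3 a b n : rsch (step3 a b n).
Proof.
pose L := \sum_(j < 3) (`|coord a j| + `|coord b j| + 2).
apply: (@bdiff_rsch _ L).
  have st c d j m : bdiff m (fun x => step c d n (coord x j)).
    apply: bdiffM.
      have := bdiff_bump m 0 (n%:R ^+ 2) (- (n%:R ^+ 2 * c)) j; congr bdiff.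
      by apply/funext => x; rewrite -mulrBr.
    have := bdiff_bump m 0 (- n%:R ^+ 2) (n%:R ^+ 2 * d + n.+1%:R) j; congr bdiff.
    by apply/funext => x; congr bump; ring.
  move=> m; apply: bdiffM; first apply: bdiffM.
  - have := st a.1.1 b.1.1 0 m; congr bdiff; apply/funext => x; by have [-> _ _] := coordE x.
  - have := st a.1.2 b.1.2 1 m; congr bdiff; apply/funext => x; by have [_ -> _] := coordE x.
  - have := st a.2 b.2 2 m; congr bdiff; apply/funext => x; by have [_ _ ->] := coordE x.
move=> x /step3_neq0[h0 h1 h2] j.
have tri (c d t : R) : c <= t <= d + 2 -> `|t| <= `|c| + `|d| + 2.
  move=> /andP[h h']; rewrite ler_norml; apply/andP; split.
    by have := ler_norm (- c); rewrite normrN; have := normr_ge0 d; lra.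
  by have := ler_norm d; have := normr_ge0 c; lra.
rewrite /L (bigD1 j) //=; apply: (@le_trans _ _ (`|coord a j| + `|coord b j| + 2)); last first.
  by rewrite lerDl; apply: sumr_ge0 => k _; rewrite !addr_ge0.
apply: tri; case: j => -[|[|[|//]]] ?; rewrite /coord !(tnth_nth 0) //=.
Qed.

Definition inbox (a b x : R3 R) : bool :=
  [&& a.1.1 < x.1.1 <= b.1.1, a.1.2 < x.1.2 <= b.1.2 & a.2 < x.2 <= b.2].

Lemma step3_cvg a b x : step3 a b n x @[n --> \oo] --> ((inbox a b x)%:R : R).
Proof.
have -> : (inbox a b x)%:R = (a.1.1 < x.1.1 <= b.1.1)%R%:R * (a.1.2 < x.1.2 <= b.1.2)%R%:R *
    (a.2 < x.2 <= b.2)%R%:R :> R by rewrite -natrM -natrM !mulnb /inbox andbA.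
by apply: cvgM; first apply: cvgM; exact: step_cvg.
Qed.

Lemma step3_ge0 a b n x : 0 <= step3 a b n x.
Proof. by apply: mulr_ge0; [apply: mulr_ge0|]; exact: step_ge0. Qed.

Lemma step3_le1 a b n x : step3 a b n x <= 1.
Proof.
have h a' b' t := step_ge0 a' b' n t; have k a' b' t := step_le1 a' b' n t.
apply: mulr_ile1; rewrite ?h ?k //; first by apply: mulr_ge0; exact: h.
by apply: mulr_ile1; rewrite ?h ?k.
Qed.

Definition cbox (a b : R3 R) : set (R3 R) :=
  (`[a.1.1, b.1.1] `*` `[a.1.2, b.1.2]) `*` `[a.2, b.2].

Lemma step3_supp a b n x : ~ cbox a (b + (2, 2, 2)) x -> step3 a b n x = 0.
Proof.
move=> h; apply/eqP; apply/negPn/negP => /step3_neq0[h0 h1 h2]; apply: h.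
by split; [split|]; rewrite /= in_itv.
Qed.

Lemma compact_cbox a b : compact (cbox a b).
Proof. by apply: compact_setX; first apply: compact_setX; exact: segment_compact. Qed.

Lemma measurable_cbox a b : measurable (cbox a b : set (RRR R)).
Proof. by apply: measurableX; first apply: measurableX; exact: measurable_itv. Qed.

End TestFunctions.

(** * From test functions to measurable sets *)

Section DynkinIntegral.
Context d d' (X : measurableType d) (T : measurableType d') (R : realType).
Variables (mu : {measure set X -> \bar R}) (p : X -> T) (h : X -> R) (G : set (set T)).
Hypotheses (mp : measurable_fun setT p) (ih : intg mu h)
  (mG : @measurable _ T = <<s G>>) (GI : setI_closed G)
  (h0 : Int mu h = 0) (hG : forall A, G A -> Int mu (fun x => h x * \1_A (p x)) = 0).

(** The sets whose preimages carry no mass of [h] form a Dynkin system: [h0] handles the whole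
    space, additivity the complements, and dominated convergence the disjoint unions. The map [p]
    allows the sets in one coordinate to be enlarged while those in the others stay fixed. *)
Lemma Int_dynkin (A : set T) : measurable A -> Int mu (fun x => h x * \1_A (p x)) = 0.
Proof.
have mind (B : set T) : measurable B -> measurable_fun setT (fun x => (\1_B (p x) : R)).
  move=> mB; exact: (measurableT_comp (measurable_indic mB) mp).
have ihB (B : set T) : measurable B -> intg mu (fun x => h x * \1_B (p x)).
  move=> mB; apply: (intg_le (measurable_funM (intg_meas ih) (mind _ mB)) (intg_norm ih)) => x.
  by rewrite normrM ler_piMr // indicE; case: (_ \in _); rewrite ?normr1 ?normr0.
rewrite {1}mG; move: A; apply: (@dynkin_induction _ T G _ mG GI).
- by rewrite -[RHS]h0; apply: Int_eq => x; rewrite indicT mulr1.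
- exact: hG.
- move=> S mS PS.
  have -> : (fun x => h x * \1_(~` S) (p x)) = (fun x => h x - h x * \1_S (p x)).
    apply/funext => x; rewrite !indicE in_setC; case: (_ \in _) => /=; ring.
  by rewrite IntB ?h0 ?PS ?subr0 //; exact: ihB.
- move=> F mF tF PF.
  pose U n := \big[setU/set0]_(i < n) F i.
  have mU n : measurable (U n) by exact: bigsetU_measurable.
  have PU n : Int mu (fun x => h x * \1_(U n) (p x)) = 0.
    elim: n => [|n IH].
      by rewrite /U big_ord0 -[RHS](mulr0 (Int mu h)) mulrC -IntZ //; apply: Int_eq => x; rewrite indic0 mul0r mulr0.
    have -> : (fun x => h x * \1_(U n.+1) (p x)) =
        (fun x => h x * \1_(U n) (p x) + h x * \1_(F n) (p x)).
      apply/funext => x; rewrite -mulrDr; congr (_ * _); rewrite /U big_ord_recr /= !indicE.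
      rewrite in_setU; case: (boolP (p x \in F n)) => xF; rewrite ?orbF ?addr0 // orbT.
      suff -> : (p x \in \big[setU/set0]_(i < n) F i) = false by rewrite add0r.
      apply/negbTE/negP; rewrite inE -bigcup_mkord => -[i /= lin Fi].
      have := tF i n Logic.I Logic.I; rewrite inE in xF.
      by move=> /(_ (ex_intro _ (p x) (conj Fi xF))) ein; rewrite ein ltnn in lin.
    by rewrite IntD ?IH ?PF ?addr0 //; exact: ihB.
  have mUF : measurable (\bigcup_k F k) by exact: bigcupT_measurable.
  have c : Int mu (fun x => h x * \1_(U n) (p x)) @[n --> \oo] --> Int mu (fun x => h x * \1_(\bigcup_k F k) (p x)).
    apply: (@Int_dct _ _ _ mu _ _ (fun x => `|h x|)).
    + by move=> n; exact: (intg_meas (ihB _ (mU n))).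
    + exact: (intg_meas (ihB _ mUF)).
    + exact: intg_norm.
    + by move=> n; apply: aeW => x; rewrite normrM ler_piMr // indicE; case: (_ \in _); rewrite ?normr1 ?normr0.
    + apply: aeW => x; apply: cvgM; first exact: cvg_cst.
      have [[k _ Fk]|nF] := pselect ((\bigcup_k F k) (p x)).
        apply: cvg_near_cst; near=> n; rewrite !indicE !mem_set //; first by exists k.
        rewrite /U -bigcup_mkord; exists k => //=; near: n; exact: nbhs_infty_gt.
      apply: cvg_near_cst; near=> n; rewrite !indicE !memNset //.
      by rewrite /U -bigcup_mkord => -[k _ Fk]; apply: nF; exists k.
  rewrite (_ : (fun n => _) = (fun=> 0)) in c; last by apply/funext => n; exact: PU.
  exact: (cvg_unique (@Rhausdorff R) c (cvg_cst (0:R))).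
Unshelve. all: by end_near. Qed.

End DynkinIntegral.

Section Uniqueness.
Context {R : realType}.
Implicit Types (x a b : R3 R).

Lemma ocitvE : @measurable _ (measurableTypeR R) = <<s (@ocitv R) >>.
Proof. by []. Qed.

Lemma ocitv_indic (a b : R) (t : R) : \1_(`]a, b]%classic) t = (a < t <= b)%R%:R :> R.
Proof. by rewrite indicE; congr (nat_of_bool _)%:R; apply/idP/idP; rewrite inE /= in_itv. Qed.

Lemma inboxE a b x : (inbox a b x)%:R = \1_(`]a.1.1, b.1.1]%classic) x.1.1 *
  \1_(`]a.1.2, b.1.2]%classic) x.1.2 * \1_(`]a.2, b.2]%classic) x.2 :> R.
Proof. by rewrite !ocitv_indic -natrM -natrM !mulnb /inbox andbA. Qed.

Lemma indic_le1n (T : Type) (A : set T) (y : T) : `|\1_A y : R| <= 1.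
Proof. by rewrite indicE; case: (_ \in _); rewrite ?normr1 ?normr0. Qed.

Variable h : R3 R -> R.
Hypotheses (mh : meas3 h)
  (hK : forall K : set (R3 R), compact K -> measurable (K : set (RRR R)) -> (\int[leb3]_(x in K) `|h x|%:E < +oo)%E)
  (hstep : forall a b n, Int3 (fun x => h x * step3 a b n x) = 0).

Lemma intg_cbox a b : intg3 (fun x => h x * \1_(cbox a b) x).
Proof.
apply: (@intg_mkcond _ (RRR R) R leb3) => //; first exact: measurable_cbox.
by apply: hK; [exact: compact_cbox|exact: measurable_cbox].
Qed.

Lemma meas_ind (p : RRR R -> measurableTypeR R) (A : set (measurableTypeR R)) : measurable_fun setT p ->
  measurable A -> meas3 (fun x => \1_A (p x) : R).
Proof. by move=> mp mA; exact: (measurableT_comp (measurable_indic mA) mp). Qed.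

Let m11 : @measurable_fun _ _ (RRR R) (measurableTypeR R) setT (fun x => x.1.1).
Proof. exact: (measurableT_comp measurable_fst measurable_fst). Qed.
Let m12 : @measurable_fun _ _ (RRR R) (measurableTypeR R) setT (fun x => x.1.2).
Proof. exact: (measurableT_comp measurable_snd measurable_fst). Qed.
Let m2 : @measurable_fun _ _ (RRR R) (measurableTypeR R) setT (fun x => x.2).
Proof. exact: measurable_snd. Qed.

Lemma meas_inbox a b : meas3 (fun x => (inbox a b x)%:R : R).
Proof.
under eq_fun do rewrite inboxE.
by apply: measurable_funM; first apply: measurable_funM; apply: meas_ind => //; exact: measurable_itv.
Qed.

Lemma inbox_cbox a b x : inbox a b x -> cbox a b x.
Proof.
by move=> /and3P[/andP[? ?] /andP[? ?] /andP[? ?]]; split; [split|];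
  rewrite /= in_itv /=; apply/andP; split => //; exact: ltW.
Qed.

Lemma intg_inbox a b : intg3 (fun x => h x * (inbox a b x)%:R).
Proof.
apply: (intg_le (measurable_funM mh (meas_inbox a b)) (intg_norm (intg_cbox a b))) => x.
rewrite !normrM ler_wpM2l // indicE; case: (boolP (inbox a b x)) => [/inbox_cbox xb|_].
  by rewrite mem_set.
by rewrite normr0.
Qed.

(** Half-open boxes are limits of the smooth [step3], all of which are supported in one compact box,
    where [h] is integrable. *)
Lemma Int_inbox a b : Int3 (fun x => h x * (inbox a b x)%:R) = 0.
Proof.
have c : Int3 (fun x => h x * step3 a b n x) @[n --> \oo] --> Int3 (fun x => h x * (inbox a b x)%:R).
  apply: (@Int_dct _ (RRR R) R leb3 _ _ (fun x => `|h x * \1_(cbox a (b + (2, 2, 2))) x|)).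
  - by move=> n; apply: measurable_funM => //; exact: (rsch_measurable (rsch_step3 a b n)).
  - exact: (intg_meas (intg_inbox a b)).
  - exact/intg_norm/intg_cbox.
  - move=> n; apply: aeW => x; rewrite 2!(normrM (h x)) ler_wpM2l // (ger0_norm (step3_ge0 _ _ _ _)).
    rewrite indicE; have [xb|xb] := pselect (cbox a (b + (2, 2, 2)) x).
      by rewrite mem_set // normr1 step3_le1.
    by rewrite step3_supp.
  - apply: aeW => x; apply: cvgM; first exact: cvg_cst.
    exact: step3_cvg.
rewrite (_ : (fun n => _) = (fun=> 0)) in c; last by apply/funext => n; exact: hstep.
exact: (cvg_unique (@Rhausdorff R) c (cvg_cst (0:R))).
Qed.

Section Box.
Variable N : nat.
Let aN : R3 R := (- N%:R, - N%:R, - N%:R).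
Let bN : R3 R := (N%:R, N%:R, N%:R).
Let hN x := h x * (inbox aN bN x)%:R.

Let ihN : intg3 hN. Proof. exact: intg_inbox. Qed.

Let intg_hN (g : R3 R -> R) : meas3 g -> (forall x, `|g x| <= 1) -> intg3 (fun x => hN x * g x).
Proof.
move=> mg g1; apply: (intg_le (measurable_funM (intg_meas ihN) mg) (intg_norm ihN)) => x.
by rewrite normrM ler_piMr.
Qed.

Let J (A1 A2 A3 : set (measurableTypeR R)) :=
  Int3 (fun x => hN x * (\1_A1 x.1.1 * \1_A2 x.1.2 * \1_A3 x.2)).

Let I : set (measurableTypeR R) := `]- N%:R, N%:R]%classic.

Let ocitv_meas A : ocitv A -> measurable (A : set (measurableTypeR R)).
Proof. by move=> [[p q] _ <-]; exact: measurable_itv. Qed.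

Let ocitv_I : ocitv I. Proof. by exists (- N%:R, N%:R). Qed.
Let mI : measurable I. Proof. exact: ocitv_meas. Qed.

Let J_ocitv A1 A2 A3 : ocitv A1 -> ocitv A2 -> ocitv A3 -> J A1 A2 A3 = 0.
Proof.
move=> [[p1 q1] _ <-] [[p2 q2] _ <-] [[p3 q3] _ <-] /=.
pose a' : R3 R := (Num.max p1 (- N%:R), Num.max p2 (- N%:R), Num.max p3 (- N%:R)).
pose b' : R3 R := (Num.min q1 N%:R, Num.min q2 N%:R, Num.min q3 N%:R).
rewrite -(Int_inbox a' b'); apply: Int_eq => x; rewrite /hN -mulrA; congr (_ * _).
rewrite !ocitv_indic -!natrM !mulnb; congr (nat_of_bool _)%:R.
rewrite /inbox /= !gt_max !le_min.
case: (p1 < x.1.1); case: (p2 < x.1.2); case: (p3 < x.2); rewrite ?andbF //=.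
case: (x.1.1 <= q1); case: (x.1.2 <= q2); case: (x.2 <= q3); rewrite ?andbF ?andbT //=.
Qed.

(** The truncation to the box already contains the indicator of [I] in each coordinate. Inserting it
    again turns the integral over the whole space, required by [Int_dynkin], into one over a product
    of intervals. *)
Let absorb x : [/\ hN x * \1_I x.1.1 = hN x, hN x * \1_I x.1.2 = hN x & hN x * \1_I x.2 = hN x].
Proof.
rewrite /hN inboxE /= -/I !indicE.
by case: (x.1.1 \in I); case: (x.1.2 \in I); case: (x.2 \in I); rewrite !(mulr1, mulr0).
Qed.

Let mi1 A : measurable A -> meas3 (fun x => \1_A x.1.1 : R). Proof. exact: meas_ind. Qed.
Let mi2 A : measurable A -> meas3 (fun x => \1_A x.1.2 : R). Proof. exact: meas_ind. Qed.
Let mi3 A : measurable A -> meas3 (fun x => \1_A x.2 : R). Proof. exact: meas_ind. Qed.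
Let le1M (u v : R) : `|u| <= 1 -> `|v| <= 1 -> `|u * v| <= 1.
Proof. by move=> u1 v1; rewrite normrM mulr_ile1. Qed.

(** Intervals are enlarged to Borel sets one coordinate at a time, in [J1], [J2] and [J3];
    rectangles are then enlarged to measurable sets of the plane and of the whole space in [J12] and
    [JA]. *)
Let J1 A1 A2 A3 : measurable A1 -> ocitv A2 -> ocitv A3 -> J A1 A2 A3 = 0.
Proof.
move=> mA1 o2 o3; have mA2 := ocitv_meas o2; have mA3 := ocitv_meas o3.
have E A : J A A2 A3 = Int3 (fun x => (hN x * (\1_A2 x.1.2 * \1_A3 x.2)) * \1_A x.1.1).
  by apply: Int_eq => x; ring.
rewrite E; apply: (@Int_dynkin _ _ (RRR R) (measurableTypeR R) R leb3 (fun x => x.1.1) _ (@ocitv R) m11 _ ocitvE (@ocitvI R)) => //.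
- apply: intg_hN; first exact: (measurable_funM (mi2 mA2) (mi3 mA3)).
  by move=> x; apply: le1M; exact: indic_le1n.
- rewrite -(J_ocitv ocitv_I o2 o3); apply: Int_eq => x.
  by have [E1 E2 E3] := absorb x; rewrite -{1}E1; ring.
- by move=> A oA; rewrite -E J_ocitv.
Qed.

Let J2 A1 A2 A3 : measurable A1 -> measurable A2 -> ocitv A3 -> J A1 A2 A3 = 0.
Proof.
move=> mA1 mA2 o3; have mA3 := ocitv_meas o3.
have E A : J A1 A A3 = Int3 (fun x => (hN x * (\1_A1 x.1.1 * \1_A3 x.2)) * \1_A x.1.2).
  by apply: Int_eq => x; ring.
rewrite E; apply: (@Int_dynkin _ _ (RRR R) (measurableTypeR R) R leb3 (fun x => x.1.2) _ (@ocitv R) m12 _ ocitvE (@ocitvI R)) => //.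
- apply: intg_hN; first exact: (measurable_funM (mi1 mA1) (mi3 mA3)).
  by move=> x; apply: le1M; exact: indic_le1n.
- rewrite -(J1 mA1 ocitv_I o3); apply: Int_eq => x.
  by have [E1 E2 E3] := absorb x; rewrite -{1}E2; ring.
- by move=> A oA; rewrite -E J1.
Qed.

Let J3 A1 A2 A3 : measurable A1 -> measurable A2 -> measurable A3 -> J A1 A2 A3 = 0.
Proof.
move=> mA1 mA2 mA3.
have E A : J A1 A2 A = Int3 (fun x => (hN x * (\1_A1 x.1.1 * \1_A2 x.1.2)) * \1_A x.2).
  by apply: Int_eq => x; ring.
rewrite E; apply: (@Int_dynkin _ _ (RRR R) (measurableTypeR R) R leb3 (fun x => x.2) _ (@ocitv R) m2 _ ocitvE (@ocitvI R)) => //.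
- apply: intg_hN; first exact: (measurable_funM (mi1 mA1) (mi2 mA2)).
  by move=> x; apply: le1M; exact: indic_le1n.
- rewrite -(J2 mA1 mA2 ocitv_I); apply: Int_eq => x.
  by have [E1 E2 E3] := absorb x; rewrite -{1}E3; ring.
- by move=> A oA; rewrite -E J2.
Qed.

Let rect_I d1 d2 (T1 : measurableType d1) (T2 : measurableType d2) :
  setI_closed [set (A : set T1) `*` (B : set T2) | A in measurable & B in measurable].
Proof.
move=> _ _ [A mA [B mB <-]] [A' mA' [B' mB' <-]].
by exists (A `&` A'); [exact: measurableI|exists (B `&` B'); [exact: measurableI|rewrite setXI]].
Qed.

Let indicX (T1 T2 : Type) (A : set T1) (B : set T2) (z : T1 * T2) :
  \1_(A `*` B) z = \1_A z.1 * \1_B z.2 :> R.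
Proof. by rewrite !indicE in_setX -natrM mulnb. Qed.

Let J12 (C : set (measurableTypeR R * measurableTypeR R)) A3 : measurable C -> measurable A3 ->
  Int3 (fun x => (hN x * \1_A3 x.2) * \1_C x.1) = 0.
Proof.
move=> mC mA3.
apply: (@Int_dynkin _ _ (RRR R) (measurableTypeR R * measurableTypeR R)%type R leb3 (fun x => x.1) _
  _ (measurable_fst) _ (measurable_prod_measurableType _ _) (@rect_I _ _ _ _)) => //.
- by apply: intg_hN => [|x]; [exact: mi3|exact: indic_le1n].
- rewrite -(J3 mI mI mA3); apply: Int_eq => x.
  by have [E1 E2 E3] := absorb x; rewrite -{1}E1 -{1}E2; ring.
- move=> _ [A mA [B mB <-]]; rewrite -(J3 mA mB mA3); apply: Int_eq => x.
  by rewrite indicX; ring.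
Qed.

Let JA (A : set (RRR R)) : measurable A -> Int3 (fun x => hN x * \1_A x) = 0.
Proof.
move=> mA.
apply: (@Int_dynkin _ _ (RRR R) (RRR R) R leb3 (fun x => x) _
  _ (@measurable_id _ _ _) _ (measurable_prod_measurableType _ _) (@rect_I _ _ _ _)) => //.
- rewrite -(J3 mI mI mI); apply: Int_eq => x.
  by have [E1 E2 E3] := absorb x; rewrite -{1}E1 -{1}E2 -{1}E3; ring.
- move=> _ [C mC [B mB <-]]; rewrite -(J12 mC mB); apply: Int_eq => x.
  by rewrite indicX; ring.
Qed.

Lemma ae_box0 : {ae leb3, forall x, h x * (inbox aN bN x)%:R = 0}.
Proof. exact: (@ae_intg0 _ (RRR R) R leb3 _ ihN JA). Qed.

End Box.

Lemma ae_eq0_step : {ae leb3, forall x, h x = 0}.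
Proof.
have : {ae leb3, forall x, forall n, h x * (inbox (- n%:R, - n%:R, - n%:R) (n%:R, n%:R, n%:R) x)%:R = 0}.
  by apply: (@ae_foralln _ (RRR R) R leb3) => n; exact: ae_box0.
move/(@ae_imp _ (RRR R) R leb3); apply => x H.
pose M := Num.max (Num.max `|x.1.1| `|x.1.2|) `|x.2|.
have [n Mn] : exists n, M < n%:R by exists (Num.bound M); by apply: archi_boundP; rewrite /M le_max normr_ge0 orbT.
have := H n; rewrite (_ : inbox _ _ _ = true) ?mulr1 //.
move: Mn; rewrite !gt_max !ltr_norml => /andP[/andP[/andP[a1 b1] /andP[a2 b2]] /andP[a3 b3]].
by rewrite /inbox /= a1 a2 a3 !ltW.
Qed.
End Uniqueness.

Section FourierUniqueness.
Context {R : realType}.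
Local Notation C := R[i].
Implicit Types (f g : R3 R -> C).

Lemma L1loc_part f (h : R3 R -> R) : L1loc f -> meas3 h -> (forall x, `|h x| <= normc (f x)) ->
  forall K : set (R3 R), compact K -> measurable (K : set (RRR R)) -> (\int[leb3]_(x in K) `|(h x)%:E| < +oo)%E.
Proof.
move=> [mf fK] mh hf K cK mK; apply: le_lt_trans (fK K cK).
apply: (@ge0_le_integral _ (RRR R) R leb3) => //.
- apply: measurableT_comp => //; apply/measurable_EFinP; exact: measurable_funS mh.
- by apply/measurable_EFinP; exact: measurable_funS (@measurable_normc _ (RRR R) R _ mf).
- by move=> x _; rewrite /= lee_fin.
Qed.

Lemma L1loc_step f (h : R3 R -> R) : L1loc f -> meas3 h -> (forall x, `|h x| <= normc (f x)) ->
  forall a b n, intg3 (fun x => h x * step3 a b n x).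
Proof.
move=> fL mh hf a b n.
have hK := L1loc_part fL mh hf.
have c : intg3 (fun x => h x * \1_(cbox a (b + (2, 2, 2))) x) by apply: intg_cbox.
apply: (@intg_le _ (RRR R) R leb3 _ _ _ (intg_norm c)).
  by apply: measurable_funM => //; exact: (rsch_measurable (rsch_step3 a b n)).
move=> x; rewrite 2!(normrM (h x)) ler_wpM2l // (ger0_norm (step3_ge0 _ _ _ _)).
rewrite indicE; have [xb|xb] := pselect (cbox a (b + (2, 2, 2)) x).
  by rewrite mem_set // normr1 step3_le1.
by rewrite step3_supp.
Qed.

Lemma L1loc_ae0 (h1 h2 : R3 R -> R) f g : L1loc f -> meas3 h1 -> (forall x, `|h1 x| <= normc (f x)) ->
  L1loc g -> meas3 h2 -> (forall x, `|h2 x| <= normc (g x)) ->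
  (forall a b n, Int3 (fun x => h1 x * step3 a b n x) = Int3 (fun x => h2 x * step3 a b n x)) ->
  {ae leb3, forall x, h1 x = h2 x}.
Proof.
move=> fL m1 hf gL m2 hg E.
suff : {ae leb3, forall x, h1 x - h2 x = 0}.
  by move/(@ae_imp _ (RRR R) R leb3); apply => x /subr0_eq.
apply: ae_eq0_step.
- exact: measurable_funB.
- move=> K cK mK.
  have i1 := @intg_mkcond _ (RRR R) R leb3 K h1 mK m1 (L1loc_part fL m1 hf cK mK).
  have i2 := @intg_mkcond _ (RRR R) R leb3 K h2 mK m2 (L1loc_part gL m2 hg cK mK).
  apply: (@intg_mkcond_lty _ (RRR R) R leb3) => //.
  by have := intgB i1 i2; rewrite (_ : (fun x => _) = (fun x => (h1 x - h2 x) * \1_K x)) //; apply/funext => x; rewrite mulrBl.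
- move=> a b n; rewrite -(subrr (Int3 (fun x => h1 x * step3 a b n x))) {2}E.
  rewrite -IntB; [by apply: Int_eq => x; rewrite mulrBl|exact: (L1loc_step fL)|exact: (L1loc_step gL)].
Qed.

Lemma ReMr (z : C) (r : R) : Re (z * r%:C) = Re z * r.
Proof. by case: z => a b /=; rewrite mulr0 subr0. Qed.

Lemma ImMr (z : C) (r : R) : Im (z * r%:C) = Im z * r.
Proof. by case: z => a b /=; rewrite mulr0 add0r. Qed.

(** The test functions [step3] are real, so they see the real and the imaginary parts separately,
    and each part is decided by [ae_eq0_step]. *)
Lemma L1loc_ae_eq f g : L1loc f -> L1loc g ->
  (forall phi, schwartz phi -> cintegral leb3 setT (fun x => f x * phi x) = cintegral leb3 setT (fun x => g x * phi x)) ->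
  {ae leb3, forall x, f x = g x}.
Proof.
move=> fL gL E; have [[mfR mfI] _] := fL; have [[mgR mgI] _] := gL.
have sc (a b : R3 R) n : schwartz (fun x => (step3 a b n x)%:C).
  apply/schwartzP; split; first exact: rsch_step3.
  by have := rschZ 0 (rsch_step3 a b n); under eq_fun do rewrite mul0r.
have ER : {ae leb3, forall x, Re (f x) = Re (g x)}.
  apply: (L1loc_ae0 fL mfR _ gL mgR) => [x|x|a b n]; try exact: Re_le_normc.
  have [H _] := E _ (sc a b n); move: H; rewrite -!/(Int3 _).
  rewrite (@Int_eq _ (RRR R) R leb3 _ (fun x => Re (f x) * step3 a b n x)).
    move=> ->; apply: Int_eq => x.
    exact: ReMr.
  by move=> x; exact: ReMr.
have EI : {ae leb3, forall x, Im (f x) = Im (g x)}.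
  apply: (L1loc_ae0 fL mfI _ gL mgI) => [x|x|a b n]; try exact: Im_le_normc.
  have [_ H] := E _ (sc a b n); move: H; rewrite -!/(Int3 _).
  rewrite (@Int_eq _ (RRR R) R leb3 _ (fun x => Im (f x) * step3 a b n x)).
    move=> ->; apply: Int_eq => x.
    exact: ImMr.
  by move=> x; exact: ImMr.
apply: (@ae_imp2 _ (RRR R) R leb3 _ _ _ ER EI) => x; exact: complex_eq.
Qed.

Lemma is_fourier_unique v f g : is_fourier v f -> is_fourier v g -> {ae leb3, forall x, f x = g x}.
Proof.
move=> [fL Ef] [gL Eg]; apply: L1loc_ae_eq => // phi sphi.
by rewrite -Ef // -Eg.
Qed.

End FourierUniqueness.

Section BoundedLimit.
Context d (T : measurableType d) (R : realType) (mu : {measure set T -> \bar R}).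

Lemma intg_lim_bounded (F : nat -> T -> R) (f : T -> R) (M : R) : (forall n, intg mu (F n)) ->
  (forall n x, 0 <= F n x) -> (forall x, F n x @[n --> \oo] --> f x) ->
  (forall n, Int mu (F n) <= M) -> measurable_fun setT f -> intg mu f.
Proof.
move=> iF F0 Ff FM mf; apply/integrableP; split; first exact/measurable_EFinP.
have fE x : limn_einf (fun n => (F n x)%:E) = `|(f x)%:E|%E.
  have f0 : 0 <= f x.
    by rewrite -(cvg_lim _ (Ff x)) //; apply: limr_ge; [apply: cvgP (Ff x)|exact: nearW].
  have : (F n x)%:E @[n --> \oo] --> (f x)%:E by apply: cvg_EFin; [exact: nearW|exact: Ff].
  by move=> /cvg_limn_einf_sup[-> _]; rewrite gee0_abs.
have H := fatou mu measurableT (f := fun n x => (F n x)%:E)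
  (fun n => (measurable_EFinP _ _).2 (intg_meas (iF n))) (fun n x _ => F0 n x).
rewrite (eq_integral (fun x => limn_einf (fun n => (F n x)%:E))); last by move=> x _; rewrite fE.
apply: le_lt_trans H _; rewrite (@le_lt_trans _ _ M%:E) ?ltry //.
rewrite limn_einf_lim; apply: lime_le; first exact: is_cvg_einfs.
apply: nearW => n; apply: (@le_trans _ _ (\int[mu]_x (F n x)%:E)%E).
  by apply: ereal_inf_lbound; exists n => /=.
by rewrite -EFin_Int // lee_fin.
Qed.

Lemma scales_ae phi k (P : T -> Prop) : scales mu phi k -> {ae mu, forall x, P x} ->
  {ae mu, forall x, P (phi x)}.
Proof.
move=> [mphi k0 sc] [N [mN N0 PN]].
exists (phi @^-1` N); split; first by rewrite -[X in measurable X]setTI; exact: mphi.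
- have := sc (fun x => (\1_N x)%:E); rewrite integral_indic // setIT N0.
  move=> /(_ _ _)/esym; have -> : (\int[mu]_x (\1_N (phi x))%:E = mu (phi @^-1` N))%E.
    rewrite (eq_integral (fun x => (\1_(phi @^-1` N) x)%:E)) => [|x _]; last by rewrite !indicE.
    by rewrite integral_indic ?setIT // -[X in measurable X]setTI; exact: mphi.
  have mul0 (a : \bar R) : (k%:E * a = 0)%E -> a = 0%E.
    by move=> /eqP; rewrite mule_eq0 eqe gt_eqF //= => /eqP.
  move=> H; apply/mul0/H => [|x]; last by rewrite lee_fin.
  by apply/measurable_EFinP; exact: measurable_indic.
- by move=> x /= nP; apply: PN.
Qed.
End BoundedLimit.

(** The continuous functions y / (y^2 + 1/(n+1)) converge to 1/y for every y, including y = 0, where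
    the limit 0 agrees with the convention for the inverse. *)
Lemma measurable_inv d (T : measurableType d) (R : realType) (f : T -> R) : measurable_fun setT f ->
  measurable_fun setT (fun x => (f x)^-1).
Proof.
move=> mf; apply: (@measurableT_comp _ _ _ _ _ _ (fun y : R => y^-1)) mf.
pose g n (y : R) := y * (y ^+ 2 + n.+1%:R^-1)^-1.
have p n (y : R) : 0 < y ^+ 2 + n.+1%:R^-1 by rewrite ltr_wpDl ?sqr_ge0 // invr_gt0.
apply: (measurable_fun_cvg (h := g)) => [n|y _].
  apply: continuous_measurable_fun => y; apply: cvgM; first exact: cvg_id.
  apply: cvgV; first exact: lt0r_neq0.
  by apply: cvgD; [exact: exprn_continuous|exact: cvg_cst].
have [->|y0] := eqVneq y 0; first by rewrite invr0 /g; under eq_fun do rewrite mul0r; exact: cvg_cst.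
rewrite (_ : y^-1 = y * (y ^+ 2 + 0)^-1); last by rewrite addr0; field.
apply: cvgM; first exact: cvg_cst.
apply: cvgV; first by rewrite addr0 expf_neq0.
by apply: cvgD; [exact: cvg_cst|exact: cvg_harmonic].
Qed.

(** * Convolution of homogeneous weights *)

Section HomogeneousWeights.
Context {R : realType}.
Implicit Types x y : R3 R.

Lemma measurable_dotxx : meas3 (fun x => dot x x).
Proof.
under eq_fun do rewrite dotE.
have m1 : @measurable_fun _ _ (RRR R) (measurableTypeR R) setT (fun x => x.1.1).
  exact: (measurableT_comp measurable_fst measurable_fst).
have m2 : @measurable_fun _ _ (RRR R) (measurableTypeR R) setT (fun x => x.1.2).
  exact: (measurableT_comp measurable_snd measurable_fst).
have m3 : @measurable_fun _ _ (RRR R) (measurableTypeR R) setT (fun x => x.2) by exact: measurable_snd.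
exact: (measurable_funD (measurable_funD (measurable_funM m1 m1) (measurable_funM m2 m2)) (measurable_funM m3 m3)).
Qed.

Lemma dotZZ (c : R) x : dot (c *: x) (c *: x) = c ^+ 2 * dot x x.
Proof. by rewrite dotZl dotC dotZl; ring. Qed.

Lemma scales_dilation (c : R) : 0 < c -> @scales R _ (RRR R) leb3 (fun x : R3 R => c *: x) (c ^+ 3).
Proof.
move=> c0; have := scales_affine3 (0 : R3 R) (lt0r_neq0 c0).
rewrite (gtr0_norm c0) (_ : c * c * c = c ^+ 3); last by ring.
by under [X in scales _ X]eq_fun do rewrite addr0.
Qed.

(* [h x = (c^3 / 2) h (c x)] makes the integral of [h] over each shell of the family
   [chi n] half of the preceding one, so that the integrals of [h chi n] stay bounded. *)
Lemma intg_shells (h : R3 R -> R) (chi : nat -> R3 R -> bool) (chioo : R3 R -> bool) (c : R) :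
  0 < c -> meas3 h -> (forall x, 0 <= h x) -> (forall x, h x = c ^+ 3 / 2 * h (c *: x)) ->
  (forall n, intg3 (fun x => h x * (chi n x)%:R)) -> (forall x, chi 0%N x = false) ->
  (forall n x, (chi n.+1 x)%:R = (chi 1%N x)%:R + (chi n (c *: x))%:R :> R) ->
  (forall x, h x != 0 -> \forall n \near \oo, chi n x = chioo x) ->
  meas3 (fun x => h x * (chioo x)%:R) ->
  intg3 (fun x => h x * (chioo x)%:R).
Proof.
move=> c0 mh h0 hc ichi chi0 chiS chil mchi.
pose J n := Int3 (fun x => h x * (chi n x)%:R).
have JS n : J n.+1 = J 1%N + J n / 2.
  have i2 : intg3 (fun x => c ^+ 3 / 2 * (h (c *: x) * (chi n (c *: x))%:R)).
    exact: (intgZ _ (intg_scales (scales_dilation c0) (ichi n))).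
  transitivity (Int3 (fun x => h x * (chi 1%N x)%:R + c ^+ 3 / 2 * (h (c *: x) * (chi n (c *: x))%:R))).
    by apply: Int_eq => x; rewrite chiS mulrDr {2}hc mulrA.
  rewrite IntD // IntZ; last exact: (intg_scales (scales_dilation c0) (ichi n)).
  congr (_ + _); rewrite /J (Int_scales (scales_dilation c0) (ichi n)).
  by rewrite [RHS]mulrAC [RHS]mulrC; ring.
have J1 : 0 <= J 1%N by apply: Int_ge0 => x; rewrite mulr_ge0.
have JM n : J n <= 2 * J 1%N.
  elim: n => [|n IH]; last by rewrite JS; lra.
  rewrite /J (_ : Int3 _ = 0) ?mulr_ge0 //.
  have -> : (fun x => h x * (chi 0%N x)%:R) = (fun x => 0 * h x * (chi 1%N x)%:R).
    by apply/funext => x; rewrite chi0 mulr0 !mul0r.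
  under Int_eq do rewrite -mulrA; rewrite IntZ ?mul0r //.
apply: (@intg_lim_bounded _ (RRR R) R leb3 (fun n x => h x * (chi n x)%:R) _ _ ichi _ _ JM mchi).
  by move=> n x; rewrite mulr_ge0.
move=> x; have [hx|hx] := eqVneq (h x) 0.
  by rewrite hx mul0r; under eq_fun do rewrite mul0r; exact: cvg_cst.
apply: cvg_near_cst; have := chil x hx; apply: filterS => n -> //.
Qed.

Definition wt x : R := (dot x x)^-1.

Lemma wt_ge0 x : 0 <= wt x. Proof. by rewrite invr_ge0 dot_ge0. Qed.

Lemma measurable_wt : meas3 wt.
Proof. exact: (@measurable_inv _ (RRR R) R _ measurable_dotxx). Qed.

Lemma wtZ (c : R) x : c != 0 -> wt x = c ^+ 2 * wt (c *: x).
Proof.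
by move=> c0; rewrite /wt dotZZ invfM mulrA mulfV ?mul1r // expf_neq0.
Qed.

Lemma measurable_shell (a b : R) : meas3 (fun x => (a < dot x x <= b)%R%:R : R).
Proof.
under eq_fun do rewrite -ocitv_indic.
by apply: (@meas_ind R (fun x => dot x x)); [exact: measurable_dotxx|exact: measurable_itv].
Qed.

Lemma prod3_lor_ge x (L : R) : dot x x <= L -> 1 <= (1 + L) ^+ 3 * prod3 lor x.
Proof.
rewrite dotE /prod3 /lor => xL.
have := sqr_ge0 x.1.1; have := sqr_ge0 x.1.2; have := sqr_ge0 x.2.
rewrite -!expr2 in xL *; move: (x.1.1 ^+ 2) (x.1.2 ^+ 2) (x.2 ^+ 2) xL => a b c xL c0 b0 a0.
rewrite -!invfM ler_pdivlMr ?mul1r; last by rewrite !mulr_gt0 //; lra.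
rewrite (_ : (1 + L) ^+ 3 = (1 + L) * (1 + L) * (1 + L)); last by ring.
by rewrite !ler_pM ?mulr_ge0 //; lra.
Qed.

(** On a ball the function [prod3 lor] is bounded below, so a multiple of it dominates [h]; volumes
    need not be computed. *)
Lemma intg_ball (h : R3 R -> R) (K L : R) : 0 <= L -> meas3 h -> (forall x, `|h x| <= K) ->
  (forall x, L < dot x x -> h x = 0) -> intg3 h.
Proof.
move=> L0 mh hK hL.
apply: (@intg_le _ (RRR R) R leb3 _ _ mh (intg_prod3_lor (K * (1 + L) ^+ 3))) => x.
have K0 : 0 <= K := le_trans (normr_ge0 _) (hK x).
have [xL|xL] := leP (dot x x) L; last first.
  by rewrite hL // normr0 !mulr_ge0 ?lor_ge0 ?exprn_ge0 // addr_ge0.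
apply: le_trans (hK x) _; rewrite -mulrA ler_peMr //; exact: prod3_lor_ge.
Qed.

Lemma shell_split (a b c d : R) : a <= b -> b <= c ->
  (a < d <= c)%R%:R = (b < d <= c)%R%:R + (a < d <= b)%R%:R :> R.
Proof.
move=> ab bc; have [db|bd] := leP d b; last by rewrite (le_lt_trans ab bd) andbF addr0.
by rewrite (le_trans db bc) !andbT add0r.
Qed.

(** Self-similarity with ratio c = 2: |x|^-2 = 4 |2x|^-2, and 4 is c^3 / 2. The shells run towards
    the origin. *)
Lemma intg_wt_in : intg3 (fun x => wt x * (0 < dot x x <= 1)%R%:R).
Proof.
have q0 n : 0 < (4^-1 : R) ^+ n by rewrite exprn_gt0 // invr_gt0.
apply: (@intg_shells wt (fun n x => 4^-1 ^+ n < dot x x <= 1) _ 2) => //.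
- exact: measurable_wt.
- exact: wt_ge0.
- move=> x; rewrite (wtZ x (_ : 2 != 0 :> R)) //; congr (_ * _); by field.
- move=> n; apply: (@intg_ball _ (4 ^+ n) 1) => //.
  + exact: (measurable_funM measurable_wt (measurable_shell _ _)).
  + move=> x; rewrite normrM ger0_norm ?wt_ge0 //; case: (boolP (4^-1 ^+ n < dot x x <= 1)) => [/andP[nx _]|_]; last by rewrite normr0 mulr0 exprn_ge0.
    rewrite normr1 mulr1 /wt invf_ple ?posrE ?exprn_gt0 ?(lt_trans _ nx) // -exprVn ltW //.
  + by move=> x x1; rewrite [dot x x <= 1]leNgt x1 andbF mulr0.
- by move=> x; rewrite expr0; case: ltP => //= x1; rewrite leNgt x1.
- move=> n x; rewrite dotZZ (_ : 2 ^+ 2 = 4 :> R); last by ring.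
  rewrite (@shell_split _ (4^-1 ^+ 1)); last 2 first.
  + rewrite exprS expr1; apply: ler_piMr; [by rewrite invr_ge0|apply: exprn_ile1; [by rewrite invr_ge0|by rewrite invf_le1 // ler1n]].
  + by rewrite expr1 invf_le1 // ler1n.
  by congr (_ + _%:R); rewrite exprS expr1 -ltr_pdivlMl ?invr_gt0 // invrK -ler_pdivlMl // mulr1.
- move=> x wx; have x0 : 0 < dot x x.
    rewrite lt_neqAle dot_ge0 andbT eq_sym; apply: contra wx => /eqP; rewrite /wt => ->.
    by rewrite invr0.
  rewrite x0 /=; have : (4^-1 : R) ^+ n @[n --> \oo] --> 0.
    by apply: cvg_expr; rewrite ger0_norm ?invr_ge0 // invf_lt1 // ltr1n.
  move=> /cvgr_lt/(_ _ x0); apply: filterS => n -> //.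
- exact: (measurable_funM measurable_wt (measurable_shell _ _)).
Qed.

(** The same argument with c = 1/2: |x|^-4 = (1/16) |x/2|^-4, and 1/16 is c^3 / 2. The shells run
    towards infinity. *)
Lemma intg_wt_out : intg3 (fun x => wt x ^+ 2 * (1 < dot x x)%R%:R).
Proof.
have half0 : (2^-1 : R) != 0 by rewrite invr_neq0.
apply: (@intg_shells (fun x => wt x ^+ 2) (fun n x => 1 < dot x x <= 4 ^+ n) (fun x => 1 < dot x x) 2^-1) => //.
- exact: (measurable_funX 2 measurable_wt).
- by move=> x; exact: sqr_ge0.
- move=> x; rewrite (wtZ x half0); move: (wt _) => w; by field.
- move=> n; apply: (@intg_ball _ 1 (4 ^+ n)); rewrite ?exprn_ge0 //.
  + exact: (measurable_funM (measurable_funX 2 measurable_wt) (measurable_shell _ _)).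
  + move=> x; rewrite normrM ger0_norm ?sqr_ge0 //; case: (boolP (1 < dot x x <= 4 ^+ n)) => [/andP[nx _]|_]; last by rewrite normr0 mulr0.
    rewrite normr1 mulr1 exprn_ile1 ?wt_ge0 // /wt invf_le1 ?ltW // (lt_trans _ nx) //.
  + by move=> x x1; rewrite [dot x x <= _]leNgt x1 andbF mulr0.
- by move=> x; rewrite expr0; case: ltP => //= x1; rewrite leNgt x1.
- move=> n x; rewrite dotZZ addrC (@shell_split _ (4 ^+ 1)); last 2 first.
  + by rewrite expr1 ler1n.
  + rewrite [X in _ <= X]exprS expr1; apply: ler_peMr => //; apply: exprn_ege1; exact: ler1n.
  congr (_%:R + _); rewrite expr1 exprS exprVn (_ : 2 ^+ 2 = 4 :> R); last by ring.
  by rewrite ltr_pdivlMl // mulr1 ler_pdivrMl.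
- move=> x wx; have : \forall n \near \oo, dot x x <= 4 ^+ n.
    near=> n; apply: (@le_trans _ _ n%:R).
      by near: n; exact: nbhs_infty_ger.
    rewrite -natrX ler_nat; exact: (ltnW (ltn_expl n (isT : 1 < 4)%N)).
  by apply: filterS => n ->; rewrite andbT.
- apply: (measurable_funM (measurable_funX 2 measurable_wt)).
  have := @meas_ind R (fun x => dot x x) _ measurable_dotxx (measurable_itv `]1, +oo[).
  by congr measurable_fun; apply/funext => x; rewrite indicE; congr (nat_of_bool _)%:R; apply/idP/idP; rewrite inE /= in_itv /= andbT.
Unshelve. all: by end_near. Qed.

(** Behaves like |x|^-2 at the origin and like |x|^-4 at infinity, integrable at both ends in
    dimension three. Its dilates bound the convolution of two weights. *)
Definition wt2 x : R := wt x * (1 + dot x x)^-1.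

Lemma wt2_ge0 x : 0 <= wt2 x.
Proof. by rewrite mulr_ge0 ?wt_ge0 // invr_ge0 addr_ge0 // dot_ge0. Qed.

Lemma measurable_wt2 : meas3 wt2.
Proof.
apply: (measurable_funM measurable_wt).
apply: (@measurable_inv _ (RRR R) R); apply: measurable_funD => //; exact: measurable_dotxx.
Qed.

Lemma intg_wt2 : intg3 wt2.
Proof.
apply: (@intg_le _ (RRR R) R leb3 _ _ measurable_wt2 (intgD intg_wt_in intg_wt_out)) => x.
rewrite ger0_norm ?wt2_ge0 // /wt2.
have := dot_ge0 x; rewrite le_eqVlt => /orP[/eqP x0|x0].
  by rewrite /wt -x0 invr0 !mul0r expr0n /= mul0r addr0.
have w0 : 0 < wt x by rewrite invr_gt0.
have [x1|x1] := leP (dot x x) 1; rewrite x0 /= ?mulr0 ?mulr1 ?addr0 ?add0r.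
  by rewrite ler_piMr ?wt_ge0 // invf_le1 ?lerDl ?ltW // addr_gt0.
by rewrite expr2; apply: ler_wpM2l; [exact: ltW|rewrite /wt lef_pV2 ?posrE // ?addr_gt0 // lerDr].
Qed.

Lemma wt_lor_le x : wt x * prod3 lor x <= wt2 x.
Proof.
rewrite ler_wpM2l ?wt_ge0 // dotE /prod3 /lor -!invfM -!expr2.
have := sqr_ge0 x.1.1; have := sqr_ge0 x.1.2; have := sqr_ge0 x.2.
move: (x.1.1 ^+ 2) (x.1.2 ^+ 2) (x.2 ^+ 2) => a b c c0 b0 a0.
rewrite lef_pV2 ?posrE; last 2 first.
- by rewrite !mulr_gt0 //; lra.
- by lra.
have := mulr_ge0 a0 b0; have := mulr_ge0 a0 c0; have := mulr_ge0 b0 c0.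
have := mulr_ge0 (mulr_ge0 a0 b0) c0; lra.
Qed.

Lemma intg_wt_lor : intg3 (fun x => wt x * prod3 lor x).
Proof.
apply: (@intg_le _ (RRR R) R leb3 _ _ _ intg_wt2) => [|x].
  exact: (measurable_funM measurable_wt (intg_meas (intg_prod3 intg_lor))).
rewrite ger0_norm ?wt_lor_le // mulr_ge0 ?wt_ge0 //.
by rewrite !mulr_ge0 ?lor_ge0.
Qed.

Lemma dot_gt0 x : x != 0 -> 0 < dot x x.
Proof. by move=> x0; rewrite -enorm_sqr exprn_gt0 // enorm_gt0. Qed.

Lemma scales_reflect (b : R3 R) : @scales R _ (RRR R) leb3 (fun x : R3 R => b - x) 1.
Proof.
have := scales_affine3 b (_ : (-1 : R) != 0); rewrite normrN1 !mul1r => /(_ _)[].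
  by rewrite oppr_eq0 oner_eq0.
by move=> ? ? ?; under [X in scales _ X]eq_fun do rewrite addrC -scaleN1r.
Qed.

(** A dilate of [wt2] at scale r. Homogeneity makes its integral a constant divided by r, which is
    the origin of the decay |xi|^-1 of the convolution. *)
Let ker (r : R) x := wt x * (r ^+ 2 + dot x x)^-1.

Let kerE (r : R) x : 0 < r -> ker r x = r^-1 ^+ 4 * wt2 (r^-1 *: x).
Proof.
move=> r0; rewrite /ker /wt2 dotZZ (wtZ x (_ : r^-1 != 0)) ?invr_neq0 ?lt0r_neq0 //.
have := dot_ge0 x; move: (dot x x) (wt _) => d w d0.
have h1 : r ^+ 2 + d != 0 by rewrite lt0r_neq0 // ltr_wpDr // exprn_gt0.
have h2 : 1 + r^-1 ^+ 2 * d != 0 by rewrite lt0r_neq0 // ltr_wpDr // mulr_ge0 // sqr_ge0.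
rewrite (_ : r ^+ 2 + d = r ^+ 2 * (1 + r^-1 ^+ 2 * d)); last by field; exact: lt0r_neq0.
by rewrite invfM; field; rewrite lt0r_neq0 //=.
Qed.

Let intg_ker (r : R) : 0 < r -> intg3 (ker r) /\ Int3 (ker r) = Int3 wt2 / r.
Proof.
move=> r0; have ri : 0 < r^-1 by rewrite invr_gt0.
have E : ker r = (fun x => r^-1 ^+ 4 * wt2 (r^-1 *: x)) by apply/funext => x; exact: kerE.
have i := intg_scales (scales_dilation ri) intg_wt2.
split; rewrite E; first exact: intgZ.
rewrite IntZ // (Int_scales (scales_dilation ri) intg_wt2); move: (Int _ _) => I.
by field; exact: lt0r_neq0.
Qed.

(** Twice the factor 5 of [ker_le], for the two kernels centred at 0 and at x; only an upper bound
    for the constant of the convolution is sought. *)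
Definition cker : R := 10 * Int3 wt2.

Lemma cker_ge0 : 0 <= cker.
Proof. by rewrite mulr_ge0 //; apply: Int_ge0; exact: wt2_ge0. Qed.

(** Put a = |x - y|^2, b = |y|^2 and r = |x|^2 <= 2 (a + b). If a <= b then r + a <= 3 a + 2 b <= 5
    b, so 1/b <= 5 / (r + a); the other case is symmetric. Each singularity is thus paired with a
    kernel that decays at the scale |x|. *)
Let ker_le x y : x != 0 -> wt (x - y) * wt y <= 5 * (ker (enorm x) (x - y) + ker (enorm x) y).
Proof.
move=> x0; rewrite /ker /wt enorm_sqr.
have r0 := dot_gt0 x0.
have : dot x x <= 2 * (dot (x - y) (x - y) + dot y y).
  rewrite !dotE /=; move: x y {x0 r0} => [[a b] c] [[a' b'] c'] /=.
  have := sqr_ge0 (a - 2 * a'); have := sqr_ge0 (b - 2 * b'); have := sqr_ge0 (c - 2 * c'); nra.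
have := dot_ge0 (x - y); have := dot_ge0 y.
move: (dot x x) (dot (x - y) (x - y)) (dot y y) r0 => r a b r0 b0 a0 rab.
have p (u : R) : 0 <= u -> 0 <= u^-1 * (r + u)^-1 by move=> u0; rewrite mulr_ge0 ?invr_ge0 // addr_ge0 // ltW.
(* At the two singular points y = x and y = 0 the left-hand side is 0, because the inverse of 0 is
   0. *)
move: a0; rewrite le_eqVlt => /orP[/eqP<-|a0].
  by rewrite invr0 mul0r mulr_ge0 // addr_ge0 // ?p // mul0r.
move: b0; rewrite le_eqVlt => /orP[/eqP<-|b0].
  by rewrite invr0 mulr0 mulr_ge0 // addr_ge0 // ?p ?mul0r // ltW.
have key (u v : R) : 0 < u -> 0 < v -> u <= v -> r <= 2 * (u + v) -> u^-1 * v^-1 <= 5 * (u^-1 * (r + u)^-1).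
  move=> u0 v0 uv ruv; rewrite mulrCA; apply: ler_wpM2l; first by rewrite invr_ge0 ltW.
  rewrite ler_pdivlMr ?addr_gt0 // ler_pdivrMl //; lra.
have [ab|/ltW ba] := leP a b.
  apply: (le_trans (key _ _ a0 b0 ab rab)); rewrite ler_wpM2l // lerDl; exact/p/ltW.
rewrite mulrC; apply: (le_trans (key _ _ b0 a0 ba _)); first by rewrite addrC.
rewrite ler_wpM2l // lerDr; exact/p/ltW.
Qed.

Lemma intg_wt_conv x : x != 0 -> intg3 (fun y => wt (x - y) * wt y) /\
  Int3 (fun y => wt (x - y) * wt y) <= cker / enorm x.
Proof.
move=> x0; have [ik Ek] := intg_ker (enorm_gt0 x0).
have sr := scales_reflect x.
have ik' := intg_scales sr ik.
have isum := intgZ 5 (intgD ik' ik).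
have iw : intg3 (fun y => wt (x - y) * wt y).
  apply: (@intg_le _ (RRR R) R leb3 _ _ _ isum) => [|y].
    apply: measurable_funM measurable_wt.
    by have [m _ _] := sr; exact: (measurableT_comp measurable_wt m).
  by rewrite ger0_norm ?ker_le // mulr_ge0 ?wt_ge0.
split=> //; apply: (le_trans (Int_le iw isum (fun y => ker_le y x0))).
rewrite IntZ ?IntD //; last exact: intgD.
have := Int_scales sr ik; rewrite mul1r => <-; rewrite Ek /cker.
by move: (Int _ _) (_^-1) => I q; rewrite le_eqVlt; apply/orP; left; apply/eqP; ring.
Qed.

End HomogeneousWeights.

Notation cInt3 f := (@cInt _ (RRR _) _ leb3 f).
Notation cintg3 f := (@cintg _ (RRR _) _ leb3 f).
Notation cmeas3 f := (@cmeasurable _ _ (RRR _) f).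

(** The integral of a nonnegative function is a supremum over the simple functions below it, so it
    is monotone with measurability required of the majorant alone. It is applied to compact sets,
    given by the topology and not by the product sigma-algebra. *)
Lemma ge0_integral_mono d (T : measurableType d) (R : realType) (mu : {measure set T -> \bar R})
    (D : set T) (f g : T -> R) : (forall x, 0 <= f x) -> (forall x, 0 <= g x) ->
  (forall x, D x -> f x <= g x) -> intg mu g -> (\int[mu]_(x in D) (f x)%:E < +oo)%E.
Proof.
move=> f0 g0 fg /integrableP[_]; apply: le_lt_trans.
rewrite integral_mkcond; set F := (_ \_ _).
have F0 x : (0 <= F x)%E by rewrite /F patchE; case: ifP => _ //; rewrite lee_fin.
have FG x : (F x <= `|(EFin \o g) x|)%E.
  rewrite /F patchE; case: ifPn => [xD|_]; last exact: abse_ge0.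
  by rewrite lee_fin ger0_norm // fg //; rewrite inE in xD.
rewrite (ge0_integralTE mu F0) ge0_integralTE => [|x]; last exact: abse_ge0.
apply: le_ereal_sup => _ [h hf <-]; exists h => // x; exact: le_trans (hf x) (FG x).
Qed.

(** * Distributions with a bounded transform *)

Section HomogeneousBound.
Context {R : realType}.
Local Notation C := R[i].
Implicit Types (x y xi : R3 R) (f g phi psi : R3 R -> C) (M : R).

Lemma measurable_enorm : meas3 (@enorm R).
Proof.
apply: (measurableT_comp (continuous_measurable_fun (@sqrt_continuous R))).
exact: measurable_dotxx.
Qed.

(** The indicator of the origin is invariant under dilation by 2, while its integral is multiplied
    by 8; the integral is finite, hence 0. *)
Lemma ae_neq0 : {ae leb3, forall x, x != 0}.
Proof.
pose h x : R := (dot x x == 0)%:R.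
have mh : meas3 h.
  have := @meas_ind R (fun x => dot x x) _ measurable_dotxx (measurable_set1 0).
  congr measurable_fun; apply/funext => x; rewrite indicE /h; congr (nat_of_bool _)%:R.
  by apply/idP/idP; rewrite inE /= => /eqP.
have h1 x : `|h x| <= 1 by rewrite /h; case: (_ == _); rewrite ?normr1 ?normr0.
have ih : intg3 h.
  by apply: (@intg_ball _ _ 1 0) => // x x0; rewrite /h gt_eqF.
have I0 : Int3 h = 0.
  have := Int_scales (scales_dilation (ltr0Sn R 1)) ih.
  rewrite (_ : Int leb3 (fun x => h (2 *: x)) = Int3 h).
    by move: (Int _ _) => I; lra.
  apply: Int_eq => x; rewrite /h dotZZ mulf_eq0 expf_eq0 /= pnatr_eq0 //.
have H0 : {ae leb3, forall x, h x = 0}.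
  apply: (@ae_intg0 _ (RRR R) R leb3 _ ih) => A mA; apply/eqP; rewrite eq_le.
  have i' : intg3 (fun x => h x * \1_A x).
    apply: (@intg_le _ (RRR R) R leb3 _ _ _ (intg_norm ih)) => [|x].
      by apply: measurable_funM => //; exact: measurable_indic.
    by rewrite normrM ler_piMr // indic_le1n.
  apply/andP; split; last by apply: Int_ge0 => x; rewrite mulr_ge0.
  rewrite -I0; apply: Int_le => // x; apply: ler_piMr; first by rewrite /h ler0n.
  by apply: le_trans (ler_norm _) (indic_le1n _ _).
apply: (@ae_imp _ (RRR R) R leb3 _ _ H0) => x; apply: contra_eqN => /eqP ->.
by rewrite /h -enorm_sqr enorm0 expr0n eqxx oner_eq0.
Qed.

(* Dominates both homogeneous weights occurring in the spaces PM^2 and PM^0. *)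
Definition wt1 x : R := wt x + 1.

Lemma wt1_ge0 x : 0 <= wt1 x. Proof. by rewrite addr_ge0 // wt_ge0. Qed.

Lemma wtN x : wt (- x) = wt x.
Proof. by rewrite /wt -!enorm_sqr enormN. Qed.

Lemma intg_wt1_lor : intg3 (fun x => wt1 x * prod3 lor x).
Proof.
have := intgD intg_wt_lor (intg_prod3_lor (1 : R)).
by congr intg; apply/funext => x; rewrite /wt1 mulrDl mul1r.
Qed.

Definition hatb M f := cmeas3 f /\ {ae leb3, forall x, normc (f x) <= M * wt1 x}.

Lemma intg_hatb M f (K : R) : hatb M f ->
  intg3 (fun x => normc (f x) * (K * prod3 lor x)).
Proof.
move=> [mf fM].
apply: (@intg_ae_le _ (RRR R) R leb3 _ (fun x => `|M * K| * (wt1 x * prod3 lor x))).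
- apply: measurable_funM; first exact: (@measurable_normc _ (RRR R)).
  exact: (intg_meas (intg_prod3_lor K)).
- exact: (intgZ _ intg_wt1_lor).
- apply: (@ae_imp _ (RRR R) R leb3 _ _ fM) => x fx.
  have p0 : 0 <= prod3 lor x by rewrite /prod3 !mulr_ge0 ?lor_ge0.
  rewrite [X in X <= _]normrM (normrM K) (ger0_norm (normc_ge0 _)) (ger0_norm p0) normrM.
  have : normc (f x) <= `|M| * wt1 x.
    by apply: (le_trans fx); rewrite ler_wpM2r ?wt1_ge0 // ler_norm.
  move=> h; have := ler_wpM2r (mulr_ge0 (normr_ge0 K) p0) h.
  by move/le_trans; apply; rewrite le_eqVlt; apply/orP; left; apply/eqP; ring.
Qed.

Lemma compact_dot_bound (K : set (R3 R)) : compact K -> exists L, 0 <= L /\ forall x, K x -> dot x x <= L.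
Proof.
move=> /compact_bounded[N [_ /(_ (`|N| + 1))]].
have NN : N < `|N| + 1 by apply: (le_lt_trans (ler_norm N)); rewrite ltrDl.
move=> /(_ NN) H; set B := `|N| + 1 in H.
exists (B ^+ 2 + B ^+ 2 + B ^+ 2); split; first by rewrite !addr_ge0 ?sqr_ge0.
move=> x /H; rewrite /= !prod_normE !ge_max => /andP[/andP[h1 h2] h3].
have B0 : 0 <= B := le_trans (normr_ge0 _) h3.
by rewrite dotE -!expr2 !lerD // -(real_normK (num_real _)) ler_pXn2r ?nnegrE.
Qed.

Lemma hatb_L1loc M f : hatb M f -> L1loc f.
Proof.
move=> hf; split; first exact: hf.1.
move=> K /compact_dot_bound[L [L0 KL]].
have p x : 0 <= (1 + L) ^+ 3 * prod3 lor x.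
  by rewrite mulr_ge0 ?exprn_ge0 ?addr_ge0 // /prod3 !mulr_ge0 ?lor_ge0.
apply: (@ge0_integral_mono _ (RRR R) R leb3 K _ _ _ _ _ (intg_hatb ((1 + L) ^+ 3) hf)) => x.
- exact: normc_ge0.
- by rewrite mulr_ge0 ?normc_ge0.
- by move=> xK; rewrite ler_peMr ?normc_ge0 // prod3_lor_ge // KL.
Qed.

Lemma schwartz_meas phi : schwartz phi -> cmeas3 phi.
Proof. by move=> /schwartzP[r i]; split; exact: rsch_measurable. Qed.

Lemma schwartz_lor phi : schwartz phi -> exists K, forall x, normc (phi x) <= K * prod3 lor x.
Proof.
move=> /schwartzP[[_ /(_ [::])r] [_ /(_ [::])i]].
have [K1 h1] := rdecay_lor r; have [K2 h2] := rdecay_lor i.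
exists (K1 + K2) => x; rewrite mulrDl; apply: (le_trans (normc_le_ReIm _)).
by apply: lerD; [exact: h1|exact: h2].
Qed.

Lemma cintg_schwartz phi : schwartz phi -> cintg3 phi.
Proof. by move=> /schwartzP[r i]; split; exact: rsch_intg. Qed.

Lemma cintg_hatb M f phi (K : R) : hatb M f -> cmeas3 phi ->
  (forall x, normc (phi x) <= K * prod3 lor x) -> cintg3 (fun x => f x * phi x).
Proof.
move=> hf mphi phiK; apply: (@cintg_le _ (RRR R) R leb3 _ _ _ (intg_hatb K hf)).
  exact: (cmeasM hf.1 mphi).
by apply: aeW => x; rewrite Normc.normcM ler_wpM2l ?normc_ge0.
Qed.

Lemma normc_cis (a : R) : normc (cos a -i* sin a) = 1.
Proof. by rewrite /= sqrrN cos2Dsin2 sqrtr1. Qed.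

Lemma cmeas_cis xi : cmeas3 (fun x => cos (dot x xi) -i* sin (dot x xi) : C).
Proof.
split => /=.
  by have := measurable_cos_dot 0 xi; under eq_fun do rewrite addr0.
have := measurable_funM (measurable_cst (- 1 : R)) (measurable_cos_dot (- (pi / 2)) xi).
apply: eq_measurable_fun => x _; rewrite /= cosB cos_pihalf sin_pihalf; ring.
Qed.

Lemma cintg_fourier phi xi : schwartz phi ->
  cintg3 (fun x => (cos (dot x xi) -i* sin (dot x xi)) * phi x).
Proof.
move=> sp; apply: (@cintg_le _ (RRR R) R leb3 _ _ _ (cintg_normc (cintg_schwartz sp))).
  exact: (cmeasM (cmeas_cis xi) (schwartz_meas sp)).
by apply: aeW => x; rewrite Normc.normcM normc_cis mul1r.
Qed.

Lemma fourierE phi xi : fourier phi xi =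
  fc%:C * cInt3 (fun x => (cos (dot x xi) -i* sin (dot x xi)) * phi x).
Proof. by []. Qed.

Lemma fourier_lin (a : C) phi psi xi : schwartz phi -> schwartz psi ->
  fourier (fun x => a * phi x + psi x) xi = a * fourier phi xi + fourier psi xi.
Proof.
move=> sp sq; rewrite !fourierE mulrCA -mulrDr; congr (_ * _).
rewrite -cIntZ; last exact: cintg_fourier.
rewrite -cIntD; [|apply: cintgZ|]; try exact: cintg_fourier.
by apply: cInt_eq => x; rewrite mulrDr mulrCA.
Qed.

Lemma conjCM (z w : C) : (z * w)^*%C = z^*%C * w^*%C.
Proof. exact: rmorphM. Qed.

Lemma fourier_conj phi xi : schwartz phi ->
  fourier (conjf phi) xi = (fourier phi (- xi))^*%C.
Proof.
move=> sp; rewrite !fourierE conjCM -cInt_conj; last exact: cintg_fourier.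
rewrite (_ : (fc%:C)^*%C = fc%:C); last by rewrite /= oppr0.
congr (_ * _); apply: cInt_eq => x; rewrite conjCM; congr (_ * _); last by rewrite /conjf; case: (phi x).
rewrite (_ : dot x (- xi) = - dot x xi); last by rewrite !dotE /=; ring.
by rewrite cosN sinN /= opprK.
Qed.

Definition hermitian f := {ae leb3, forall x, f (- x) = (f x)^*%C}.

(** The inverse transform as a total function. If psi is the transform of phi, then phi(x) is the
    transform of psi at - x, so the condition of [is_fourier] leaves no other value on Schwartz
    functions. *)
Definition dist_of f : distr R := fun psi => cInt3 (fun x => f x * fourier psi (- x)).

Lemma measurable_opp3 : @measurable_fun _ _ (RRR R) (RRR R) setT (fun x => - x).
Proof. by have [m _ _] := @scales_reflect R 0; under eq_fun do rewrite -sub0r. Qed.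

Lemma scales_opp : @scales R _ (RRR R) leb3 (fun x : R3 R => - x) 1.
Proof. by have := @scales_reflect R 0; under [X in scales _ X]eq_fun do rewrite sub0r. Qed.

Lemma prod3_lorN x : prod3 lor (- x) = prod3 (@lor R) x.
Proof. by rewrite /prod3 /lor /= !sqrrN. Qed.

Lemma cintg_dist M f psi : hatb M f -> schwartz psi -> cintg3 (fun x => f x * fourier psi (- x)).
Proof.
move=> hf sp; have sf := schwartz_opp (schwartz_fourier sp).
have [K hK] := schwartz_lor sf.
exact: (cintg_hatb hf (schwartz_meas sf) hK).
Qed.

Lemma dist_of_tempered M f : hatb M f -> tempered (dist_of f).
Proof.
move=> hf; split.
  move=> a phi psi sp sq; rewrite /dist_of -cIntZ; last exact: (cintg_dist hf).
  rewrite -cIntD; [|apply: cintgZ|]; try exact: (cintg_dist hf).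
  by apply: cInt_eq => x; rewrite fourier_lin // mulrDr mulrCA.
exists 6%N, (fourier_const * Int3 (fun x => normc (f x) * (1 * prod3 lor x))) => phi N sp hN.
rewrite mulrAC -IntZ; last exact: (intg_hatb 1 hf).
apply: (@normc_cInt_le _ (RRR R) R leb3).
- exact: (cintg_meas (cintg_dist hf sp)).
- exact: (intgZ _ (intg_hatb 1 hf)).
- apply: aeW => x; rewrite Normc.normcM mulrCA ler_wpM2l ?normc_ge0 //.
  by rewrite mul1r -prod3_lorN; exact: fourier_seminorm.
Qed.

Lemma dist_of_fourier M f : hatb M f -> is_fourier (dist_of f) f.
Proof.
move=> hf; split; first exact: (hatb_L1loc hf).
move=> phi sp; apply: cInt_eq => x; congr (_ * _).
by rewrite fourier_fourier // opprK.
Qed.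

Lemma of_hat_spec M f : hatb M f -> tempered (of_hat f) /\ is_fourier (of_hat f) f.
Proof.
move=> hf; rewrite /of_hat.
have := @xgetPex _ (fun=> 0 : C) [set v | tempered v /\ is_fourier v f]; apply.
by exists (dist_of f); split; [exact: (dist_of_tempered hf)|exact: (dist_of_fourier hf)].
Qed.

Lemma hat_spec (v : distr R) f : is_fourier v f -> is_fourier v (hat v).
Proof.
by move=> vf; have := @xgetPex _ (fun=> 0 : C) [set f | is_fourier v f]; apply; exists f.
Qed.

Lemma hat_ae (v : distr R) f : is_fourier v f -> {ae leb3, forall x, hat v x = f x}.
Proof. by move=> vf; exact: (is_fourier_unique (hat_spec vf) vf). Qed.

Lemma hat_of_hat M f : hatb M f -> {ae leb3, forall x, hat (of_hat f) x = f x}.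
Proof. by move=> hf; have [_ h] := of_hat_spec hf; exact: hat_ae. Qed.

(** Every Schwartz function is a transform, so a transform function determines the distribution on
    all Schwartz functions. The choices in [hat] and [of_hat] become harmless. *)
Lemma is_fourierE (v : distr R) f psi : is_fourier v f -> schwartz psi -> v psi = dist_of f psi.
Proof.
move=> [_ vf] sp; have [phi sphi [<- phiE]] := fourier_inverse sp.
rewrite vf //; apply: cInt_eq => x; by rewrite phiE.
Qed.

Lemma of_hatE M f psi : hatb M f -> schwartz psi -> of_hat f psi = dist_of f psi.
Proof. by move=> hf; have [_ h] := of_hat_spec hf; exact: is_fourierE. Qed.

Lemma dist_of_ae f g psi : cmeas3 f -> cmeas3 g -> schwartz psi -> {ae leb3, forall x, f x = g x} ->
  dist_of f psi = dist_of g psi.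
Proof.
move=> mf mg sp fg.
have mp := schwartz_meas (schwartz_opp (schwartz_fourier sp)).
apply: (@cInt_ae _ (RRR R) R leb3); [exact: (cmeasM mf mp)|exact: (cmeasM mg mp)|].
by apply: (@ae_imp _ (RRR R) R leb3 _ _ fg) => x ->.
Qed.

(** Replacing x by - x and using the symmetry of [f] and of the transform of a real function, the
    pairing is seen to equal its own conjugate. *)
Lemma dist_of_real M f : hatb M f -> hermitian f -> real_distr (dist_of f).
Proof.
move=> hf hh psi sp rp.
have pc : conjf psi = psi by apply/funext => x; rewrite /conjf rp oppr0; case: (psi x) (rp x) => a b /= ->.
have E : dist_of f psi = (dist_of f psi)^*%C.
  rewrite -cInt_conj; last exact: (cintg_dist hf).
  rewrite {1}/dist_of (cInt_scales scales_opp) ?mul1r; last exact: (cintg_dist hf).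
  have i1 := cintg_scales scales_opp (cintg_dist hf sp).
  apply: (@cInt_ae _ (RRR R) R leb3); first exact: (cintg_meas i1).
    exact: (cmeas_conj (cintg_meas (cintg_dist hf sp))).
  apply: (@ae_imp _ (RRR R) R leb3 _ _ hh) => x ->.
  by rewrite conjCM opprK -{1}pc fourier_conj.
by case: (dist_of f psi) E => a b [] /=; lra.
Qed.

Lemma of_hat_real M f : hatb M f -> hermitian f -> real_distr (of_hat f).
Proof.
move=> hf hh psi sp rp; rewrite (of_hatE hf sp); exact: (dist_of_real hf hh sp rp).
Qed.

Lemma hatbN M f : hatb M f -> hatb M (fun x => f (- x)).
Proof.
move=> [mf fM]; split; first exact: (cmeas_comp mf measurable_opp3).
apply: (@ae_imp _ (RRR R) R leb3 _ _ (scales_ae scales_opp fM)) => x.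
by rewrite /wt1 wtN.
Qed.

Lemma normc_conj (z : C) : normc (z^*%C) = normc z.
Proof. by case: z => a b /=; rewrite sqrrN. Qed.

Lemma hatb_conj M f : hatb M f -> hatb M (fun x => (f x)^*%C).
Proof.
move=> [mf fM]; split; first exact: (cmeas_conj mf).
by apply: (@ae_imp _ (RRR R) R leb3 _ _ fM) => x; rewrite normc_conj.
Qed.

Lemma hatbD M N f g : hatb M f -> hatb N g -> hatb (M + N) (fun x => f x + g x).
Proof.
move=> [mf fM] [mg gN]; split; first exact: (cmeasD mf mg).
apply: (@ae_imp2 _ (RRR R) R leb3 _ _ _ fM gN) => x h1 h2.
by rewrite mulrDl; apply: (le_trans (le_normcD _ _)); exact: lerD.
Qed.

Lemma tempered_conj (v : distr R) psi : tempered v -> real_distr v -> schwartz psi ->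
  v (conjf psi) = (v psi)^*%C.
Proof.
move=> [lin _] rv /schwartzP[sr si].
have s0 : rsch (fun=> 0 : R) by have := rschZ 0 sr; under eq_fun do rewrite mul0r.
have sR : schwartz (fun x => (Re (psi x))%:C) by apply/schwartzP.
have sI : schwartz (fun x => (Im (psi x))%:C) by apply/schwartzP.
have vR := rv _ sR (fun _ => erefl); have vI := rv _ sI (fun _ => erefl).
have E1 : psi = (fun x => (0 +i* 1) * (Im (psi x))%:C + (Re (psi x))%:C).
  by apply/funext => x; case: (psi x) => a b; apply: complex_eq => /=; ring.
have E2 : conjf psi = (fun x => (0 -i* 1) * (Im (psi x))%:C + (Re (psi x))%:C).
  by apply/funext => x; rewrite /conjf; case: (psi x) => a b; apply: complex_eq => /=; ring.
rewrite E2 [in RHS]E1 !lin //.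
move: (v _) (v _) vI vR => [a b] [c d] /= -> ->.
by apply: complex_eq => /=; ring.
Qed.

(** The reflection of [f] and its conjugate are tested against the same function: a change of
    variables evaluates the first pairing as a value of [v], reality of [v] shows that the second is
    the same number, and uniqueness of locally integrable transforms concludes. *)
Lemma hat_hermitian M (v : distr R) f : tempered v -> real_distr v -> is_fourier v f -> hatb M f ->
  hermitian f.
Proof.
move=> tv rv [_ vf] hf; apply: L1loc_ae_eq => [||phi sphi].
- exact: (hatb_L1loc (hatbN hf)).
- exact: (hatb_L1loc (hatb_conj hf)).
have sN := schwartz_opp sphi; have sC := schwartz_conj sphi.
have i1 psi : schwartz psi -> cintg3 (fun x => f x * psi x).
  by move=> sp; have [K hK] := schwartz_lor sp; exact: (cintg_hatb hf (schwartz_meas sp) hK).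
rewrite -[LHS]/(cInt3 _) -[RHS]/(cInt3 _).
have -> : cInt3 (fun x => f (- x) * phi x) = v (fourier (fun x => phi (- x))).
  rewrite vf // -[RHS]/(cInt3 _) (cInt_scales scales_opp (i1 _ sN)) mul1r.
  by apply: cInt_eq => x; rewrite opprK.
have -> : cInt3 (fun x => (f x)^*%C * phi x) = (v (fourier (conjf phi)))^*%C.
  rewrite vf // -[X in _ = (X)^*%C]/(cInt3 _) -cInt_conj; last exact: i1.
  by apply: cInt_eq => x; rewrite conjCM; congr (_ * _); rewrite /conjf; case: (phi x) => a b /=; rewrite opprK.
have -> : fourier (conjf phi) = conjf (fourier (fun x => phi (- x))).
  apply/funext => x; by rewrite fourier_conj // /conjf fourier_opp.
rewrite (tempered_conj tv rv); last exact: schwartz_fourier.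
by case: (v _) => a b /=; rewrite opprK.
Qed.

Lemma tempered_add (v w : distr R) : tempered v -> tempered w -> tempered (fun psi => v psi + w psi).
Proof.
move=> [lv [N1 [A1 b1]]] [lw [N2 [A2 b2]]]; split.
  by move=> a phi psi sp sq; rewrite lv // lw //; ring.
exists (maxn N1 N2), (A1 + A2) => phi M sp hM.
rewrite mulrDl; apply: (le_trans (le_normcD _ _)); apply: lerD.
- by apply: b1 => // s k x sN kN; apply: hM; rewrite leq_max ?sN ?kN.
- by apply: b2 => // s k x sN kN; apply: hM; rewrite leq_max ?sN ?kN orbT.
Qed.

Lemma tempered_opp (v : distr R) : tempered v -> tempered (fun psi => - v psi).
Proof.
move=> [lv [N1 [A1 b1]]]; split; first by move=> a phi psi sp sq; rewrite lv //; ring.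
exists N1, A1 => phi M sp hM; rewrite -mulN1r Normc.normcM -(rmorphN1 (real_complex R)) normc_real normrN1 mul1r.
exact: b1.
Qed.

Lemma is_fourier_add M N (v w : distr R) f g : hatb M f -> hatb N g -> is_fourier v f -> is_fourier w g ->
  is_fourier (fun psi => v psi + w psi) (fun x => f x + g x).
Proof.
move=> hf hg [_ vf] [_ wg]; split; first exact: (hatb_L1loc (hatbD hf hg)).
move=> phi sphi; have [K hK] := schwartz_lor sphi; have mp := schwartz_meas sphi.
rewrite vf // wg // -[RHS]/(cInt3 _) -[X in X + _]/(cInt3 _) -[X in _ + X]/(cInt3 _) -cIntD.
- by apply: cInt_eq => x; rewrite mulrDl.
- exact: (cintg_hatb hf mp hK).
- exact: (cintg_hatb hg mp hK).
Qed.

Lemma is_fourier_opp M (v : distr R) f : hatb M f -> is_fourier v f ->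
  is_fourier (fun psi => - v psi) (fun x => - f x) /\ hatb M (fun x => - f x).
Proof.
move=> hf [_ vf].
have hN : hatb M (fun x => - f x).
  split; first exact: (cmeasN hf.1).
  apply: (@ae_imp _ (RRR R) R leb3 _ _ hf.2) => x.
  by rewrite -mulN1r Normc.normcM -(rmorphN1 (real_complex R)) normc_real normrN1 mul1r.
split=> //; split; first exact: (hatb_L1loc hN).
move=> phi sphi; have [K hK] := schwartz_lor sphi; have mp := schwartz_meas sphi.
rewrite vf // -[RHS]/(cInt3 _) -[X in - X]/(cInt3 _) -cIntN; last exact: (cintg_hatb hf mp hK).
by apply: cInt_eq => x; rewrite mulNr.
Qed.

End HomogeneousBound.

Lemma ae_ord3 d (T : measurableType d) (R : realType) (mu : {measure set T -> \bar R}) (P : 'I_3 -> T -> Prop) :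
  (forall i, {ae mu, forall x, P i x}) -> {ae mu, forall x, forall i, P i x}.
Proof.
move=> aP; have := ae_foralln (fun n => aP (inord n)).
by move=> /ae_imp; apply => x H i; rewrite -(inord_val i).
Qed.

(** * Norms and elements of the spaces PM and Cw *)

Section SpaceNorms.
Context {R : realType}.
Local Notation C := R[i].
Implicit Types (x xi : R3 R) (f g : R3 R -> C) (M : R) (v w : vdistr R) (u : curve R).

Lemma ae3_imp (P Q : R3 R -> Prop) : {ae leb3, forall x, P x} -> (forall x, P x -> Q x) ->
  {ae leb3, forall x, Q x}.
Proof. exact: (@ae_imp _ (RRR R) R leb3). Qed.

Lemma ae3_imp2 (P Q S : R3 R -> Prop) : {ae leb3, forall x, P x} -> {ae leb3, forall x, Q x} ->
  (forall x, P x -> Q x -> S x) -> {ae leb3, forall x, S x}.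
Proof. exact: (@ae_imp2 _ (RRR R) R leb3). Qed.

Lemma ae3_ord3 (P : 'I_3 -> R3 R -> Prop) : (forall i, {ae leb3, forall x, P i x}) ->
  {ae leb3, forall x, forall i, P i x}.
Proof. exact: (@ae_ord3 _ (RRR R) R leb3). Qed.

(** If no point satisfied [P], the function [prod3 lor] would vanish almost everywhere, but its
    integral is pi^3. A point of this kind shows that a constant in an almost everywhere bound is
    nonnegative. *)
Lemma ae_ex (P : R3 R -> Prop) : {ae leb3, forall x, P x} -> exists x, P x.
Proof.
move=> aP; apply: contrapT => nP.
have E : Int3 (prod3 (@lor R)) = Int3 (fun=> 0 : R).
  apply: (@Int_ae _ (RRR R) R leb3).
  - exact: (intg_meas (intg_prod3 (@intg_lor R))).
  - exact: measurable_cst.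
  - by apply: (ae3_imp aP) => x Px; exfalso; apply: nP; exists x.
move: E; rewrite (Int_prod3 (@intg_lor R)) (@Int0 _ (RRR R) R leb3) (proj2 (@intg_lor_pi R)) => /eqP.
by rewrite expf_eq0 /= gt_eqF // pi_gt0.
Qed.

Lemma pm_norm2P v M : (pm_norm 2 v <= M%:E)%E <->
  {ae leb3, forall xi, dot xi xi * cvnorm (fun i => hat (v i) xi) <= M}.
Proof.
have E xi : enorm xi `^ 2 = dot xi xi by rewrite powR_mulrn ?enorm_ge0 // enorm_sqr.
split=> [/ess_supP|H]; last apply/ess_supP.
  by move=> H; apply: (ae3_imp H) => xi; rewrite lee_fin E.
by apply: (ae3_imp H) => xi; rewrite lee_fin E.
Qed.

Lemma pm_norm0P v M : (pm_norm 0 v <= M%:E)%E <->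
  {ae leb3, forall xi, cvnorm (fun i => hat (v i) xi) <= M}.
Proof.
split=> [/ess_supP|H]; last apply/ess_supP.
  by move=> H; apply: (ae3_imp H) => xi; rewrite lee_fin powRr0 mul1r.
by apply: (ae3_imp H) => xi; rewrite lee_fin powRr0 mul1r.
Qed.

Lemma cw_normP (a : R) u (M : \bar R) : (cw_norm a u <= M)%E <->
  forall t : R, 0 <= t -> (pm_norm a (u t) <= M)%E.
Proof.
split=> [H t t0|H].
  apply: le_trans H; apply: ereal_sup_ubound; exists t => //.
  by rewrite /= in_itv /= t0.
by apply: ub_ereal_sup => _ [t /= ht <-]; apply: H; move: ht; rewrite in_itv /= andbT.
Qed.

Lemma pm_norm_ge0 (a : R) v : (0 <= pm_norm a v)%E.
Proof.
rewrite leNgt; apply/negP => H.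
have := ess_sup_ge leb3 (fun xi => (enorm xi `^ a * cvnorm (fun i => hat (v i) xi))%:E).
move=> /ae_ex[x]; rewrite -/(pm_norm a v) => /le_lt_trans/(_ H).
by rewrite lte_fin ltNge mulr_ge0 ?powR_ge0 ?cvnorm_ge0.
Qed.

Lemma cw_norm_ge0 (a : R) u : (0 <= cw_norm a u)%E.
Proof.
apply: (le_trans (pm_norm_ge0 a (u 0))).
exact: ((cw_normP a u (cw_norm a u)).1 (lexx _) 0 (lexx 0)).
Qed.

Lemma Cw_norm (a : R) u : Cw a u -> exists2 M, 0 <= M & cw_norm a u = M%:E.
Proof.
move=> [_ + _]; have := cw_norm_ge0 a u; case: (cw_norm a u) => // M M0 _.
by exists M.
Qed.

Lemma ae_dot_gt0 : {ae leb3, forall x, 0 < dot x x}.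
Proof. by apply: (ae3_imp ae_neq0) => x; exact: dot_gt0. Qed.

Definition weight2 (z : R3 R -> 'I_3 -> C) M := {ae leb3, forall xi, dot xi xi * cvnorm (z xi) <= M}.

Lemma weight2_hatb (z : R3 R -> 'I_3 -> C) M i : cmeas3 (fun x => z x i) -> weight2 z M ->
  hatb M (fun x => z x i).
Proof.
move=> mz zM; split=> //.
have M0 : 0 <= M.
  have [x] := ae_ex zM; apply: le_trans; by rewrite mulr_ge0 ?dot_ge0 ?cvnorm_ge0.
apply: (ae3_imp2 zM ae_dot_gt0) => x zx x0.
apply: (le_trans (normc_le_cvnorm _ i)).
rewrite mulrDr mulr1 ler_wpDr // ler_pdivlMr // mulrC //.
Qed.

Lemma PM_comp a v i : PM a v -> [/\ tempered (v i), real_distr (v i), is_fourier (v i) (hat (v i)) &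
  cmeas3 (hat (v i))].
Proof.
move=> [/(_ i)[tv rv [f vf]] _]; have h := hat_spec vf.
by split => //; exact: h.1.1.
Qed.

Lemma PM2_hatb v i M : PM 2 v -> (pm_norm 2 v <= M%:E)%E -> hatb M (hat (v i)).
Proof.
move=> Pv /pm_norm2P H; have [_ _ _ mv] := PM_comp i Pv.
exact: (@weight2_hatb (fun x i => hat (v i) x)).
Qed.

Lemma PM0_hatb v i M : PM 0 v -> (pm_norm 0 v <= M%:E)%E -> hatb M (hat (v i)).
Proof.
move=> Pv /pm_norm0P H; have [_ _ _ mv] := PM_comp i Pv; split=> //.
have M0 : 0 <= M by have [x] := ae_ex H; apply: le_trans; exact: cvnorm_ge0.
apply: (ae3_imp H) => x hx.
apply: (le_trans (normc_le_cvnorm (fun i => hat (v i) x) i)); apply: (le_trans hx).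
by rewrite ler_peMr // lerDr wt_ge0.
Qed.

Lemma PM_fin (a : R) v : PM a v -> exists M, (pm_norm a v <= M%:E)%E.
Proof.
move=> [_]; have := pm_norm_ge0 a v; case: (pm_norm a v) => // M _ _; by exists M.
Qed.

Lemma PM2_hatb_ex v i : PM 2 v -> exists M, hatb M (hat (v i)).
Proof. by move=> Pv; have [M hM] := PM_fin Pv; exists M; exact: PM2_hatb. Qed.

Lemma PM2_hermitian v i : PM 2 v -> hermitian (hat (v i)).
Proof.
move=> Pv; have [M hM] := PM2_hatb_ex i Pv; have [tv rv fv _] := PM_comp i Pv.
exact: (hat_hermitian tv rv fv hM).
Qed.

Lemma PM0_hermitian v i : PM 0 v -> hermitian (hat (v i)).
Proof.
move=> Pv; have [M hM] := PM_fin Pv; have [tv rv fv _] := PM_comp i Pv.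
exact: (hat_hermitian tv rv fv (PM0_hatb i Pv hM)).
Qed.

Lemma PM_of_hat (z : R3 R -> 'I_3 -> C) M : (forall i, cmeas3 (fun x => z x i)) -> weight2 z M ->
  (forall i, hermitian (fun x => z x i)) ->
  [/\ PM 2 (fun i => of_hat (fun x => z x i)),
      (pm_norm 2 (fun i => of_hat (fun x => z x i)) <= M%:E)%E &
      {ae leb3, forall x i, hat (of_hat (fun x => z x i)) x = z x i}].
Proof.
move=> mz zM hz; have hb i := weight2_hatb (mz i) zM.
have aeh : {ae leb3, forall x i, hat (of_hat (fun x => z x i)) x = z x i}.
  by apply: ae3_ord3 => i; exact: (hat_of_hat (hb i)).
have nM : (pm_norm 2 (fun i => of_hat (fun x => z x i)) <= M%:E)%E.
  apply/pm_norm2P; apply: (ae3_imp2 zM aeh) => x zx hx.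
  by rewrite (_ : (fun i => _) = z x) //; apply/funext => i; rewrite hx.
split=> //; split; last by rewrite (le_lt_trans nM) ?ltry.
move=> i; have [t f] := of_hat_spec (hb i); split => //; last by exists (fun x => z x i).
exact: (of_hat_real (hb i) (hz i)).
Qed.

(** Continuity on t >= 0 in sequential form, because dominated convergence is available along
    sequences. *)
Definition seq_cont (g : R -> R) := forall (t : R) (s : nat -> R), 0 <= t -> (forall n, 0 <= s n) ->
  s n @[n --> \oo] --> t -> g (s n) @[n --> \oo] --> g t.

Lemma seq_cont_within (g : R -> R) : seq_cont g -> {within `[0, +oo[%classic, continuous g}.
Proof.
(* Precomposition with max(0, t) extends [g] continuously to the whole line, where the sequential
   criterion applies. *)
move=> gc; have c0 : continuous (fun t : R => g (Num.max 0 t)).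
  move=> t; apply: ((@cvg_nbhsP R R^o (fun t : R => g (Num.max 0 t)) t _).2) => s st; apply: gc; [by rewrite le_max lexx|by move=> n; rewrite le_max lexx|].
  by apply: continuous_cvg st; apply: continuous_max; [exact: cst_continuous|exact: cvg_id].
have : {within `[(0:R), +oo[%classic, continuous (fun t : R => g (Num.max 0 t))} := continuous_subspaceT c0.
apply: subspace_eq_continuous => t; rewrite inE /= in_itv /= andbT => t0.
by rewrite /from_subspace /= max_r.
Qed.

(** Weak continuity follows from continuity in t at almost every fixed x: the pairing with a test
    function is an integral against its transform, and the weight bound, uniform in t, supplies an
    integrable majorant. *)
Lemma Cw_of_hat (f : R -> 'I_3 -> R3 R -> C) M :
  (forall (t : R) i, 0 <= t -> cmeas3 (f t i)) ->
  (forall t : R, 0 <= t -> weight2 (fun x i => f t i x) M) ->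
  (forall (t : R) i, 0 <= t -> hermitian (f t i)) ->
  (forall i, {ae leb3, forall x, seq_cont (fun t => Re (f t i x)) /\ seq_cont (fun t => Im (f t i x))}) ->
  [/\ Cw 2 (fun t i => of_hat (f t i)), (cw_norm 2 (fun t i => of_hat (f t i)) <= M%:E)%E &
    forall t : R, 0 <= t -> {ae leb3, forall x i, hat (of_hat (f t i)) x = f t i x}].
Proof.
move=> mf fM hf cf.
have P (t : R) (t0 : 0 <= t) := PM_of_hat (fun i => mf t i t0) (fM t t0) (fun i => hf t i t0).
have hb (t : R) i (t0 : 0 <= t) := weight2_hatb (mf t i t0) (fM t t0).
have nM : (cw_norm 2 (fun t i => of_hat (f t i)) <= M%:E)%E.
  by apply/cw_normP => t t0; have [_ h _] := P t t0.
split=> //; last by move=> t t0; have [_ _] := P t t0.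
split.
- by move=> t t0; have [] := P t t0.
- by rewrite (le_lt_trans nM) ?ltry.
move=> i psi sp.
have [K hK] := schwartz_lor (schwartz_opp (schwartz_fourier sp)).
have key (t : R) (s : nat -> R) : 0 <= t -> (forall n, 0 <= s n) -> s n @[n --> \oo] --> t ->
    Re (of_hat (f (s n) i) psi) @[n --> \oo] --> Re (of_hat (f t i) psi) /\
    Im (of_hat (f (s n) i) psi) @[n --> \oo] --> Im (of_hat (f t i) psi).
  move=> t0 s0 st; rewrite (of_hatE (hb _ i t0) sp).
  under eq_fun do rewrite (of_hatE (hb _ i (s0 _)) sp).
  under [X in _ /\ (X @ _ --> _)]eq_fun do rewrite (of_hatE (hb _ i (s0 _)) sp).
  apply: (@cInt_dct _ (RRR R) R leb3 _ _ (fun x => M * (wt1 x * (K * prod3 lor x)))).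
  - by move=> n; exact: (cintg_meas (cintg_dist (hb _ i (s0 n)) sp)).
  - exact: (cintg_meas (cintg_dist (hb _ i t0) sp)).
  - have := intgZ (M * K) (@intg_wt1_lor R); congr intg; apply/funext => x; ring.
  - move=> n; have [_ b] := hb _ i (s0 n); apply: (ae3_imp b) => x bx.
    rewrite Normc.normcM mulrA; apply: ler_pM; rewrite ?normc_ge0 //; exact: hK.
  - apply: (ae3_imp (cf i)) => x [cR cI].
    have hR := cR t s t0 s0 st; have hI := cI t s t0 s0 st.
    split.
    + under eq_fun do rewrite ReM; rewrite ReM.
      by apply: cvgB; apply: cvgM => //; exact: cvg_cst.
    + under eq_fun do rewrite ImM; rewrite ImM.
      by apply: cvgD; apply: cvgM => //; exact: cvg_cst.
by split; apply: seq_cont_within => t s t0 s0 st; have [] := key t s t0 s0 st.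
Qed.

Lemma curve_sub_hat v w i : PM 2 v -> PM 2 w ->
  {ae leb3, forall x, hat (fun psi => v i psi - w i psi) x = hat (v i) x - hat (w i) x}.
Proof.
move=> Pv Pw; have [M hM] := PM2_hatb_ex i Pv; have [N hN] := PM2_hatb_ex i Pw.
have [_ _ fv _] := PM_comp i Pv; have [_ _ fw _] := PM_comp i Pw.
have [fw' hN'] := is_fourier_opp hN fw.
exact/hat_ae/(is_fourier_add hM hN' fv fw').
Qed.

Lemma PM_sub_norm v w M N : PM 2 v -> PM 2 w -> (pm_norm 2 v <= M%:E)%E -> (pm_norm 2 w <= N%:E)%E ->
  (pm_norm 2 (fun i psi => v i psi - w i psi)%R <= (M + N)%:E)%E.
Proof.
move=> Pv Pw /pm_norm2P hM /pm_norm2P hN.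
have H := ae3_ord3 (fun i => curve_sub_hat i Pv Pw).
apply/pm_norm2P.
have HMN := ae3_imp2 hM hN (fun x a b => conj a b).
apply: (ae3_imp2 H HMN) => x Hx [a b].
rewrite (_ : (fun i => _) = (fun i => hat (v i) x + - hat (w i) x)); last by apply/funext.
apply: (le_trans (ler_wpM2l (dot_ge0 x) (cvnormD _ _))).
by rewrite cvnormN mulrDr lerD.
Qed.

Lemma PM_sub v w : PM 2 v -> PM 2 w -> PM 2 (fun i psi => v i psi - w i psi).
Proof.
move=> Pv Pw; have [M hM] := PM_fin Pv; have [N hN] := PM_fin Pw.
split; last by apply: (le_lt_trans (PM_sub_norm Pv Pw hM hN)); exact: ltry.
move=> i; have [M' hM'] := PM2_hatb_ex i Pv; have [N' hN'] := PM2_hatb_ex i Pw.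
have [tv rv fv _] := PM_comp i Pv; have [tw rw fw _] := PM_comp i Pw.
have [fw' hN''] := is_fourier_opp hN' fw.
split; first exact: (tempered_add tv (tempered_opp tw)).
- by move=> phi sp rp; rewrite ImD ImN rv // rw // subr0.
- by exists (fun x => hat (v i) x - hat (w i) x); exact: (is_fourier_add hM' hN'' fv fw').
Qed.

Lemma Cw_fin (a : R) u (t : R) : Cw a u -> 0 <= t -> PM a (u t).
Proof. by move=> [H _ _] t0; exact: H. Qed.

Lemma Cw_le (a : R) u (M : R) (t : R) : (cw_norm a u <= M%:E)%E -> 0 <= t -> (pm_norm a (u t) <= M%:E)%E.
Proof. by move=> /cw_normP H t0; exact: H. Qed.

Lemma Cw_sub u1 u2 : Cw 2 u1 -> Cw 2 u2 -> Cw 2 (curve_sub u1 u2).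
Proof.
move=> C1 C2; have [P1 n1 c1] := C1; have [P2 n2 c2] := C2.
have [M M0 hM] := Cw_norm C1; have [N N0 hN] := Cw_norm C2.
split; first by move=> t t0; exact: (PM_sub (P1 t t0) (P2 t t0)).
  apply: (@le_lt_trans _ _ (M + N)%:E); last exact: ltry.
  apply/cw_normP => t t0; apply: PM_sub_norm; [exact: P1|exact: P2| |].
    by apply: Cw_le t0; rewrite hM.
  by apply: Cw_le t0; rewrite hN.
move=> i phi sp; have [r1 i1] := c1 i phi sp; have [r2 i2] := c2 i phi sp.
split.
- rewrite (_ : (fun t => _) = (fun t : R => Re (u1 t i phi) - Re (u2 t i phi))).
    by move=> t; apply: cvgB; [exact: r1|exact: r2].
  by apply/funext => t; rewrite -ReN -ReD.
- rewrite (_ : (fun t => _) = (fun t : R => Im (u1 t i phi) - Im (u2 t i phi))).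
    by move=> t; apply: cvgB; [exact: i1|exact: i2].
  by apply/funext => t; rewrite -ImN -ImD.
Qed.

End SpaceNorms.

(** * Exchange of almost everywhere quantifiers; the Leray projector *)

Section AeSwap.
Context d1 d2 (T1 : measurableType d1) (T2 : measurableType d2) (R : realType).
Variables (m1 : {sigma_finite_measure set T1 -> \bar R}) (m2 : {sigma_finite_measure set T2 -> \bar R}).

(** Tonelli applied to the indicator of the set where f > M. Bounds come for almost every time and
    then almost every frequency, but time integrals are taken at a fixed frequency. *)
Lemma ae_swap (f : T1 * T2 -> R) (M : R) : measurable_fun setT f ->
  {ae m1, forall x, {ae m2, forall y, f (x, y) <= M}} ->
  {ae m2, forall y, {ae m1, forall x, f (x, y) <= M}}.
Proof.
move=> mf H.
pose h (p : T1 * T2) : R := \1_(`]M, +oo[%classic) (f p).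
have mh : measurable_fun setT h.
  by apply: (measurableT_comp _ mf); apply: measurable_indic; exact: measurable_itv.
have mhE : measurable_fun setT (EFin \o h) by exact/measurable_EFinP.
have h0 p : (0 <= (EFin \o h) p)%E by rewrite lee_fin.
have hM p : f p <= M <-> h p = 0.
  rewrite /h indicE; split => [fM|].
    by rewrite memNset //= in_itv /= andbT; apply/negP; rewrite -leNgt.
  by case: (boolP (f p \in _)) => [_ /eqP|+ _]; [rewrite oner_eq0|rewrite notin_setE /= in_itv /= andbT => /negP; rewrite -leNgt].
have F : (\int[m1]_x \int[m2]_y (h (x, y))%:E = 0)%E.
  apply: (@eq_trans _ _ (\int[m1]_x `|\int[m2]_y (h (x, y))%:E|)%E).
    by apply: eq_integral => x _; rewrite gee0_abs //; apply: integral_ge0 => y _; exact: (h0 (x, y)).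
  have mF : measurable_fun setT (fun x => \int[m2]_y (h (x, y))%:E)%E.
    exact: (@measurable_fun_fubini_tonelli_F _ _ T1 T2 R m2 _ mhE h0).
  apply/(ae_eq_integral_abs m1 measurableT mF); apply: (ae_imp H) => x Hx _ /=.
  apply: (@eq_trans _ _ (\int[m2]_y `|(h (x, y))%:E|)%E).
    by apply: eq_integral => y _; rewrite gee0_abs //; exact: (h0 (x, y)).
  apply/(ae_eq_integral_abs m2 measurableT); first exact: (measurableT_comp mhE (pair1_measurable x)).
  by apply: (ae_imp Hx) => y /hM hy _ /=; rewrite hy.
have G : (\int[m2]_y \int[m1]_x (h (x, y))%:E = 0)%E.
  rewrite -F; apply/esym; exact: (@fubini_tonelli _ _ T1 T2 R m1 m2 _ mhE h0).
have mG : measurable_fun setT (fun y => \int[m1]_x (h (x, y))%:E)%E.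
  exact: (@measurable_fun_fubini_tonelli_G _ _ T1 T2 R m1 _ mhE h0).
have : (\int[m2]_y `|\int[m1]_x (h (x, y))%:E| = 0)%E.
  rewrite -[RHS]G; apply: eq_integral => y _; rewrite gee0_abs //.
  by apply: integral_ge0 => x _; exact: (h0 (x, y)).
move/(ae_eq_integral_abs m2 measurableT mG)/ae_imp; apply => y /(_ Logic.I) Hy.
have : (\int[m1]_x `|(h (x, y))%:E| = 0)%E.
  by rewrite -[RHS]Hy; apply: eq_integral => x _; rewrite gee0_abs //; exact: (h0 (x, y)).
move/(ae_eq_integral_abs m1 measurableT); move=> /(_ _)/ae_imp; apply.
  exact: (measurableT_comp mhE (pair2_measurable y)).
by move=> x /(_ Logic.I) [] /hM.
Qed.

End AeSwap.

Section Leray.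
Context {R : realType}.
Local Notation C := R[i].
Implicit Types (xi : R3 R) (z w : 'I_3 -> C).

(** With q = (xi.a) / |xi|^2 the j-th component is a_j - xi_j q, and the squared norm drops by q^2
    |xi|^2: the matrix is an orthogonal projection. At xi = 0 the convention gives q = 0 and the
    matrix is the identity. *)
Lemma leray_real_le xi (a : 'I_3 -> R) :
  \sum_(j < 3) (\sum_(k < 3) ((j == k)%:R - coord xi j * coord xi k / enorm xi ^+ 2) * a k) ^+ 2
  <= \sum_(j < 3) a j ^+ 2.
Proof.
pose q := (\sum_(k < 3) coord xi k * a k) / enorm xi ^+ 2.
have E j : \sum_(k < 3) ((j == k)%:R - coord xi j * coord xi k / enorm xi ^+ 2) * a k = a j - coord xi j * q.
  under eq_bigr do rewrite mulrBl; rewrite sumrB; congr (_ - _).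
    rewrite (bigD1 j) //= eqxx mul1r big1 ?addr0 // => k kj.
    by rewrite eq_sym (negPf kj) mul0r.
  by rewrite /q mulr_suml mulr_sumr; apply: eq_bigr => k _; ring.
under eq_bigr do rewrite E.
have qn : q * (\sum_(k < 3) coord xi k * a k) = q ^+ 2 * enorm xi ^+ 2.
  rewrite /q; have [->|n0] := eqVneq (enorm xi ^+ 2) 0; first by rewrite invr0; ring.
  by move: (\sum_(k < 3) _) (enorm xi ^+ 2) n0 => S n n0; field.
have nE : enorm xi ^+ 2 = \sum_(k < 3) coord xi k * coord xi k by rewrite enorm_sqr.
have q0 : 0 <= q ^+ 2 * enorm xi ^+ 2 by rewrite mulr_ge0 // sqr_ge0.
move: qn q0; rewrite nE !big3; move: (coord xi 0) (coord xi 1) (coord xi 2) (a 0) (a 1) (a 2) => x y u b c d qn q0.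
lra.
Qed.

Lemma Re_leray xi z j : Re (leray xi z j) =
  \sum_(k < 3) ((j == k)%:R - coord xi j * coord xi k / enorm xi ^+ 2) * Re (z k).
Proof. by rewrite /leray !big3 !ReD !ReM /= !mul0r !subr0. Qed.

Lemma Im_leray xi z j : Im (leray xi z j) =
  \sum_(k < 3) ((j == k)%:R - coord xi j * coord xi k / enorm xi ^+ 2) * Im (z k).
Proof. by rewrite /leray !big3 !ImD !ImM /= !mul0r !addr0. Qed.

Lemma leray_le xi z : cvnorm (leray xi z) <= cvnorm z.
Proof.
rewrite -(@ler_pXn2r _ 2) ?nnegrE ?cvnorm_ge0 // !cvnorm_sqr.
under eq_bigr do rewrite normc_sqr Re_leray Im_leray.
under [X in _ <= X]eq_bigr do rewrite normc_sqr.
by rewrite !big_split; apply: lerD; exact: leray_real_le.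
Qed.

Lemma lerayB xi z w j : leray xi (fun k => z k - w k) j = leray xi z j - leray xi w j.
Proof. by rewrite /leray -sumrB; apply: eq_bigr => k _; rewrite mulrBr. Qed.

Lemma leray_herm xi z w j : (forall k, w k = (z k)^*%C) -> leray (- xi) w j = (leray xi z j)^*%C.
Proof.
move=> wz.
have cN k : coord (- xi) k = - coord xi k by rewrite -scaleN1r coordZ mulN1r.
have Rc (a : C) : Re (a^*%C) = Re a by case: a.
have Ic (a : C) : Im (a^*%C) = - Im a by case: a.
apply: complex_eq; rewrite ?Rc ?Ic ?Re_leray ?Im_leray ?enormN.
- by apply: eq_bigr => k _; rewrite !cN mulrNN wz Rc.
- by rewrite -sumrN; apply: eq_bigr => k _; rewrite !cN mulrNN wz Ic mulrN.
Qed.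

Lemma cmeas_leray d (T : measurableType d) (x : T -> R3 R) (z : T -> 'I_3 -> C) j :
  @measurable_fun _ _ T (RRR R) setT x -> (forall k, cmeasurable (fun p => z p k)) ->
  cmeasurable (fun p => leray (x p) (z p) j).
Proof.
move=> mx mz; apply: cmeas_sum => k; apply: cmeasM => //.
apply: cmeas_real; apply: measurable_funB => //.
have mc i : measurable_fun setT (fun p => coord (x p) i) by exact: (measurableT_comp (measurable_coord i) mx).
apply: measurable_funM; first exact: measurable_funM.
apply: measurable_inv; apply: measurable_funX.
exact: (measurableT_comp measurable_enorm mx).
Qed.

End Leray.

(** * Time integrals *)

Section TimeKernel.
Context {R : realType}.
Local Notation C := R[i].
Local Notation leb1 := (@lebesgue_measure R : {measure set (measurableTypeR R) -> \bar R}).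
Implicit Types (s t tau : R).

(** The interval of integration is turned into an indicator, so that t becomes a parameter of an
    integrand on the whole line. Joint measurability and dominated convergence as t varies then
    apply. *)
Definition tker s t tau : R := (0 <= tau <= t)%R%:R * expR (- ((t - tau) * s)).

Lemma tker_ge0 s t tau : 0 <= tker s t tau.
Proof. by rewrite mulr_ge0 // expR_ge0. Qed.

Lemma tker_le1 s t B tau : 0 <= s -> t <= B -> tker s t tau <= (0 <= tau <= B)%R%:R.
Proof.
move=> s0 tB; rewrite /tker; case: (boolP (0 <= tau <= t)) => [/andP[h0 h]|_]; last by rewrite mul0r ler0n.
by rewrite h0 (le_trans h tB) mul1r -[X in _ <= X]expR0 ler_expR oppr_le0 mulr_ge0 ?subr_ge0.
Qed.

Lemma meas_box B : @measurable_fun _ _ (measurableTypeR R) _ setT (fun tau : R => (0 <= tau <= B)%R%:R : R).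
Proof.
have := @measurable_indic _ (measurableTypeR R) R setT _ (measurable_itv `[(0:R), B]).
apply: eq_measurable_fun => tau _; rewrite indicE; congr (nat_of_bool _)%:R.
by apply/idP/idP; rewrite inE /= in_itv.
Qed.

Lemma intg_box B : intg leb1 (fun tau => (0 <= tau <= B)%R%:R : R).
Proof.
apply: (@intg_le _ (measurableTypeR R) R leb1 _ _ (meas_box B) (intgZ (1 + B ^+ 2) (@intg_lor R))) => tau.
rewrite ger0_norm ?ler0n //; case: (boolP (0 <= tau <= B)) => [/andP[h0 h]|_]; last first.
  by rewrite mulr_ge0 ?lor_ge0 // addr_ge0 // sqr_ge0.
rewrite /lor ler_pdivlMr ?mul1r ?lerD2l ?ler_pXn2r ?nnegrE // ?(le_trans h0 h) //.
by rewrite ltr_pwDl // sqr_ge0.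
Qed.

Lemma measurable_tker d (T : measurableType d) (s t tau : T -> R) : measurable_fun setT s ->
  measurable_fun setT t -> measurable_fun setT tau ->
  measurable_fun setT (fun p => tker (s p) (t p) (tau p)).
Proof.
move=> ms mt mtau; apply: measurable_funM.
- have m1 : measurable_fun setT (fun p => 0 <= tau p) by apply: measurable_fun_ler.
  have m2 : measurable_fun setT (fun p => tau p <= t p) by apply: measurable_fun_ler.
  have m3 := measurable_and m1 m2.
  rewrite (_ : (fun p => _) = (fun p => if (0 <= tau p) && (tau p <= t p) then 1 else 0 : R)); last first.
    by apply/funext => p; case: (_ && _).
  exact: measurable_fun_ifT.
- apply: (measurableT_comp (@measurable_expR R)).
  rewrite (_ : (fun p => _) = (fun p => (tau p - t p) * s p)); last by apply/funext => p; ring.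
  by apply: measurable_funM => //; exact: measurable_funB.
Qed.

Lemma meas_tker s t : @measurable_fun _ _ (measurableTypeR R) _ setT (fun tau => tker s t tau).
Proof. by apply: (@measurable_tker _ (measurableTypeR R)). Qed.

Lemma intg_tker s t : 0 <= s -> intg leb1 (fun tau => tker s t tau).
Proof.
move=> s0; apply: (@intg_le _ (measurableTypeR R) R leb1 _ _ (meas_tker s t) (intg_box t)) => tau.
by rewrite ger0_norm ?tker_ge0 // tker_le1.
Qed.

Lemma ae_neq1 t : {ae leb1, forall tau, tau != t}.
Proof.
exists [set t]; split; first exact: measurable_set1.
- exact: lebesgue_measure_set1.
- by move=> x /= /negP; rewrite negbK => /eqP ->.
Qed.

Lemma scales_flip t : @scales R _ (measurableTypeR R) leb1 (fun tau => t - tau) 1.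
Proof.
have n0 : (-1 : R) != 0 by rewrite oppr_eq0 oner_eq0.
have := scales_affine t n0; rewrite normrN1.
by under [X in scales _ X]eq_fun do rewrite mulN1r addrC.
Qed.

(** After the flip of tau to t - tau the kernel lies below the right half of [dexp s], except
    possibly at tau = t. The two halves of [dexp s] are mirror images with total mass at most 2/s,
    so one half has mass at most 1/s. *)
Lemma Int_tker_le s t : 0 < s -> s * Int leb1 (fun tau => tker s t tau) <= 1.
Proof.
move=> s0; have [id Id] := dexp_int s0.
pose p (x : R) := (0 < x)%R%:R * dexp s x.
have mp : @measurable_fun _ _ (measurableTypeR R) _ setT p.
  apply: measurable_funM; last exact: (intg_meas id).
  have := @measurable_indic _ (measurableTypeR R) R setT _ (measurable_itv `](0:R), +oo[).
  apply: eq_measurable_fun => x _; rewrite indicE; congr (nat_of_bool _)%:R.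
  by apply/idP/idP; rewrite inE /= in_itv /= andbT.
have d0 x : 0 <= dexp s x by exact: expR_ge0.
have ip : intg leb1 p.
  apply: (@intg_le _ (measurableTypeR R) R leb1 _ _ mp id) => x.
  by rewrite ger0_norm ?mulr_ge0 // ler_piMl // lern1 leq_b1.
have ip' := intg_scales (scales_flip 0) ip.
have E : Int leb1 p + Int leb1 p <= 2 / s.
  rewrite -Id {2}(Int_scales (scales_flip 0) ip) mul1r -IntD //.
  apply: Int_le => //; first exact: intgD.
  move=> x; rewrite /p sub0r oppr_gt0 /dexp normrN -mulrDl ler_piMl ?expR_ge0 //.
  by case: (ltgtP 0 x) => _; rewrite ?addr0 ?add0r.
have P1 : Int leb1 (fun tau => tker s t tau) <= Int leb1 p.
  rewrite (Int_scales (scales_flip t) ip) mul1r; apply: (le_trans (ler_norm _)).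
  apply: Int_norm_le; [exact: (intg_scales (scales_flip t) ip)|exact: meas_tker|].
  apply: (ae_imp (ae_neq1 t)) => tau taut; rewrite ger0_norm ?tker_ge0 // /tker /p /dexp.
  case: (boolP (0 <= tau <= t)) => [/andP[_ h]|_]; last by rewrite mul0r mulr_ge0 ?expR_ge0.
  by rewrite subr_gt0 lt_neqAle taut h ger0_norm ?subr_ge0 // (mulrC s).
rewrite -ler_pdivlMl // mulr1.
by apply: (le_trans P1); move: E; rewrite -mulr2n mulrC; lra.
Qed.

Definition tInt s (g : R -> C) t : C := cInt leb1 (fun tau => (tker s t tau)%:C * g tau).

Lemma tIntE s g t : cintegral leb1 `[0, t]%classic (fun tau => (expR (- ((t - tau) * s)))%:C * g tau) = tInt s g t.
Proof.
have H (r q : R -> R) : (forall tau, r tau = (0 <= tau <= t)%R%:R * q tau) ->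
    Rintegral leb1 `[0, t]%classic q = Int leb1 r.
  move=> rq; rewrite Rintegral_mkcond; apply: Int_eq => tau; rewrite rq patchE.
  rewrite (_ : (tau \in _) = (0 <= tau <= t)); last by apply/idP/idP; rewrite inE /= in_itv.
  by case: ifP; rewrite ?mul1r ?mul0r.
apply: complex_eq; apply: H => tau; rewrite /tker; case: (g tau) => a b /=; ring.
Qed.

Section TimeIntegral.
Variables (s : R) (s0 : 0 < s) (g : R -> C) (K : R).
Hypotheses (mg : @cmeasurable R _ (measurableTypeR R) g)
  (gK : {ae leb1, forall tau, 0 <= tau -> normc (g tau) <= K}).

Lemma tInt_bound t (B : R) : t <= B ->
  {ae leb1, forall tau, normc ((tker s t tau)%:C * g tau) <= K * (0 <= tau <= B)%R%:R}.
Proof.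
move=> tB; apply: (ae_imp gK) => tau gt; rewrite normcMr ger0_norm ?tker_ge0 //.
have := tker_le1 tau (ltW s0) tB; have := tker_ge0 s t tau.
case: (boolP (0 <= tau <= B)) => [/andP[h0 _]|_] k0 k1; last first.
  by rewrite (_ : tker s t tau = 0) ?mul0r ?mulr0 //; apply/eqP; rewrite eq_le k0 andbT.
rewrite mulrC; apply: ler_pM; rewrite ?normc_ge0 //; exact: gt.
Qed.

Lemma tInt_meas t : @cmeasurable R _ (measurableTypeR R) (fun tau => (tker s t tau)%:C * g tau).
Proof. by apply: cmeasM => //; apply: cmeas_real; exact: meas_tker. Qed.

Lemma tInt_cintg t : cintg leb1 (fun tau => (tker s t tau)%:C * g tau).
Proof. exact: (cintg_le (tInt_meas t) (intgZ K (intg_box t)) (tInt_bound (lexx t))). Qed.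

Lemma tker_cvg t (u : nat -> R) tau : tau != t -> u n @[n --> \oo] --> t ->
  tker s (u n) tau @[n --> \oo] --> tker s t tau.
Proof.
move=> taut ut; apply: cvgM.
  apply: cvg_near_cst.
  case: (ltgtP tau t) taut => // h _.
  - move: ut => /cvgr_gt/(_ _ h) N.
    by apply: filterS N => n hn; rewrite (ltW hn).
  - move: ut => /cvgr_lt/(_ _ h) N.
    by apply: filterS N => n hn; rewrite [tau <= _]leNgt hn.
apply: (continuous_cvg _ (@continuous_expR R _)); apply: cvgN; apply: cvgM; last exact: cvg_cst.
by apply: cvgB => //; exact: cvg_cst.
Qed.

Lemma tInt_cont : seq_cont (fun t => Re (tInt s g t)) /\ seq_cont (fun t => Im (tInt s g t)).
Proof.
have key (t : R) (u : nat -> R) : u n @[n --> \oo] --> t ->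
    Re (tInt s g (u n)) @[n --> \oo] --> Re (tInt s g t) /\ Im (tInt s g (u n)) @[n --> \oo] --> Im (tInt s g t).
  (* A convergent sequence of times is bounded, so all the integrands live on one interval [0, B],
     where the constant [K] is integrable. *)
  move=> ut; have [B uB] : exists B, forall n, u n <= B.
    have [N [_ /(_ (N + 1) (ltr_pwDr ltr01 (lexx N))) H]] := cvg_seq_bounded (cvgP _ ut).
    by exists (N + 1) => n; apply: (le_trans (ler_norm _)); exact: H.
  apply: (cInt_dct (mu := leb1) (fun n => tInt_meas (u n)) (tInt_meas t) (intgZ K (intg_box B))).
    by move=> n; exact: tInt_bound.
  (* The kernel jumps in its second argument only at tau = t, a single point. *)
  apply: (ae_imp (ae_neq1 t)) => tau taut; have h := tker_cvg taut ut.
  split.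
  - under eq_fun do rewrite ReM /= mul0r subr0; rewrite ReM /= mul0r subr0.
    by apply: cvgM => //; exact: cvg_cst.
  - under eq_fun do rewrite ImM /= mul0r addr0; rewrite ImM /= mul0r addr0.
    by apply: cvgM => //; exact: cvg_cst.
by split => t u _ _ ut; have [] := key t u ut.
Qed.
End TimeIntegral.

(** Minkowski's inequality on the six real components keeps the constant 1. This matters for the
    force: its contribution to the linear part must be bounded by its own norm, since the smallness
    hypothesis adds the two norms as they stand. *)
Lemma tInt_vector_bound s (g : 'I_3 -> R -> C) (K t : R) : 0 < s -> 0 <= K ->
  (forall i, @cmeasurable R _ (measurableTypeR R) (g i)) ->
  {ae leb1, forall tau, 0 <= tau -> cvnorm (fun i => g i tau) <= K} ->
  s * cvnorm (fun i => tInt s (g i) t) <= K.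
Proof.
move=> s0 K0 mg gK.
have gK' i : {ae leb1, forall tau, 0 <= tau -> normc (g i tau) <= K}.
  by apply: (ae_imp gK) => tau H t0; apply: le_trans (H t0); exact: (normc_le_cvnorm (fun i => g i tau)).
have ik := intgZ K (intg_tker t (ltW s0)).
have k0 tau : 0 <= K * tker s t tau by rewrite mulr_ge0 // tker_ge0.
pose F (p : 'I_3 * bool) tau := parts (fun i => (tker s t tau)%:C * g i tau) p.
have iF p : intg leb1 (F p).
  by have [iR iI] := tInt_cintg s0 (mg p.1) (gK' p.1) t; case: p iR iI => i [].
have := Int_minkowski iF ik k0 _; rewrite IntZ; last exact: (intg_tker t (ltW s0)).
have -> : \sum_p Int leb1 (F p) ^+ 2 = cvnorm (fun i => tInt s (g i) t) ^+ 2.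
  by rewrite -sum_parts; apply: eq_bigr => -[i []].
move=> H; have {}H : cvnorm (fun i => tInt s (g i) t) <= K * Int leb1 (fun tau => tker s t tau).
  rewrite -(@ler_pXn2r _ 2) ?nnegrE ?cvnorm_ge0 //; last first.
    by rewrite mulr_ge0 //; apply: Int_ge0; exact: tker_ge0.
  apply: H; apply: (ae_imp gK) => tau gt.
  rewrite sum_parts ler_pXn2r ?nnegrE ?cvnorm_ge0 // cvnormZ ?tker_ge0 //.
  rewrite mulrC; have [h|h] := boolP (0 <= tau); first by rewrite ler_wpM2r ?tker_ge0 ?gt.
  by rewrite (_ : tker s t tau = 0) ?mulr0 // /tker (negPf h) mul0r.
apply: (le_trans (ler_wpM2l (ltW s0) H)).
by rewrite mulrCA ler_piMr // Int_tker_le.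
Qed.

End TimeKernel.

Notation mR R := (measurableTypeR R).
Notation TX R := (measurableTypeR R * (measurableTypeR R * measurableTypeR R * measurableTypeR R))%type.

(** * Convolutions and Duhamel integrals of fields *)

Section Convolution.
Context {R : realType}.
Local Notation C := R[i].
Local Notation leb1 := (@lebesgue_measure R : {measure set (measurableTypeR R) -> \bar R}).
Implicit Types (x xi : R3 R) (f g : R3 R -> C) (M N K : R).

Definition wtb M f := cmeas3 f /\ {ae leb3, forall x, normc (f x) <= M * wt x}.

Lemma wtb_ge0 M f : wtb M f -> 0 <= M.
Proof.
move=> [_ fM]; have [x [h x0]] := ae_ex (ae3_imp2 fM ae_dot_gt0 (fun x a b => conj a b)).
have w0 : 0 < wt x by rewrite invr_gt0.
by rewrite -(pmulr_lge0 _ w0) (le_trans (normc_ge0 _) h).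
Qed.

Lemma conv_intg M N f g xi : xi != 0 -> wtb M f -> wtb N g ->
  cintg3 (fun y => f (xi - y) * g y) /\ normc (conv f g xi) <= M * N * (cker / enorm xi).
Proof.
move=> x0 hf hg; have M0 := wtb_ge0 hf; have N0 := wtb_ge0 hg.
have [iw Iw] := intg_wt_conv x0; have [mf fM] := hf; have [mg gN] := hg.
have [mr _ _] := scales_reflect xi.
have mfg : cmeas3 (fun y => f (xi - y) * g y) by apply: cmeasM mg; exact: (cmeas_comp mf mr).
have ai : {ae leb3, forall y, normc (f (xi - y) * g y) <= M * N * (wt (xi - y) * wt y)}.
  apply: (ae3_imp2 (scales_ae (scales_reflect xi) fM) gN) => y h1 h2.
  by rewrite Normc.normcM mulrACA; apply: ler_pM; rewrite ?normc_ge0.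
have isum := intgZ (M * N) iw.
split; first exact: (@cintg_le _ (RRR R) R leb3 _ _ mfg isum ai).
apply: (le_trans (@normc_cInt_le _ (RRR R) R leb3 _ _ mfg isum ai)).
by rewrite IntZ // ler_wpM2l // mulr_ge0.
Qed.

Lemma conv_ae f1 f2 g1 g2 xi : cmeas3 f1 -> cmeas3 f2 -> cmeas3 g1 -> cmeas3 g2 ->
  {ae leb3, forall x, f1 x = f2 x} -> {ae leb3, forall x, g1 x = g2 x} ->
  conv f1 g1 xi = conv f2 g2 xi.
Proof.
move=> m1 m2 m3 m4 ff gg; have [mr _ _] := scales_reflect xi.
apply: (@cInt_ae _ (RRR R) R leb3).
- by apply: cmeasM => //; exact: (cmeas_comp m1 mr).
- by apply: cmeasM => //; exact: (cmeas_comp m2 mr).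
- by apply: (ae3_imp2 (scales_ae (scales_reflect xi) ff) gg) => y -> ->.
Qed.

Lemma conv_herm M N f g xi : xi != 0 -> wtb M f -> wtb N g -> hermitian f -> hermitian g ->
  conv f g (- xi) = (conv f g xi)^*%C.
Proof.
move=> x0 hf hg hhf hhg; have [mf _] := hf; have [mg _] := hg.
have [iw _] := conv_intg x0 hf hg.
have nx0 : - xi != 0 by rewrite oppr_eq0.
have [iw' _] := conv_intg nx0 hf hg.
rewrite -[RHS]cInt_conj // [LHS](cInt_scales scales_opp iw') mul1r.
apply: (@cInt_ae _ (RRR R) R leb3).
- exact: (cintg_meas (cintg_scales scales_opp iw')).
- exact: (cmeas_conj (cintg_meas iw)).
apply: (ae3_imp2 (scales_ae (scales_reflect xi) hhf) hhg) => y h1 h2.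
by rewrite conjCM -h1 -h2 opprB opprK addrC.
Qed.

Definition divT (F G : 'I_3 -> R3 R -> C) xi (j : 'I_3) : C :=
  \sum_(k < 3) (0 +i* 1) * (coord xi k)%:C * prod_hat (F k) (G j) xi.

(** The 9 collects the three terms of the divergence and the passage from components to the vector
    norm, which costs another 3. *)
Definition cdiv : R := 9 * fc * cker.

Lemma cdiv_ge0 : 0 <= cdiv.
Proof. by apply: mulr_ge0 cker_ge0; apply: mulr_ge0 => //; apply/ltW; exact: fc_gt0. Qed.

(** The factor |xi_k| <= |xi| of the derivative cancels the |xi|^-1 of the convolution, leaving a
    bound independent of xi. *)
Lemma divT_le M N (F G : 'I_3 -> R3 R -> C) xi : xi != 0 -> (forall k, wtb M (F k)) ->
  (forall k, wtb N (G k)) -> cvnorm (divT F G xi) <= cdiv * (M * N).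
Proof.
move=> x0 hF hG; have e0 := enorm_gt0 x0.
have t k j : normc ((0 +i* 1) * (coord xi k)%:C * prod_hat (F k) (G j) xi) <= fc * cker * (M * N).
  have [_ h] := conv_intg x0 (hF k) (hG j).
  rewrite Normc.normcM Normc.normcM normc_real /prod_hat normcMr.
  rewrite (_ : normc (0 +i* 1) = 1); last by rewrite /= expr0n expr1n add0r sqrtr1.
  rewrite mul1r (ger0_norm (ltW (@fc_gt0 R))).
  apply: (@le_trans _ _ (enorm xi * (fc * (M * N * (cker / enorm xi))))).
    apply: ler_pM => //; [by rewrite mulr_ge0 ?normc_ge0 // ltW // fc_gt0|exact: coord_le_enorm|].
    by apply: ler_wpM2l => //; rewrite ltW // fc_gt0.
  by rewrite le_eqVlt; apply/orP; left; apply/eqP; move: fc cker => a b; field; rewrite gt_eqF.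
have le3 (a b c : C) (q : R) : normc a <= q -> normc b <= q -> normc c <= q -> normc (a + b + c) <= 3 * q.
  move=> h1 h2 h3; have := le_normcD (a + b) c; have := le_normcD a b; lra.
apply: (@le_trans _ _ (3 * (3 * (fc * cker * (M * N))))).
  by apply: cvnorm_le => j; rewrite /divT big3; apply: le3; exact: t.
by rewrite le_eqVlt; apply/orP; left; apply/eqP; rewrite /cdiv; move: fc cker => a b; ring.
Qed.

Lemma divTBl M1 M2 N (F1 F2 G : 'I_3 -> R3 R -> C) xi j : xi != 0 -> (forall k, wtb M1 (F1 k)) ->
  (forall k, wtb M2 (F2 k)) -> (forall k, wtb N (G k)) ->
  divT (fun k x => F1 k x - F2 k x) G xi j = divT F1 G xi j - divT F2 G xi j.
Proof.
move=> x0 h1 h2 hG; rewrite /divT -sumrB; apply: eq_bigr => k _; rewrite -mulrBr; congr (_ * _).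
rewrite /prod_hat -mulrBr; congr (_ * _).
have [i1 _] := conv_intg x0 (h1 k) (hG j); have [i2 _] := conv_intg x0 (h2 k) (hG j).
rewrite -[RHS](cIntB i1 i2); apply: cInt_eq => y; exact: mulrBl.
Qed.

Lemma divTBr M N1 N2 (F G1 G2 : 'I_3 -> R3 R -> C) xi j : xi != 0 -> (forall k, wtb M (F k)) ->
  (forall k, wtb N1 (G1 k)) -> (forall k, wtb N2 (G2 k)) ->
  divT F (fun k x => G1 k x - G2 k x) xi j = divT F G1 xi j - divT F G2 xi j.
Proof.
move=> x0 hF h1 h2; rewrite /divT -sumrB; apply: eq_bigr => k _; rewrite -mulrBr; congr (_ * _).
rewrite /prod_hat -mulrBr; congr (_ * _).
have [i1 _] := conv_intg x0 (hF k) (h1 j); have [i2 _] := conv_intg x0 (hF k) (h2 j).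
rewrite -[RHS](cIntB i1 i2); apply: cInt_eq => y; exact: mulrBr.
Qed.

Lemma divT_ae (F1 F2 G1 G2 : 'I_3 -> R3 R -> C) xi j : (forall k, cmeas3 (F1 k)) -> (forall k, cmeas3 (F2 k)) ->
  (forall k, cmeas3 (G1 k)) -> (forall k, cmeas3 (G2 k)) ->
  (forall k, {ae leb3, forall x, F1 k x = F2 k x}) -> (forall k, {ae leb3, forall x, G1 k x = G2 k x}) ->
  divT F1 G1 xi j = divT F2 G2 xi j.
Proof.
move=> m1 m2 m3 m4 h1 h2; apply: eq_bigr => k _; congr (_ * _).
by rewrite /prod_hat (conv_ae _ (m1 k) (m2 k) (m3 j) (m4 j) (h1 k) (h2 j)).
Qed.

Lemma divT_herm M N (F G : 'I_3 -> R3 R -> C) xi j : xi != 0 -> (forall k, wtb M (F k)) ->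
  (forall k, wtb N (G k)) -> (forall k, hermitian (F k)) -> (forall k, hermitian (G k)) ->
  divT F G (- xi) j = (divT F G xi j)^*%C.
Proof.
move=> x0 hF hG hhF hhG.
have cD (a b : C) : (a + b)^*%C = a^*%C + b^*%C by exact: rmorphD.
have t k : (0 +i* 1) * (coord (- xi) k)%:C * prod_hat (F k) (G j) (- xi) =
    ((0 +i* 1) * (coord xi k)%:C * prod_hat (F k) (G j) xi)^*%C.
  rewrite !conjCM /prod_hat (conv_herm x0 (hF k) (hG j) (hhF k) (hhG j)) mulrA [in RHS]mulrA; congr (_ * _).
  rewrite -scaleN1r coordZ; move: (coord xi k) (_ `^ _) => a b.
  by apply: complex_eq => /=; ring.
by rewrite /divT !big3 !cD !t.
Qed.

Lemma measurable_sub3 d (T : measurableType d) (x y : T -> RRR R) : measurable_fun setT x ->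
  measurable_fun setT y -> @measurable_fun _ _ T (RRR R) setT (fun p => (x p : R3 R) - y p).
Proof.
move=> mx my.
have c1 (z : T -> RRR R) : measurable_fun setT z -> measurable_fun setT (fun p => (z p).1.1).
  by move=> mz; exact: (measurableT_comp measurable_fst (measurableT_comp measurable_fst mz)).
have c2 (z : T -> RRR R) : measurable_fun setT z -> measurable_fun setT (fun p => (z p).1.2).
  by move=> mz; exact: (measurableT_comp measurable_snd (measurableT_comp measurable_fst mz)).
have c3 (z : T -> RRR R) : measurable_fun setT z -> measurable_fun setT (fun p => (z p).2).
  by move=> mz; exact: (measurableT_comp measurable_snd mz).
apply: (@measurable_fun_pair _ _ _ T (mR R * mR R)%type (mR R) (fun p => ((x p).1.1 - (y p).1.1, (x p).1.2 - (y p).1.2)) (fun p => (x p).2 - (y p).2)).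
  apply: measurable_fun_pair; apply: measurable_funB; by [exact: c1|exact: c2].
by apply: measurable_funB; exact: c3.
Qed.

Let leb3s : {sigma_finite_measure set (RRR R) -> \bar R} :=
  sfprod (sfprod (@lebesgue_measure R) (@lebesgue_measure R)) (@lebesgue_measure R).

Lemma cmeas_divT (F G : R -> 'I_3 -> R3 R -> C) j :
  (forall k, cmeasurable (fun p : TX R => F p.1 k p.2)) -> (forall k, cmeasurable (fun p : TX R => G p.1 k p.2)) ->
  cmeasurable (fun p : TX R => divT (F p.1) (G p.1) p.2 j).
Proof.
move=> mF mG; apply: cmeas_sum => k; apply: cmeasM.
  apply: cmeasM; first exact: cmeas_cst.
  apply: cmeas_real; exact: (measurableT_comp (measurable_coord k) measurable_snd).
apply: cmeasM; first exact: cmeas_cst.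
apply: (@cmeas_cInt _ _ (TX R) (RRR R) R leb3s (fun q => F q.1.1 k (q.1.2 - q.2) * G q.1.1 j q.2)).
have m11 : measurable_fun setT (fun q : TX R * RRR R => q.1.1) by exact: (measurableT_comp measurable_fst measurable_fst).
have m12 : measurable_fun setT (fun q : TX R * RRR R => q.1.2) by exact: (measurableT_comp measurable_snd measurable_fst).
have m2 : measurable_fun setT (fun q : TX R * RRR R => q.2) by exact: measurable_snd.
apply: cmeasM.
- have mp : measurable_fun setT (fun q : TX R * RRR R => (q.1.1, (q.1.2 : R3 R) - q.2) : TX R).
    by apply: measurable_fun_pair => //; exact: measurable_sub3.
  exact: (@cmeas_comp _ _ _ (TX R) R (fun p => F p.1 k p.2) _ (mF k) mp).
- have mp : measurable_fun setT (fun q : TX R * RRR R => (q.1.1, q.2) : TX R).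
    exact: measurable_fun_pair.
  exact: (@cmeas_comp _ _ _ (TX R) R (fun p => G p.1 j p.2) _ (mG j) mp).
Qed.

Definition duF (H : R -> 'I_3 -> R3 R -> C) t (j : 'I_3) xi : C :=
  tInt (enorm xi ^+ 2) (fun tau => leray xi (fun k => H tau k xi) j) t.

Lemma duFE (H : R -> 'I_3 -> R3 R -> C) t j xi : cintegral leb1 `[0, t]%classic (fun tau =>
    heat_symbol (t - tau) xi * leray xi (fun k => H tau k xi) j) = duF H t j xi.
Proof. exact: tIntE. Qed.

Lemma measurable_cvnorm d (T : measurableType d) (z : T -> 'I_3 -> C) : (forall k, cmeasurable (fun p => z p k)) ->
  measurable_fun setT (fun p => cvnorm (z p)).
Proof.
move=> mz; apply: (measurableT_comp (continuous_measurable_fun (@sqrt_continuous R))).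
under eq_fun do rewrite big3.
by apply: measurable_funD; first apply: measurable_funD; apply: measurable_funX; exact: measurable_normc.
Qed.

Section Duhamel.
Variables (H : R -> 'I_3 -> R3 R -> C) (K : R).
Hypotheses (K0 : 0 <= K) (mH : forall k, cmeasurable (fun p : TX R => H p.1 k p.2))
  (HK : {ae leb1, forall tau, 0 <= tau -> {ae leb3, forall xi, cvnorm (fun k => H tau k xi) <= K}})
  (Hh : {ae leb1, forall tau, 0 <= tau -> forall k, hermitian (H tau k)}).

Lemma duF_cmeas j : cmeasurable (fun p : TX R => duF H p.1 j p.2).
Proof.
apply: (@cmeas_cInt _ _ (TX R) (mR R) R (@lebesgue_measure R)
  (fun q => (tker (enorm q.1.2 ^+ 2) q.1.1 q.2)%:C * leray q.1.2 (fun k => H q.2 k q.1.2) j)).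
have m11 : measurable_fun setT (fun q : TX R * mR R => q.1.1) by exact: (measurableT_comp measurable_fst measurable_fst).
have m12 : measurable_fun setT (fun q : TX R * mR R => q.1.2) by exact: (measurableT_comp measurable_snd measurable_fst).
have m2 : measurable_fun setT (fun q : TX R * mR R => q.2) by exact: measurable_snd.
apply: cmeasM.
  apply: cmeas_real; apply: measurable_tker => //.
  by apply: measurable_funX; exact: (measurableT_comp measurable_enorm m12).
apply: cmeas_leray => // k.
by apply: (@cmeas_comp _ _ _ (TX R) R (fun p => H p.1 k p.2) (fun q => (q.2, q.1.2)) (mH k)); exact: measurable_fun_pair.
Qed.

Let meas_nonneg : measurable_fun setT (fun p : TX R => (0 <= p.1)%R%:R : R).
Proof.
have m := @measurable_indic _ (mR R) R setT _ (measurable_itv `[(0:R), +oo[).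
have := measurableT_comp m (@measurable_fst _ _ (mR R) (RRR R)).
apply: eq_measurable_fun => p _; rewrite /= indicE; congr (nat_of_bool _)%:R.
by apply/idP/idP; rewrite inE /= in_itv /= andbT.
Qed.

Let gtau xi k tau := leray xi (fun k => H tau k xi) k.

Let mgtau xi k : @cmeasurable R _ (mR R) (gtau xi k).
Proof.
apply: (@cmeas_leray R _ (mR R) (fun _ => xi)) => // i.
exact: (cmeas_comp (mH i) (pair2_measurable (xi : RRR R))).
Qed.

(** Quantifiers exchanged by [ae_swap]: for almost every fixed frequency the integrand is bounded
    for almost all times. The factor 0 <= tau in the function handed to [ae_swap] makes its values
    at negative times harmless. *)
Let HKs : {ae leb3, forall xi, {ae leb1, forall tau, 0 <= tau -> cvnorm (fun k => gtau xi k tau) <= K}}.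
Proof.
have mf : measurable_fun setT (fun p : TX R => (0 <= p.1)%R%:R * cvnorm (fun k => H p.1 k p.2)).
  by apply: measurable_funM; [exact: meas_nonneg|exact: measurable_cvnorm].
have := @ae_swap _ _ (mR R) (RRR R) R (@lebesgue_measure R) leb3s _ K mf.
move=> /(_ _)/ae3_imp; apply.
  apply: (ae_imp HK) => tau ht; case: (boolP (0 <= tau)) => [t0|_].
    by apply: (ae3_imp (ht t0)) => xi; rewrite /= mul1r.
  by apply: (aeW leb3s) => xi /=; rewrite mul0r.
move=> xi h; apply: (ae_imp h) => tau /= ht t0; apply: (le_trans (leray_le _ _)).
by move: ht; rewrite t0 mul1r.
Qed.

Lemma duF_weight t : weight2 (fun xi j => duF H t j xi) K.
Proof.
apply: (ae3_imp2 HKs ae_dot_gt0) => xi h x0.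
rewrite -enorm_sqr; apply: tInt_vector_bound => //; last by move=> i; exact: mgtau.
by rewrite enorm_sqr.
Qed.

Lemma duF_cont j : {ae leb3, forall xi, seq_cont (fun t => Re (duF H t j xi)) /\ seq_cont (fun t => Im (duF H t j xi))}.
Proof.
apply: (ae3_imp2 HKs ae_dot_gt0) => xi h x0.
apply: (@tInt_cont R _ _ _ K (mgtau xi j)); first by rewrite enorm_sqr.
apply: (ae_imp h) => tau ht t0; apply: le_trans (ht t0).
exact: (normc_le_cvnorm (fun k => gtau xi k tau)).
Qed.

(** The symmetry of [H tau] is known for almost every tau and then almost every xi. [ae_swap] with
    bound 0, applied to the size of the defect, transfers it to almost every fixed xi, where the
    time integral can be conjugated. *)
Lemma duF_herm t j : hermitian (duF H t j).
Proof.
pose f (p : TX R) : R := (0 <= p.1)%R%:R * cvnorm (fun k => H p.1 k (- (p.2 : R3 R)) - (H p.1 k p.2)^*%C).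
have mN : @measurable_fun _ _ (TX R) (TX R) setT (fun p => (p.1, - (p.2 : R3 R))).
  by apply: measurable_fun_pair => //; exact: (measurableT_comp measurable_opp3 measurable_snd).
have mf : measurable_fun setT f.
  apply: measurable_funM; first exact: meas_nonneg.
  apply: measurable_cvnorm => k.
  by apply: cmeasB; [exact: (cmeas_comp (mH k) mN)|exact: cmeas_conj].
have := @ae_swap _ _ (mR R) (RRR R) R (@lebesgue_measure R) leb3s f 0 mf.
move=> /(_ _) S; apply: (ae3_imp2 (S _) (ae3_imp2 HKs ae_dot_gt0 (fun x a b => conj a b))).
  apply: (ae_imp Hh) => tau ht; case: (boolP (0 <= tau)) => [t0|t0].
    apply: (ae3_imp (ae3_ord3 (ht t0))) => xi E.
    rewrite /f /= (_ : (fun k => _) = (fun=> 0)) ?cvnorm0 ?mulr0 //.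
    by apply/funext => k; rewrite E subrr.
  by apply: (aeW leb3s) => xi; rewrite /f /= (negPf t0) mul0r.
move=> xi h1 [h2 x0].
have s0 : 0 < enorm xi ^+ 2 by rewrite enorm_sqr.
have h3 : {ae leb1, forall tau, 0 <= tau -> normc (gtau xi j tau) <= K}.
  apply: (ae_imp h2) => tau ht t0; apply: le_trans (ht t0).
  exact: (normc_le_cvnorm (fun k => gtau xi k tau)).
have ci := tInt_cintg s0 (mgtau xi j) h3 t.
rewrite /duF enormN -[RHS](cInt_conj ci).
apply: (@cInt_ae _ (mR R) R (@lebesgue_measure R)).
- exact: (@tInt_meas R _ (gtau (- xi) j) (mgtau (- xi) j) t).
- exact: (cmeas_conj (cintg_meas ci)).
apply: (ae_imp h1) => tau; rewrite /f /= conjCM /tker.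
case: (boolP (0 <= tau)) => [t0|t0] /=; last by rewrite !mul0r oppr0 !mul0r.
rewrite mul1r => h; congr (_ * _); first by rewrite oppr0.
apply: leray_herm => k; apply/eqP; rewrite -subr_eq0; apply/eqP/Normc.eq0_normc/le_anti.
rewrite normc_ge0 andbT; apply: le_trans h.
exact: (normc_le_cvnorm (fun k => H tau k (- xi) - (H tau k xi)^*%C)).
Qed.

Lemma duF_cintg : {ae leb3, forall xi, forall t j,
  cintg (@lebesgue_measure R : {measure set (mR R) -> \bar R})
    (fun tau => (tker (enorm xi ^+ 2) t tau)%:C * leray xi (fun k => H tau k xi) j)}.
Proof.
apply: (ae3_imp2 HKs ae_dot_gt0) => xi h x0 t j.
apply: (@tInt_cintg R (enorm xi ^+ 2) _ _ K (mgtau xi j)); first by rewrite enorm_sqr.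
apply: (ae_imp h) => tau ht t0; apply: le_trans (ht t0).
exact: (normc_le_cvnorm (fun k => gtau xi k tau)).
Qed.

End Duhamel.

Definition duhamelable (H : R -> 'I_3 -> R3 R -> C) K :=
  [/\ 0 <= K, forall k, cmeasurable (fun p : TX R => H p.1 k p.2) &
  {ae leb1, forall tau, 0 <= tau -> {ae leb3, forall xi, cvnorm (fun k => H tau k xi) <= K}}].

Lemma duFB H1 H2 K1 K2 : duhamelable H1 K1 -> duhamelable H2 K2 ->
  {ae leb3, forall xi, forall t j, duF (fun tau k x => H1 tau k x - H2 tau k x) t j xi =
    duF H1 t j xi - duF H2 t j xi}.
Proof.
move=> [k1 m1 h1] [k2 m2 h2].
apply: (ae3_imp2 (duF_cintg k1 m1 h1) (duF_cintg k2 m2 h2)) => xi c1 c2 t j.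
rewrite -[RHS](cIntB (c1 t j) (c2 t j)); apply: cInt_eq => tau.
by rewrite lerayB mulrBr.
Qed.

End Convolution.

Notation field R := (R -> 'I_3 -> R3 R -> R[i]).

(** * The bilinear operator *)

Section Bilinear.
Context {R : realType}.
Local Notation C := R[i].
Local Notation leb1 := (@lebesgue_measure R : {measure set (measurableTypeR R) -> \bar R}).
Implicit Types (x xi : R3 R) (M N K t tau : R) (F G : field R) (u v : curve R).

Definition jmeas F := forall k, cmeasurable (fun p : TX R => F p.1 k p.2).

Definition goodF M F := [/\ jmeas F,
  {ae leb1, forall tau, 0 <= tau -> forall k, wtb M (F tau k)} &
  {ae leb1, forall tau, 0 <= tau -> forall k, hermitian (F tau k)}].

Definition subF F G : field R := fun t k x => F t k x - G t k x.

Lemma jmeas_sub F G : jmeas F -> jmeas G -> jmeas (subF F G).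
Proof. by move=> mF mG k; exact: (cmeasB (mF k) (mG k)). Qed.

Lemma jmeas3 F t k : jmeas F -> cmeas3 (F t k).
Proof. by move=> mF; exact: (cmeas_comp (mF k) (pair1_measurable (t : mR R))). Qed.

Definition divF F G : field R := fun tau k x => divT (F tau) (G tau) x k.

Definition BF F G : field R := fun t j x => - duF (divF F G) t j x.

Lemma divF_duhamelable M N F G : 0 <= M -> 0 <= N -> goodF M F -> goodF N G ->
  duhamelable (divF F G) (cdiv * (M * N)).
Proof.
move=> M0 N0 [mF bF _] [mG bG _]; split.
- by apply: mulr_ge0; [exact: cdiv_ge0|exact: mulr_ge0].
- by move=> k; exact: cmeas_divT.
apply: (ae_imp2 bF bG) => tau hF hG t0; apply: (ae3_imp ae_neq0) => xi x0.
exact: (divT_le x0 (hF t0) (hG t0)).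
Qed.

Lemma divF_herm M N F G : goodF M F -> goodF N G ->
  {ae leb1, forall tau, 0 <= tau -> forall k, hermitian (divF F G tau k)}.
Proof.
move=> [mF bF hF] [mG bG hG].
have b := ae_imp2 bF bG (fun _ a b => conj a b).
have h := ae_imp2 hF hG (fun _ a b => conj a b).
apply: (ae_imp2 b h) => tau [b1 b2] [h1 h2] t0 k; apply: (ae3_imp ae_neq0) => xi x0.
exact: (divT_herm k x0 (b1 t0) (b2 t0) (h1 t0) (h2 t0)).
Qed.

Lemma oppC_conj (a : C) : (- a)^*%C = - a^*%C. Proof. exact: rmorphN. Qed.

Lemma seq_contN (g : R -> R) : seq_cont g -> seq_cont (fun t => - g t).
Proof. by move=> h t s t0 s0 st; apply: cvgN; exact: h. Qed.

Lemma seq_contD (g h : R -> R) : seq_cont g -> seq_cont h -> seq_cont (fun t => g t + h t).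
Proof. by move=> hg hh t s t0 s0 st; apply: cvgD; [exact: hg|exact: hh]. Qed.

Definition ccont (g : R -> C) := seq_cont (fun t => Re (g t)) /\ seq_cont (fun t => Im (g t)).

Lemma ccontN g : ccont g -> ccont (fun t => - g t).
Proof.
move=> [gR gI]; split.
- by have := seq_contN gR; congr seq_cont; apply/funext => t; rewrite ReN.
- by have := seq_contN gI; congr seq_cont; apply/funext => t; rewrite ImN.
Qed.

Lemma ccontD g h : ccont g -> ccont h -> ccont (fun t => g t + h t).
Proof.
move=> [gR gI] [hR hI]; split.
- by have := seq_contD gR hR; congr seq_cont; apply/funext => t; rewrite ReD.
- by have := seq_contD gI hI; congr seq_cont; apply/funext => t; rewrite ImD.
Qed.

(* What makes [fun t i => of_hat (F t i)] an element of [Cw 2] of norm at most [M]. *)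
Definition cfield M F := [/\ jmeas F, forall t, 0 <= t -> weight2 (fun x k => F t k x) M,
  forall t k, 0 <= t -> hermitian (F t k) &
  forall k, {ae leb3, forall x, ccont (fun t => F t k x)}].

Lemma weight2_opp (z : R3 R -> 'I_3 -> C) M : weight2 z M -> weight2 (fun x k => - z x k) M.
Proof. by move=> h; apply: (ae3_imp h) => x; rewrite cvnormN. Qed.

Lemma weight2_add (z w : R3 R -> 'I_3 -> C) M N : weight2 z M -> weight2 w N ->
  weight2 (fun x k => z x k + w x k) (M + N).
Proof.
move=> h1 h2; apply: (ae3_imp2 h1 h2) => x a b.
by apply: (le_trans (ler_wpM2l (dot_ge0 x) (cvnormD _ _))); rewrite mulrDr lerD.
Qed.

Lemma weight2_sub (z w : R3 R -> 'I_3 -> C) M N : weight2 z M -> weight2 w N ->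
  weight2 (fun x k => z x k - w x k) (M + N).
Proof. by move=> h1 h2; exact: (weight2_add h1 (weight2_opp h2)). Qed.

Lemma weight2_ae (z w : R3 R -> 'I_3 -> C) M : {ae leb3, forall x k, z x k = w x k} ->
  weight2 z M -> weight2 w M.
Proof.
move=> zw h; apply: (ae3_imp2 zw h) => x E.
by rewrite (_ : z x = w x) //; apply/funext.
Qed.

Lemma weight2_le (z : R3 R -> 'I_3 -> C) M N : M <= N -> weight2 z M -> weight2 z N.
Proof. by move=> MN h; apply: (ae3_imp h) => x /le_trans; apply. Qed.

Lemma weight2_wtb (z : R3 R -> 'I_3 -> C) M k : cmeas3 (fun x => z x k) -> weight2 z M ->
  wtb M (fun x => z x k).
Proof.
move=> mz zM; split=> //; apply: (ae3_imp2 zM ae_dot_gt0) => x zx x0.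
apply: (le_trans (normc_le_cvnorm (z x) k)).
by rewrite ler_pdivlMr // mulrC.
Qed.

(** The arguments are merely measurable, bounded and Hermitian; continuity in time of the result is
    created by the Duhamel integral. This is why [cdiv] is used here and not the given constant. *)
Lemma BF_cfield M N F G : 0 <= M -> 0 <= N -> goodF M F -> goodF N G ->
  cfield (cdiv * (M * N)) (BF F G).
Proof.
move=> M0 N0 gF gG; have [K0 mD bD] := divF_duhamelable M0 N0 gF gG.
have hD := divF_herm gF gG; split.
- by move=> k; apply: cmeasN; exact: (duF_cmeas mD).
- by move=> t t0; exact/weight2_opp/(duF_weight K0 mD bD).
- move=> t k t0; apply: (ae3_imp (duF_herm K0 mD bD hD t k)) => x.
  by rewrite /BF oppC_conj => ->.
- by move=> k; apply: (ae3_imp (duF_cont K0 mD bD k)) => x; exact: ccontN.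
Qed.

Lemma duF_ae (H1 H2 : field R) t j xi : jmeas H1 -> jmeas H2 ->
  {ae leb1, forall tau, 0 <= tau -> forall k, H1 tau k xi = H2 tau k xi} ->
  duF H1 t j xi = duF H2 t j xi.
Proof.
move=> m1 m2 h.
have mm H : jmeas H -> @cmeasurable R _ (mR R) (fun tau =>
    (tker (enorm xi ^+ 2) t tau)%:C * leray xi (fun k => H tau k xi) j).
  move=> mH; apply: cmeasM; first by apply: cmeas_real; exact: meas_tker.
  apply: (@cmeas_leray R _ (mR R) (fun _ => xi)) => // k.
  exact: (cmeas_comp (mH k) (pair2_measurable (xi : RRR R))).
apply: (@cInt_ae _ (mR R) R leb1 _ _ (mm _ m1) (mm _ m2)).
apply: (ae_imp h) => tau e; rewrite /tker; case: (boolP (0 <= tau)) => [t0|t0] /=; last first.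
  by rewrite !mul0r.
by congr (_ * leray _ _ _); apply/funext => k; exact: e.
Qed.

Lemma jmeas_div F G : jmeas F -> jmeas G -> jmeas (divF F G).
Proof. by move=> mF mG k; exact: (@cmeas_divT R F G k mF mG). Qed.

(** A convolution depends on its factors only up to null sets, and the time integral only on almost
    every tau. Equality of representatives almost everywhere therefore gives equality at every t and
    xi. *)
Lemma BF_ae F1 F2 G1 G2 t j xi : jmeas F1 -> jmeas F2 -> jmeas G1 -> jmeas G2 ->
  {ae leb1, forall tau, 0 <= tau -> forall k, {ae leb3, forall x, F1 tau k x = F2 tau k x}} ->
  {ae leb1, forall tau, 0 <= tau -> forall k, {ae leb3, forall x, G1 tau k x = G2 tau k x}} ->
  BF F1 G1 t j xi = BF F2 G2 t j xi.
Proof.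
move=> m1 m2 m3 m4 h1 h2.
rewrite /BF (@duF_ae (divF F1 G1) (divF F2 G2)) //; try exact: jmeas_div.
apply: (ae_imp2 h1 h2) => tau e1 e2 t0 k.
by apply: divT_ae => [i|i|i|i||]; try exact: jmeas3; [exact: e1|exact: e2].
Qed.

(** Telescoping through the mixed product: the term [divF G F] is subtracted and added. Both sides
    are compared off xi = 0, where the convolutions converge absolutely. *)
Lemma BF_diff M N D F G : 0 <= M -> 0 <= N -> 0 <= D -> goodF M F -> goodF N G -> goodF D (subF F G) ->
  {ae leb3, forall x, forall t j, BF F F t j x - BF G G t j x = BF (subF F G) F t j x + BF G (subF F G) t j x}.
Proof.
move=> M0 N0 D0 gF gG gD.
have dFF := divF_duhamelable M0 M0 gF gF; have dGG := divF_duhamelable N0 N0 gG gG.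
have dGF := divF_duhamelable N0 M0 gG gF.
have [mF bF _] := gF; have [mG bG _] := gG.
have b := ae_imp2 bF bG (fun _ a b => conj a b).
have mD := jmeas_sub mF mG.
have E1 : {ae leb3, forall x, forall t j, duF (divF (subF F G) F) t j x = duF (divF F F) t j x - duF (divF G F) t j x}.
  apply: (ae3_imp2 (duFB dFF dGF) ae_neq0) => x + x0 t j => <-.
  apply: duF_ae; [exact: jmeas_div|by move=> k; apply: cmeasB; exact: jmeas_div|].
  apply: (ae_imp b) => tau [b1 b2] t0 k.
  exact: (divTBl k x0 (b1 t0) (b2 t0) (b1 t0)).
have E2 : {ae leb3, forall x, forall t j, duF (divF G (subF F G)) t j x = duF (divF G F) t j x - duF (divF G G) t j x}.
  apply: (ae3_imp2 (duFB dGF dGG) ae_neq0) => x + x0 t j => <-.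
  apply: duF_ae; [exact: jmeas_div|by move=> k; apply: cmeasB; exact: jmeas_div|].
  apply: (ae_imp b) => tau [b1 b2] t0 k.
  exact: (divTBr k x0 (b2 t0) (b1 t0) (b2 t0)).
apply: (ae3_imp2 E1 E2) => x e1 e2 t j; rewrite /BF e1 e2.
by move: (duF _ _ _ _) (duF _ _ _ _) (duF _ _ _ _) => p q r; ring.
Qed.

(** Either a jointly measurable representative exists and the choice is one, or the choice falls
    back on the default 0; it is measurable in both cases. *)
Lemma st_hatP (w : R -> distr R) : let U := st_hat w in
  cmeasurable (fun p : TX R => U p.1 p.2) /\
  ({ae leb1, forall t, 0 <= t -> {ae leb3, forall xi, U t xi = hat (w t) xi}} \/ forall t xi, U t xi = 0).
Proof.
rewrite /st_hat; case: xgetP => [f _ [mf hf]|_]; first by split; [|left].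
by split; [exact: cmeas_cst|right].
Qed.

Lemma st_hat_ae (w : R -> distr R) f : cmeasurable (fun p : TX R => f p.1 p.2) ->
  {ae leb1, forall t, 0 <= t -> {ae leb3, forall xi, f t xi = hat (w t) xi}} ->
  {ae leb1, forall t, 0 <= t -> {ae leb3, forall xi, st_hat w t xi = hat (w t) xi}}.
Proof.
move=> mf hf; have := @xgetPex _ (fun _ _ => 0) [set f | cmeasurable (fun p : TX R => f p.1 p.2) /\
   {ae leb1, forall t, 0 <= t -> {ae leb3, forall xi, f t xi = hat (w t) xi}}].
by move=> /(_ (ex_intro _ f (conj mf hf)))[].
Qed.

Definition st u : field R := fun tau k => st_hat (fun s => u s k) tau.

Lemma st_jmeas u : jmeas (st u).
Proof. by move=> k; have [] := st_hatP (fun s => u s k). Qed.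

Lemma st_or u : {ae leb1, forall t, 0 <= t -> {ae leb3, forall xi, forall k,
  st u t k xi = hat (u t k) xi \/ st u t k xi = 0}}.
Proof.
have H k : {ae leb1, forall t, 0 <= t -> {ae leb3, forall xi, st u t k xi = hat (u t k) xi \/ st u t k xi = 0}}.
  have [_ [h|h]] := st_hatP (fun s => u s k).
    by apply: (ae_imp h) => t ht t0; apply: (ae3_imp (ht t0)) => xi; left.
  by apply: aeW => t t0; apply: (@aeW _ (RRR R) R leb3) => xi; right; exact: h.
by apply: (ae_imp (ae_ord3 H)) => t ht t0; apply: ae3_ord3 => k; exact: ht.
Qed.

Lemma st_herm_gen u : (forall t k, 0 <= t -> hermitian (hat (u t k))) ->
  {ae leb1, forall tau, 0 <= tau -> forall k, hermitian (st u tau k)}.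
Proof.
move=> hu.
have H k : {ae leb1, forall tau, 0 <= tau -> hermitian (st u tau k)}.
  have [_ [h|h]] := st_hatP (fun s => u s k).
    apply: (ae_imp h) => t ht t0.
    apply: (ae3_imp2 (ae3_imp2 (ht t0) (scales_ae scales_opp (ht t0)) (fun x a b => conj a b)) (hu t k t0)).
    by move=> x [e1 e2] e3; rewrite /st e1 e2.
  by apply: aeW => t t0; apply: (@aeW _ (RRR R) R leb3) => xi; rewrite /st !h conjc0.
by apply: (ae_imp (ae_ord3 H)) => t ht t0 k; exact: ht.
Qed.

Lemma cvnorm_mono (z w : 'I_3 -> C) : (forall k, z k = w k \/ z k = 0) -> cvnorm z <= cvnorm w.
Proof.
move=> h; rewrite ler_wsqrtr //; apply: ler_sum => k _; case: (h k) => -> //.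
by rewrite (normc_real 0) normr0 expr0n sqr_ge0.
Qed.

(** A component without a representative is replaced by 0, for which the bound and the symmetry are
    trivial; so the bilinear estimate covers every element of [Cw 2]. *)
Lemma st_good u M : Cw 2 u -> (cw_norm 2 u <= M%:E)%E -> goodF M (st u).
Proof.
move=> Cu nu; split; first exact: st_jmeas.
- apply: (ae_imp (st_or u)) => t ht t0 k.
  have /pm_norm2P h := Cw_le nu t0.
  apply: (@weight2_wtb (fun x k => st u t k x)); first exact: (jmeas3 _ _ (st_jmeas u)).
  apply: (ae3_imp2 (ht t0) h) => x e; apply: le_trans.
  by rewrite ler_wpM2l ?dot_ge0 //; exact: cvnorm_mono.
- by apply: st_herm_gen => t k t0; exact: (PM2_hermitian k (Cw_fin Cu t0)).
Qed.

Lemma st_force (F : curve R) M : Cw 0 F -> (cw_norm 0 F <= M%:E)%E ->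
  duhamelable (st F) M /\ {ae leb1, forall tau, 0 <= tau -> forall k, hermitian (st F tau k)}.
Proof.
move=> CF nF; split; last first.
  by apply: st_herm_gen => t k t0; exact: (PM0_hermitian k (Cw_fin CF t0)).
split; last 2 first.
- exact: st_jmeas.
- apply: (ae_imp (st_or F)) => t ht t0; have /pm_norm0P h := Cw_le nF t0.
  by apply: (ae3_imp2 (ht t0) h) => x e; apply: le_trans; exact: cvnorm_mono.
by have := le_trans (cw_norm_ge0 0 F) nF; rewrite lee_fin.
Qed.

Lemma B_hatE u v t j xi : B_hat u v t j xi = BF (st u) (st v) t j xi.
Proof. by rewrite /BF -duFE. Qed.

Lemma duhamel_hatE (F : curve R) t j xi : duhamel_hat F t j xi = duF (st F) t j xi.
Proof. by rewrite -duFE. Qed.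

Lemma cfield_curve M F : cfield M F -> [/\ Cw 2 (fun t i => of_hat (F t i)),
  (cw_norm 2 (fun t i => of_hat (F t i)) <= M%:E)%E &
  forall t : R, 0 <= t -> {ae leb3, forall x i, hat (of_hat (F t i)) x = F t i x}].
Proof.
move=> [mF wF hF cF]; apply: Cw_of_hat => //.
by move=> t i t0; exact: jmeas3.
Qed.

Lemma B_Cw u v M N : Cw 2 u -> Cw 2 v -> (cw_norm 2 u <= M%:E)%E -> (cw_norm 2 v <= N%:E)%E ->
  [/\ Cw 2 (B u v), (cw_norm 2 (B u v) <= (cdiv * (M * N))%:E)%E &
   forall t, 0 <= t -> {ae leb3, forall x i, hat (B u v t i) x = B_hat u v t i x}].
Proof.
move=> Cu Cv nu nv.
have M0 : 0 <= M by have := le_trans (cw_norm_ge0 2 u) nu; rewrite lee_fin.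
have N0 : 0 <= N by have := le_trans (cw_norm_ge0 2 v) nv; rewrite lee_fin.
have cf := BF_cfield M0 N0 (st_good Cu nu) (st_good Cv nv).
have E : B_hat u v = BF (st u) (st v).
  by apply/funext => t; apply/funext => j; apply/funext => xi; exact: B_hatE.
have := cfield_curve cf; rewrite -E; exact.
Qed.

Lemma bilinear_bound_ex : exists eta : R, 0 < eta /\ bilinear_bound eta.
Proof.
(* Only [cdiv] >= 0 has been shown; adding 1 makes the constant positive. *)
exists (cdiv + 1); split; first by rewrite ltr_wpDl // cdiv_ge0.
move=> u v Cu Cv; have [M M0 hM] := Cw_norm Cu; have [N N0 hN] := Cw_norm Cv.
have nu : (cw_norm 2 u <= M%:E)%E by rewrite hM.
have nv : (cw_norm 2 v <= N%:E)%E by rewrite hN.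
have [CB nB _] := B_Cw Cu Cv nu nv.
split=> //; apply: (le_trans nB); rewrite hM hN -!EFinM lee_fin -mulrA.
by rewrite ler_wpM2r ?mulr_ge0 // lerDl.
Qed.

End Bilinear.

(** * Representatives of curves and the mild formulation *)

Section Representatives.
Context {R : realType}.
Local Notation C := R[i].
Local Notation leb1 := (@lebesgue_measure R : {measure set (measurableTypeR R) -> \bar R}).
Implicit Types (x xi : R3 R) (M N K : R) (F G : field R) (u v : curve R).

(** Stronger than what [st_hat] offers: the field is the transform for every t >= 0, not just almost
    every one, and it is never a default value. The bound may depend on t and on the component. *)
Definition frep u F := jmeas F /\ forall (t : R) k, 0 <= t ->
  is_fourier (u t k) (F t k) /\ exists M, hatb M (F t k).

Lemma frep_hat u F (t : R) : frep u F -> 0 <= t -> {ae leb3, forall x k, hat (u t k) x = F t k x}.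
Proof. by move=> [_ h] t0; apply: ae3_ord3 => k; have [f _] := h t k t0; exact: hat_ae. Qed.

Lemma is_fourier_ae (v : distr R) f g M : hatb M f -> cmeas3 g -> is_fourier v f ->
  {ae leb3, forall x, f x = g x} -> is_fourier v g /\ hatb M g.
Proof.
move=> hf mg [_ vf] fg.
have hg : hatb M g by split => //; apply: (ae3_imp2 hf.2 fg) => x h <-.
split=> //; split; first exact: (hatb_L1loc hg).
move=> phi sp; rewrite vf //; apply: (@cInt_ae _ (RRR R) R leb3).
- exact: (cmeasM hf.1 (schwartz_meas sp)).
- exact: (cmeasM mg (schwartz_meas sp)).
- by apply: (ae3_imp fg) => x ->.
Qed.

Lemma frep_Cw u F : Cw 2 u -> jmeas F ->
  (forall t : R, 0 <= t -> {ae leb3, forall x k, hat (u t k) x = F t k x}) -> frep u F.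
Proof.
move=> Cu mF uF; split=> // t k t0; have P := Cw_fin Cu t0.
have [_ _ f _] := PM_comp k P; have [M hM] := PM2_hatb_ex k P.
have e : {ae leb3, forall x, hat (u t k) x = F t k x}.
  by apply: (ae3_imp (uF t t0)) => x; apply.
have [h1 h2] := is_fourier_ae hM (jmeas3 t k mF) f e.
by split=> //; exists M.
Qed.

Lemma frep_sub u v F G : frep u F -> frep v G -> frep (curve_sub u v) (subF F G).
Proof.
move=> [mF uF] [mG vG]; split; first exact: jmeas_sub.
move=> t k t0; have [f [M hM]] := uF t k t0; have [g [N hN]] := vG t k t0.
have [g' hN'] := is_fourier_opp hN g.
by split; [exact: (is_fourier_add hM hN' f g')|exists (M + N); exact: (hatbD hM hN')].
Qed.

Definition addF F G : field R := fun t k x => F t k x + G t k x.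

Lemma jmeas_add F G : jmeas F -> jmeas G -> jmeas (addF F G).
Proof. by move=> mF mG k; exact: (cmeasD (mF k) (mG k)). Qed.

Lemma frep_add u v F G : frep u F -> frep v G -> frep (curve_add u v) (addF F G).
Proof.
move=> [mF uF] [mG vG]; split; first exact: jmeas_add.
move=> t k t0; have [f [M hM]] := uF t k t0; have [g [N hN]] := vG t k t0.
by split; [exact: (is_fourier_add hM hN f g)|exists (M + N); exact: (hatbD hM hN)].
Qed.

Lemma frep_eq u v F : curve_eq v u -> frep u F -> frep v F.
Proof.
move=> uv [mF uF]; split=> // t k t0; have [[L f] hM] := uF t k t0; split=> //; split=> // phi sp.
by rewrite uv //; [exact: f|exact: schwartz_fourier].
Qed.

Lemma frep_norm u F M : frep u F -> (cw_norm 2 u <= M%:E)%E <->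
  forall t : R, 0 <= t -> weight2 (fun x k => F t k x) M.
Proof.
move=> uF; split=> [h t t0|h].
  have /pm_norm2P w := Cw_le h t0; exact: (weight2_ae (frep_hat uF t0) w).
apply/cw_normP => t t0; apply/pm_norm2P.
have e : {ae leb3, forall x k, F t k x = hat (u t k) x}.
  by apply: (ae3_imp (frep_hat uF t0)) => x e k; rewrite e.
exact: (weight2_ae e (h t t0)).
Qed.

(** The field [F] itself witnesses the existence required by [st_hat], so the choice is genuine, and
    both are almost everywhere the transform of the curve. *)
Lemma frep_st u F : frep u F ->
  {ae leb1, forall tau, 0 <= tau -> forall k, {ae leb3, forall x, st u tau k x = F tau k x}}.
Proof.
move=> uF; have [mF _] := uF.
have hu k (t : R) : 0 <= t -> {ae leb3, forall x, F t k x = hat (u t k) x}.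
  by move=> t0; apply: (ae3_imp (frep_hat uF t0)) => x e; rewrite e.
have H k : {ae leb1, forall tau, 0 <= tau -> {ae leb3, forall x, st u tau k x = F tau k x}}.
  have h : {ae leb1, forall t, 0 <= t -> {ae leb3, forall x, F t k x = hat (u t k) x}}.
    by apply: aeW => t; exact: hu.
  apply: (ae_imp (st_hat_ae (w := fun s => u s k) (f := fun t => F t k) (mF k) h)) => t e t0.
  by apply: (ae3_imp2 (e t0) (hu k t t0)) => x; rewrite /st => -> ->.
by apply: (ae_imp (ae_ord3 H)) => t e t0 k; exact: e.
Qed.

Lemma frep_good u F M : Cw 2 u -> frep u F -> (cw_norm 2 u <= M%:E)%E -> goodF M F.
Proof.
move=> Cu uF nu; have [mF _] := uF; split=> //.
- apply: aeW => t t0 k; apply: (@weight2_wtb R (fun x k => F t k x)); first exact: jmeas3.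
  exact: ((frep_norm M uF).1 nu).
- apply: aeW => t t0 k; have h := PM2_hermitian k (Cw_fin Cu t0).
  have e : {ae leb3, forall x, hat (u t k) x = F t k x}.
    by apply: (ae3_imp (frep_hat uF t0)) => x; apply.
  apply: (ae3_imp2 (ae3_imp2 e (scales_ae scales_opp e) (fun _ a b => conj a b)) h).
  by move=> x [e1 e2]; rewrite e1 e2.
Qed.

Lemma frep_B u v F G t j x : frep u F -> frep v G -> B_hat u v t j x = BF F G t j x.
Proof.
move=> uF vG; rewrite B_hatE; apply: BF_ae; try exact: st_jmeas; try exact: frep_st.
- exact: uF.1.
- exact: vG.1.
Qed.

Section Eta.
Variables (eta : R) (eta0 : 0 < eta) (Heta : @bilinear_bound R eta).

Lemma BF_eta u v F G M N (t : R) : Cw 2 u -> Cw 2 v -> frep u F -> frep v G ->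
  (cw_norm 2 u <= M%:E)%E -> (cw_norm 2 v <= N%:E)%E -> 0 <= t ->
  weight2 (fun x k => BF F G t k x) (eta * (M * N)).
Proof.
move=> Cu Cv uF vG nu nv t0.
have [_ nB] := Heta Cu Cv; have [CB _ hB] := B_Cw Cu Cv nu nv.
have nB' : (cw_norm 2 (B u v) <= (eta * (M * N))%:E)%E.
  have [M' M'0 hM] := Cw_norm Cu; have [N' N'0 hN] := Cw_norm Cv.
  move: nu nv nB; rewrite hM hN !lee_fin => h1 h2 /le_trans; apply.
  by rewrite -!EFinM lee_fin -mulrA ler_wpM2l ?(ltW eta0) // ler_pM.
have /pm_norm2P w := Cw_le nB' t0.
apply: (weight2_ae _ w); apply: (ae3_imp (hB t t0)) => x e k.
by rewrite e (frep_B _ _ _ uF vG).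
Qed.

Lemma BF_diff_eta u v F G M N D (t : R) : Cw 2 u -> Cw 2 v -> frep u F -> frep v G ->
  (cw_norm 2 u <= M%:E)%E -> (cw_norm 2 v <= N%:E)%E -> (cw_norm 2 (curve_sub u v) <= D%:E)%E -> 0 <= t ->
  weight2 (fun x k => BF F F t k x - BF G G t k x) (eta * (M + N) * D).
Proof.
move=> Cu Cv uF vG nu nv nD t0; have Cd := Cw_sub Cu Cv; have dFG := frep_sub uF vG.
have ge0 (w : curve R) (W : R) : (cw_norm 2 w <= W%:E)%E -> 0 <= W.
  by move=> /(le_trans (cw_norm_ge0 2 w)); rewrite lee_fin.
have E := BF_diff (ge0 _ _ nu) (ge0 _ _ nv) (ge0 _ _ nD) (frep_good Cu uF nu) (frep_good Cv vG nv)
  (frep_good Cd dFG nD).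
have w1 := BF_eta Cd Cu dFG uF nD nu t0; have w2 := BF_eta Cv Cd vG dFG nv nD t0.
have := weight2_add w1 w2; rewrite (_ : _ + _ = eta * (M + N) * D); last by ring.
apply: (@weight2_ae R (fun x k => BF (subF F G) F t k x + BF G (subF F G) t k x)
  (fun x k => BF F F t k x - BF G G t k x)).
by apply: (ae3_imp E) => x e k; exact: (esym (e t k)).
Qed.

Lemma frep_curve_eq u v F G : frep u F -> frep v G ->
  (forall t : R, 0 <= t -> weight2 (fun x k => F t k x - G t k x) 0) -> curve_eq u v.
Proof.
move=> [mF uF] [mG vG] w t t0 k psi sp.
have [f _] := uF t k t0; have [g _] := vG t k t0.
rewrite (is_fourierE f sp) (is_fourierE g sp); apply: dist_of_ae => //; try exact: jmeas3.
apply: (ae3_imp2 (w t t0) ae_dot_gt0) => x h x0.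
have h0 : cvnorm (fun k => F t k x - G t k x) <= 0 by rewrite -(pmulr_rle0 _ x0).
apply/eqP; rewrite -subr_eq0; apply/eqP/Normc.eq0_normc/le_anti.
rewrite normc_ge0 andbT; apply: le_trans h0.
exact: (normc_le_cvnorm (fun k => F t k x - G t k x)).
Qed.

End Eta.

Definition yF (u0 : vdistr R) (Fo : curve R) : field R :=
  fun t j x => heat_symbol t x * hat (u0 j) x + duF (st Fo) t j x.

Lemma heat_symbol_cmeas : cmeasurable (fun p : TX R => heat_symbol p.1 p.2).
Proof.
apply: cmeas_real; apply: (measurableT_comp (@measurable_expR R)).
rewrite (_ : (fun p : TX R => _) = (fun p : TX R => - 1 * (p.1 * enorm p.2 ^+ 2))); last first.
  by apply/funext => p; rewrite mulN1r.
apply: measurable_funM => //; apply: measurable_funM; first exact: measurable_fst.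
by apply: measurable_funX; exact: (measurableT_comp measurable_enorm measurable_snd).
Qed.

Lemma heat_cfield (u0 : vdistr R) M : PM 2 u0 -> (pm_norm 2 u0 <= M%:E)%E ->
  cfield M (fun t j x => heat_symbol t x * hat (u0 j) x).
Proof.
move=> P0 /pm_norm2P n0; split.
- move=> k; apply: cmeasM; first exact: heat_symbol_cmeas.
  have [_ _ _ m] := PM_comp k P0; exact: (cmeas_comp m measurable_snd).
- move=> t t0; apply: (ae3_imp n0) => x; apply: le_trans; rewrite ler_wpM2l ?dot_ge0 //.
  rewrite cvnormZ ?expR_ge0 // ler_piMl ?cvnorm_ge0 // -[X in _ <= X]expR0 ler_expR oppr_le0.
  by rewrite mulr_ge0 // sqr_ge0.
- move=> t k t0; apply: (ae3_imp (PM2_hermitian k P0)) => x e.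
  by rewrite conjCM e /heat_symbol enormN; congr (_ * _); rewrite /= oppr0.
- move=> k; apply: (@aeW _ (RRR R) R leb3) => x.
  have c (q : R) : seq_cont (fun t => expR (- (t * enorm x ^+ 2)) * q).
    move=> t s _ _ st; apply: cvgM; last exact: cvg_cst.
    apply: (continuous_cvg _ (@continuous_expR R _)); apply: cvgN; apply: cvgM => //; exact: cvg_cst.
  split.
  + have := c (Re (hat (u0 k) x)); congr seq_cont; apply/funext => t.
    by rewrite ReM /= mul0r subr0.
  + have := c (Im (hat (u0 k) x)); congr seq_cont; apply/funext => t.
    by rewrite ImM /= mul0r addr0.
Qed.

Lemma cfield_add F G M N : cfield M F -> cfield N G -> cfield (M + N) (addF F G).
Proof.
move=> [mF wF hF cF] [mG wG hG cG]; split.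
- exact: jmeas_add.
- by move=> t t0; exact: (weight2_add (wF t t0) (wG t t0)).
- move=> t k t0; apply: (ae3_imp2 (hF t k t0) (hG t k t0)) => x e1 e2.
  rewrite /addF e1 e2; by rewrite -rmorphD.
- by move=> k; apply: (ae3_imp2 (cF k) (cG k)) => x; exact: ccontD.
Qed.

Lemma duhamel_cfield (Fo : curve R) M : Cw 0 Fo -> (cw_norm 0 Fo <= M%:E)%E -> cfield M (duF (st Fo)).
Proof.
move=> CF nF; have [[M0 mS bS] hS] := st_force CF nF; split.
- by move=> k; exact: (duF_cmeas mS).
- by move=> t t0; exact: (duF_weight M0 mS bS).
- by move=> t k t0; exact: (duF_herm M0 mS bS hS).
- by move=> k; exact: (duF_cont M0 mS bS).
Qed.

Lemma yF_cfield (u0 : vdistr R) Fo M N : PM 2 u0 -> (pm_norm 2 u0 <= M%:E)%E -> Cw 0 Fo ->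
  (cw_norm 0 Fo <= N%:E)%E -> cfield (M + N) (yF u0 Fo).
Proof. by move=> P0 n0 CF nF; exact: (cfield_add (heat_cfield P0 n0) (duhamel_cfield CF nF)). Qed.

Lemma cfield_frep F M : cfield M F -> frep (fun t i => of_hat (F t i)) F.
Proof.
move=> [mF wF _ _]; split=> // t k t0.
have h := weight2_hatb (jmeas3 t k mF) (wF t t0).
by split; [exact: (of_hat_spec h).2|exists M].
Qed.

Lemma linear_part_frep (u0 : vdistr R) Fo : PM 2 u0 -> Cw 0 Fo -> frep (linear_part u0 Fo) (yF u0 Fo).
Proof.
move=> P0 CF; have [M hM] := PM_fin P0; have [N _ hN] := Cw_norm CF.
have nF : (cw_norm 0 Fo <= N%:E)%E by rewrite hN.
have E : duhamel Fo = (fun t j => of_hat (duF (st Fo) t j)).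
  apply/funext => t; apply/funext => j; rewrite /duhamel; congr of_hat; apply/funext => x.
  exact: duhamel_hatE.
rewrite /linear_part E.
exact: (frep_add (cfield_frep (heat_cfield P0 hM)) (cfield_frep (duhamel_cfield CF nF))).
Qed.

Lemma NS_frep (u0 : vdistr R) Fo u : PM 2 u0 -> Cw 0 Fo -> NS_solution u0 Fo u ->
  exists2 G, frep u G & forall (t : R), 0 <= t -> {ae leb3, forall x k, G t k x = yF u0 Fo t k x + BF G G t k x}.
Proof.
move=> P0 CF [Cu uE]; have [M _ hM] := Cw_norm Cu.
have nu : (cw_norm 2 u <= M%:E)%E by rewrite hM.
(* The right-hand side of the mild formula is jointly measurable and equals the transform of u(t)
   for every t >= 0, so a solution brings its own representative. Afterwards [st u] can be replaced
   by [G] inside the bilinear term. *)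
pose G := addF (yF u0 Fo) (BF (st u) (st u)).
have [N hN] := PM_fin P0; have [N' _ hN'] := Cw_norm CF.
have nF : (cw_norm 0 Fo <= N'%:E)%E by rewrite hN'.
have [my _ _ _] := yF_cfield P0 hN CF nF.
have gu := st_good Cu nu.
have M0 : 0 <= M by have := le_trans (cw_norm_ge0 2 u) nu; rewrite lee_fin.
have [mB _ _ _] := BF_cfield M0 M0 gu gu.
have uG : frep u G.
  apply: frep_Cw => //; first exact: jmeas_add.
  move=> t t0; apply: (ae3_imp (uE t t0)) => x h k.
  by rewrite h B_hatE duhamel_hatE /G /addF /yF addrAC.
exists G => // t t0; apply: (@aeW _ (RRR R) R leb3) => x k.
by rewrite -(frep_B _ _ _ uG uG) B_hatE.
Qed.

End Representatives.

(** * Geometrically convergent sequences and measurable limits *)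

Section GeometricLimits.
Context {R : realType}.
Implicit Types (a : nat -> R) (C q : R).

Lemma cvg_geometric0 C q : 0 <= q -> q < 1 -> C * q ^+ n @[n --> \oo] --> 0.
Proof.
move=> q0 q1; rewrite -(mulr0 C); apply: cvgM; first exact: cvg_cst.
by apply: cvg_expr; rewrite ger0_norm.
Qed.

(* Adding and subtracting the tail of the geometric series encloses [a] between two monotone
   sequences. *)
Lemma geometric_cvg a C q : 0 <= C -> 0 <= q -> q < 1 -> (forall n, `|a n.+1 - a n| <= C * q ^+ n) ->
  exists2 l, a n @[n --> \oo] --> l & forall n, `|l - a n| <= C / (1 - q) * q ^+ n.
Proof.
move=> C0 q0 q1 ha; pose K := C / (1 - q); have q1' : 0 < 1 - q by rewrite subr_gt0.
have K0 : 0 <= K by rewrite divr_ge0 // ltW.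
have KE : C = K * (1 - q) by rewrite /K divfK // gt_eqF.
have p n : 0 <= K * q ^+ n by rewrite mulr_ge0 // exprn_ge0.
have ndb : {homo (fun n => a n - K * q ^+ n) : n m / (n <= m)%N >-> n <= m}.
  apply: homo_leq => [x|x y z|n]; [exact: lexx|exact: le_trans|].
  have := ha n; rewrite ler_norml KE exprS => /andP[h _]; move: h.
  by move: (q ^+ n) => z h; lra.
have nic : {homo (fun n => - (a n + K * q ^+ n)) : n m / (n <= m)%N >-> n <= m}.
  apply: homo_leq => [x|x y z|n]; [exact: lexx|exact: le_trans|].
  have := ha n; rewrite ler_norml KE exprS => /andP[_ h]; move: h.
  by move: (q ^+ n) => z h; lra.
have bc n m : a n - K * q ^+ n <= a m + K * q ^+ m.
  have h1 := ndb _ _ (leq_maxl n m); have h2 := nic _ _ (leq_maxr n m).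
  move: h1 h2 => /=; have := p (maxn n m); lra.
have cb : cvgn (fun n => a n - K * q ^+ n).
  apply: nondecreasing_is_cvgn => //; exists (a 0%N + K * q ^+ 0) => _ [n _ <-]; exact: bc.
have ca : a n @[n --> \oo] --> limn (fun n => a n - K * q ^+ n).
  have h : (a n - K * q ^+ n) + K * q ^+ n @[n --> \oo] --> limn (fun n => a n - K * q ^+ n) + 0.
    by apply: cvgD; [exact: cb|exact: cvg_geometric0].
  have E : (fun n => (a n - K * q ^+ n) + K * q ^+ n) = a by apply/funext => n; rewrite subrK.
  by rewrite E addr0 in h.
exists (limn (fun n => a n - K * q ^+ n)) => // n.
have h1 : a n - K * q ^+ n <= limn (fun n => a n - K * q ^+ n) by exact: nondecreasing_cvgn_le.
have h2 : limn (fun n => a n - K * q ^+ n) <= a n + K * q ^+ n.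
  by apply: limr_le => //; apply: nearW => m; exact: bc.
by rewrite ler_norml; move: h1 h2; rewrite -/K; lra.
Qed.

(** An upper limit is defined for all sequences and preserves measurability, so the limit field is
    measurable everywhere although the sequences converge only almost everywhere. *)
Definition limR a : R := fine (limn_esup (fun n => (a n)%:E)).

Lemma limR_cvg a (l : R) : a n @[n --> \oo] --> l -> limR a = l.
Proof.
move=> al; have : (a n)%:E @[n --> \oo] --> l%:E by apply: cvg_EFin; [exact: nearW|exact: al].
by move=> /cvg_limn_einf_sup[_]; rewrite /limR => ->.
Qed.

Lemma measurable_limR d (T : measurableType d) (f : nat -> T -> R) : (forall n, measurable_fun setT (f n)) ->
  measurable_fun setT (fun x => limR (fun n => f n x)).
Proof.
move=> mf; apply: (measurableT_comp (fine_measurable measurableT)).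
by apply: measurable_fun_limn_esup => n; exact/measurable_EFinP.
Qed.

End GeometricLimits.

(** * The fixed point *)

Section Picard.
Context {R : realType}.
Local Notation C := R[i].
Local Notation leb1 := (@lebesgue_measure R : {measure set (measurableTypeR R) -> \bar R}).
Implicit Types (x xi : R3 R) (F G : field R) (u v : curve R) (t : R).

(** The countably many exceptional sets are merged into one null set before n tends to infinity
    pointwise. *)
Lemma weight2_lim (z : R3 R -> 'I_3 -> C) (a K q : R) : 0 <= q -> q < 1 ->
  (forall n, weight2 z (a + K * q ^+ n)) -> weight2 z a.
Proof.
move=> q0 q1 h; have H := @ae_foralln _ (RRR R) R leb3 _ h.
apply: (ae3_imp H) => x hx.
have c : a + K * q ^+ n @[n --> \oo] --> a.
  by rewrite -[X in _ --> X]addr0; apply: cvgD; [exact: cvg_cst|exact: cvg_geometric0].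
rewrite -(cvg_lim _ c) //; apply: limr_ge; [exact: (cvgP _ c)|exact: nearW].
Qed.

Lemma cfield_weight F (M N : R) : cfield M F -> (forall t, 0 <= t -> weight2 (fun x k => F t k x) N) -> cfield N F.
Proof. by move=> [mF _ hF cF] w. Qed.

Lemma cfield_good F (M : R) : cfield M F -> goodF M F.
Proof.
move=> [mF wF hF _]; split=> //; apply: aeW => t t0 k; last exact: hF.
by apply: (@weight2_wtb R (fun x k => F t k x)); [exact: jmeas3|exact: wF].
Qed.

Variables (eta : R) (eta0 : 0 < eta) (Heta : @bilinear_bound R eta).
Variables (y : field R) (eps : R) (eps0 : 0 < eps) (cy : cfield eps y).
Let q := 4 * eta * eps.
Hypothesis q1 : q < 1.

Let q0 : 0 <= q. Proof. by rewrite /q !mulr_ge0 // ltW. Qed.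
Let e0 : 0 <= 2 * eps. Proof. by rewrite mulr_ge0 // ltW. Qed.

Definition picard (n : nat) : field R := iter n (fun F => addF y (BF F F)) (fun _ _ _ => 0).

Lemma picardS n t k x : picard n.+1 t k x = y t k x + BF (picard n) (picard n) t k x.
Proof. by []. Qed.

Lemma picard_cfield n : cfield (2 * eps) (picard n).
Proof.
elim: n => [|n IH].
  split.
  - by move=> k; exact: cmeas_cst.
  - by move=> t t0; apply: (@aeW _ (RRR R) R leb3) => x; rewrite cvnorm0 mulr0.
  - by move=> t k t0; apply: (@aeW _ (RRR R) R leb3) => x; rewrite conjc0.
  - by move=> k; apply: (@aeW _ (RRR R) R leb3) => x; split => t s _ _ _; exact: cvg_cst.
have [Cn nn _] := cfield_curve IH; have fn := cfield_frep IH.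
have cB := BF_cfield e0 e0 (cfield_good IH) (cfield_good IH).
apply: (cfield_weight (cfield_add cy cB)) => t t0.
have [_ wy _ _] := cy.
have wB := BF_eta eta0 Heta Cn Cn fn fn nn nn t0.
apply: weight2_le (weight2_add (wy t t0) wB).
(* The ball of radius 2 eps is preserved: eps + eta (2 eps)^2 = eps + q eps <= 2 eps. *)
have : q * eps <= eps by rewrite ler_piMl // ltW.
rewrite /q; lra.
Qed.

(** On the ball the map contracts by eta (2 eps + 2 eps) = q, and the first step from 0 has size at
    most 2 eps. *)
Lemma picard_diff n t : 0 <= t ->
  weight2 (fun x k => picard n.+1 t k x - picard n t k x) (2 * eps * q ^+ n).
Proof.
elim: n t => [|n IH] t t0.
  have [_ w _ _] := picard_cfield 1; rewrite expr0 mulr1.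
  by apply: weight2_ae (w t t0); apply: (@aeW _ (RRR R) R leb3) => x k; rewrite subr0.
have [C1 n1 _] := cfield_curve (picard_cfield n.+1); have f1 := cfield_frep (picard_cfield n.+1).
have [C2 n2 _] := cfield_curve (picard_cfield n); have f2 := cfield_frep (picard_cfield n).
have nd := (frep_norm (2 * eps * q ^+ n) (frep_sub f1 f2)).2 IH.
have := BF_diff_eta eta0 Heta C1 C2 f1 f2 n1 n2 nd t0.
rewrite (_ : eta * (2 * eps + 2 * eps) * (2 * eps * q ^+ n) = 2 * eps * q ^+ n.+1); last first.
  by rewrite exprS {2}/q; ring.
apply: weight2_ae; apply: (@aeW _ (RRR R) R leb3) => x k.
rewrite (picardS n.+1) (picardS n).
have g (a b c : C) : b - c = (a + b) - (a + c) by ring.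
exact: g.
Qed.

(** The limit is taken at each point (t, xi) for lack of a complete space of fields. The null set
    where convergence may fail depends on t, so this field is measurable and bounded but has no
    evident continuity in time. *)
Definition plim : field R := fun t k x =>
  limR (fun n => Re (picard n t k x)) +i* limR (fun n => Im (picard n t k x)).

(** The sum 2 eps / (1 - q) of the geometric series, times 2 for real and imaginary parts and 3 for
    the components; its size is irrelevant in the limit. *)
Let K := 12 * eps / (1 - q).
Let K0 : 0 <= K. Proof. by rewrite divr_ge0 ?subr_ge0 ?(ltW q1) // mulr_ge0 // ltW. Qed.

Lemma plim_jmeas : jmeas plim.
Proof.
move=> k; have m n := let: And4 m _ _ _ := picard_cfield n in m k.
by split; apply: measurable_limR => n; [exact: (m n).1|exact: (m n).2].
Qed.

(** Convergence of the imaginary parts is recorded as well because an upper limit does not commute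
    with a change of sign, and conjugation in [plim_herm] needs exactly that. *)
Lemma plim_cvg t : 0 <= t -> {ae leb3, forall x,
  (forall k, Im (picard n t k x) @[n --> \oo] --> Im (plim t k x)) /\
  forall n, dot x x * cvnorm (fun k => plim t k x - picard n t k x) <= K * q ^+ n}.
Proof.
move=> t0; have H := @ae_foralln _ (RRR R) R leb3 _ (fun n => picard_diff n t0).
apply: (ae3_imp2 H ae_dot_gt0) => x hx x0.
have C0 : 0 <= 2 * eps / dot x x by rewrite divr_ge0 // ltW.
have b n k : normc (picard n.+1 t k x - picard n t k x) <= 2 * eps / dot x x * q ^+ n.
  apply: (le_trans (normc_le_cvnorm (fun k => picard n.+1 t k x - picard n t k x) k)).
  by rewrite mulrAC ler_pdivlMr // mulrC.
have HR k : exists2 l, Re (picard n t k x) @[n --> \oo] --> l & forall n, `|l - Re (picard n t k x)| <= 2 * eps / dot x x / (1 - q) * q ^+ n.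
  apply: (geometric_cvg C0 q0 q1) => n; rewrite -ReN -ReD.
  exact: le_trans (Re_le_normc _) (b n k).
have HI k : exists2 l, Im (picard n t k x) @[n --> \oo] --> l & forall n, `|l - Im (picard n t k x)| <= 2 * eps / dot x x / (1 - q) * q ^+ n.
  apply: (geometric_cvg C0 q0 q1) => n; rewrite -ImN -ImD.
  exact: le_trans (Im_le_normc _) (b n k).
split=> [k|n].
  by have [l cl _] := HI k; rewrite /= (limR_cvg cl).
apply: (@le_trans _ _ (dot x x * (3 * (2 * (2 * eps / dot x x / (1 - q) * q ^+ n))))).
  rewrite ler_wpM2l ?dot_ge0 //; apply: cvnorm_le => k; apply: (le_trans (normc_le_ReIm _)).
  have [l cl hl] := HR k; have [l' cl' hl'] := HI k.
  rewrite ReD ReN ImD ImN /= (limR_cvg cl) (limR_cvg cl').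
  by have := hl n; have := hl' n; lra.
rewrite le_eqVlt; apply/orP; left; apply/eqP; rewrite /K.
have := lt0r_neq0 x0; have : 1 - q != 0 by rewrite subr_eq0 eq_sym lt_eqF.
by move: (dot x x) (1 - q) (q ^+ n) => d p z p0 d0; field; rewrite p0 d0.
Qed.

Lemma plim_diff n t : 0 <= t -> weight2 (fun x k => plim t k x - picard n t k x) (K * q ^+ n).
Proof. by move=> t0; apply: (ae3_imp (plim_cvg t0)) => x [_]; apply. Qed.

Lemma plim_weight t : 0 <= t -> weight2 (fun x k => plim t k x) K.
Proof.
move=> t0; have := plim_diff 0 t0; rewrite expr0 mulr1; apply: weight2_ae.
by apply: (@aeW _ (RRR R) R leb3) => x k; rewrite subr0.
Qed.

Lemma plim_herm t k : 0 <= t -> hermitian (plim t k).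
Proof.
move=> t0; have h n : hermitian (picard n t k) by have [_ _ h _] := picard_cfield n; exact: h.
have H := @ae_foralln _ (RRR R) R leb3 _ h.
apply: (ae3_imp2 H (plim_cvg t0)) => x hx [/(_ k) cI _]; apply: complex_eq => /=.
  by congr limR; apply/funext => n; rewrite hx; case: (picard n t k x).
have E : (fun n => Im (picard n t k (- x))) = (fun n => - Im (picard n t k x)).
  by apply/funext => n; rewrite hx; case: (picard n t k x).
by rewrite E; apply: limR_cvg; apply: cvgN.
Qed.

Lemma plim_good : goodF K plim.
Proof.
split; first exact: plim_jmeas.
- apply: aeW => t t0 k; apply: (@weight2_wtb R (fun x k => plim t k x)); last exact: plim_weight.
  exact: (jmeas3 t k plim_jmeas).
- by apply: aeW => t t0 k; exact: plim_herm.
Qed.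

Lemma plim_sub_good n : goodF (K * q ^+ n) (subF plim (picard n)).
Proof.
have [mP bP hP] := cfield_good (picard_cfield n); have [mL _ hL] := plim_good.
have mS := jmeas_sub mL mP; split => //.
- apply: aeW => t t0 k; apply: (@weight2_wtb R (fun x k => subF plim (picard n) t k x)).
    exact: (jmeas3 t k mS).
  exact: plim_diff.
- apply: (ae_imp2 hL hP) => t h1 h2 t0 k; apply: (ae3_imp2 (h1 t0 k) (h2 t0 k)) => x e1 e2.
  by rewrite /subF e1 e2 -rmorphB.
Qed.

(** One further application of the map to the pointwise limit: the time integral restores the
    continuity that [plim] may lack, and the two fields turn out to agree almost everywhere at each
    time. *)
Definition psol : field R := addF y (BF plim plim).

(** The [cdiv] bounds of the two terms in the telescoped difference of B at [plim] and at an
    iterate, with the factor q^n taken out. *)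
Let K3 := cdiv * (K * K + 2 * eps * K).

Lemma psol_diff n t : 0 <= t -> weight2 (fun x k => psol t k x - picard n.+1 t k x) (K3 * q ^+ n).
Proof.
move=> t0; have Kn : 0 <= K * q ^+ n by rewrite mulr_ge0 // exprn_ge0.
have gP := cfield_good (picard_cfield n).
have E := BF_diff K0 e0 Kn plim_good gP (plim_sub_good n).
have [_ w1 _ _] := BF_cfield Kn K0 (plim_sub_good n) plim_good.
have [_ w2 _ _] := BF_cfield e0 Kn gP (plim_sub_good n).
have := weight2_add (w1 t t0) (w2 t t0).
rewrite (_ : _ + _ = K3 * q ^+ n); last by rewrite /K3; move: cdiv K => a b; ring.
apply: (@weight2_ae R (fun x k => BF (subF plim (picard n)) plim t k x + BF (picard n) (subF plim (picard n)) t k x)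
  (fun x k => psol t k x - picard n.+1 t k x)).
apply: (ae3_imp E) => x e k; rewrite picardS -(e t k).
have g (a b c : C) : b - c = (a + b) - (a + c) by ring.
exact: g.
Qed.

(** [BF_cfield] gives measurability, symmetry and continuity with a crude bound; the radius 2 eps is
    inherited from the iterates, which approach this field geometrically. *)
Lemma psol_cfield : cfield (2 * eps) psol.
Proof.
apply: (cfield_weight (cfield_add cy (BF_cfield K0 K0 plim_good plim_good))) => t t0.
apply: (@weight2_lim _ _ K3 q q0 q1) => n.
have [_ w _ _] := picard_cfield n.+1.
have := weight2_add (w t t0) (psol_diff n t0); apply: weight2_ae.
apply: (@aeW _ (RRR R) R leb3) => x k.
by have g (a b : C) : a + (b - a) = b by [ring|]; exact: g.
Qed.

(** Both fields are limits of the same iterates, so their difference is bounded by multiples of q^n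
    for every n. *)
Lemma psol_plim t : 0 <= t -> {ae leb3, forall x k, psol t k x = plim t k x}.
Proof.
move=> t0; have w : weight2 (fun x k => psol t k x - plim t k x) 0.
  apply: (@weight2_lim _ _ (K3 + K * q) q q0 q1) => n.
  have := weight2_sub (psol_diff n t0) (plim_diff n.+1 t0).
  rewrite (_ : _ + _ = 0 + (K3 + K * q) * q ^+ n); last by rewrite exprS; ring.
  apply: weight2_ae; apply: (@aeW _ (RRR R) R leb3) => x k.
  by have g (a b c : C) : a - b - (c - b) = a - c by [ring|]; exact: g.
apply: (ae3_imp2 w ae_dot_gt0) => x h x0 k.
have h0 : cvnorm (fun k => psol t k x - plim t k x) <= 0 by rewrite -(pmulr_rle0 _ x0).
apply/eqP; rewrite -subr_eq0; apply/eqP/Normc.eq0_normc/le_anti.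
rewrite normc_ge0 andbT; apply: le_trans h0.
exact: (normc_le_cvnorm (fun k => psol t k x - plim t k x)).
Qed.

(** By definition this field is the image of [plim]. Since the bilinear term reads its arguments
    only up to null sets, [plim] may be exchanged for [psol], and the equation holds at every
    point. *)
Lemma psol_fixed t k x : psol t k x = y t k x + BF psol psol t k x.
Proof.
have [mS _ _ _] := psol_cfield.
have e : {ae leb1, forall tau, 0 <= tau -> forall k, {ae leb3, forall x, plim tau k x = psol tau k x}}.
  by apply: aeW => tau t0 i; apply: (ae3_imp (psol_plim t0)) => z ez; exact: esym (ez i).
transitivity (y t k x + BF plim plim t k x); first by [].
by rewrite (BF_ae t k x plim_jmeas mS plim_jmeas mS e e).
Qed.

(** With D the norm of the difference, subtracting the two equations gives D <= Y + q D. Since D is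
    finite, being the norm of an element of [Cw 2], this can be solved for D. *)
Lemma fixed_point_diff u v F G (y1 y2 : field R) (Y : R) : Cw 2 u -> Cw 2 v -> frep u F -> frep v G ->
  (cw_norm 2 u <= (2 * eps)%:E)%E -> (cw_norm 2 v <= (2 * eps)%:E)%E ->
  (forall t, 0 <= t -> {ae leb3, forall x k, F t k x = y1 t k x + BF F F t k x}) ->
  (forall t, 0 <= t -> {ae leb3, forall x k, G t k x = y2 t k x + BF G G t k x}) ->
  (forall t, 0 <= t -> weight2 (fun x k => y1 t k x - y2 t k x) Y) ->
  (cw_norm 2 (curve_sub u v) <= (1 / (1 - 4 * eta * eps) * Y)%:E)%E.
Proof.
move=> Cu Cv uF vG nu nv hF hG hY; have [D D0 hD] := Cw_norm (Cw_sub Cu Cv).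
have nD : (cw_norm 2 (curve_sub u v) <= D%:E)%E by rewrite hD.
have fs := frep_sub uF vG.
have : (cw_norm 2 (curve_sub u v) <= (Y + eta * (2 * eps + 2 * eps) * D)%:E)%E.
  apply/(frep_norm _ fs) => t t0.
  have := weight2_add (hY t t0) (BF_diff_eta eta0 Heta Cu Cv uF vG nu nv nD t0).
  apply: weight2_ae; apply: (ae3_imp2 (hF t t0) (hG t t0)) => x e1 e2 k.
  rewrite /subF (e1 k) (e2 k).
  by have g (a b c d : C) : (a - b) + (c - d) = (a + c) - (b + d) by [ring|]; exact: g.
rewrite hD !lee_fin => h; rewrite mul1r mulrC ler_pdivlMr ?subr_gt0 //.
by move: h; rewrite /q; lra.
Qed.

End Picard.

Theorem theorem4p1 (R : realType) :
  (exists eta : R, 0 < eta /\ bilinear_bound eta) /\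
  forall eta : R, 0 < eta -> bilinear_bound eta ->
  forall (u0 : vdistr R) (F : curve R) (eps : R),
    PM 2 u0 -> Cw 0 F ->
    0 < eps -> eps < 1 / (4 * eta) ->
    (pm_norm 2 u0 + cw_norm 0 F < eps%:E)%E ->
    exists u : curve R,
      [/\ NS_solution u0 F u,
          (cw_norm 2 u <= (2 * eps)%:E)%E,
          (forall u' : curve R, NS_solution u0 F u' ->
             (cw_norm 2 u' <= (2 * eps)%:E)%E -> curve_eq u' u) &
          (forall (v0 : vdistr R) (G v : curve R),
             PM 2 v0 -> Cw 0 G ->
             (cw_norm 2 (linear_part v0 G) <= eps%:E)%E ->
             Cw 2 v ->
             curve_eq v (curve_add (linear_part v0 G) (B v v)) ->
             (cw_norm 2 v <= (2 * eps)%:E)%E ->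
             (cw_norm 2 (curve_sub u v) <=
                (1 / (1 - 4 * eta * eps))%:E *
                cw_norm 2 (curve_sub (linear_part u0 F)
                                     (linear_part v0 G)))%E)].
Proof.
split; first exact: bilinear_bound_ex.
move=> eta eta0 Heta u0 F eps P0 CF eps0 epseta small.
have q1 : 4 * eta * eps < 1.
  by move: epseta; rewrite ltr_pdivlMr ?mulr_gt0 // mulrC.
have [N N0 hN] := Cw_norm CF.
have [M hM] : exists M, pm_norm 2 u0 = M%:E.
  by have [_] := P0; have := pm_norm_ge0 2 u0; case: (pm_norm 2 u0) => // M _ _; exists M.
(* The linear part has norm at most the plain sum of the norms of the data, hence at most eps; this
   is where the sharp constants of the heat and Duhamel bounds are used. *)
have MN : M + N <= eps by move: small; rewrite hM hN -EFinD lte_fin => /ltW.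
have cy : cfield eps (yF u0 F).
  have nM : (pm_norm 2 u0 <= M%:E)%E by rewrite hM.
  have nN : (cw_norm 0 F <= N%:E)%E by rewrite hN.
  have c := yF_cfield P0 nM CF nN; have [_ w _ _] := c.
  by apply: (cfield_weight c) => t t0; exact: (weight2_le MN (w t t0)).
pose S := psol (yF u0 F).
have cS : cfield (2 * eps) S := psol_cfield eta0 Heta eps0 cy q1.
have fixS t : 0 <= t -> {ae leb3, forall x k, S t k x = yF u0 F t k x + BF S S t k x}.
  move=> t0; apply: (@aeW _ (RRR R) R leb3) => x k; exact: (psol_fixed eta0 Heta eps0 cy q1).
have [Cu nu hu] := cfield_curve cS; have fu := cfield_frep cS.
set u : curve R := fun t i => of_hat (S t i) in Cu nu hu fu *.
exists u; split => //.
- split=> // t t0; apply: (ae3_imp2 (hu t t0) (fixS t t0)) => x h1 h2 j.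
  by rewrite h1 h2 (frep_B _ _ _ fu fu) duhamel_hatE /yF addrAC.
- move=> u' su' nu'; have [Cu' _] := su'; have [G fG hG] := NS_frep P0 CF su'.
  (* Uniqueness is the stability estimate for equal linear parts, with [Y := 0]. *)
  have := fixed_point_diff eta0 Heta q1 Cu' Cu fG fu nu' nu hG fixS (Y := 0).
  rewrite mulr0 => h; apply: (frep_curve_eq fG fu); apply/(frep_norm 0 (frep_sub fG fu)); apply: h.
  move=> t t0; apply: (@aeW _ (RRR R) R leb3) => x; rewrite (_ : (fun k => _) = (fun=> 0)).
    by rewrite cvnorm0 mulr0.
  by apply/funext => k; rewrite subrr.
- move=> v0 G v Pv0 CG _ Cv ev nv.
  have fl := linear_part_frep P0 CF; have fl' := linear_part_frep Pv0 CG.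
  have gv := st_good Cv nv.
  have e0 : 0 <= 2 * eps by rewrite mulr_ge0 // ltW.
  have fB : frep (B v v) (BF (st v) (st v)).
    have -> : B v v = (fun t i => of_hat (BF (st v) (st v) t i)).
      apply/funext => t; apply/funext => j; rewrite /B; congr of_hat; apply/funext => x.
      exact: B_hatE.
    exact: (cfield_frep (BF_cfield e0 e0 gv gv)).
  (* The equation assumed for [v] as a distribution supplies a jointly measurable representative,
     first in terms of [st v]; in [hv] this representative then solves the fixed point equation for
     fields. *)
  have fv : frep v (addF (yF v0 G) (BF (st v) (st v))) := frep_eq ev (frep_add fl' fB).
  have hv t : 0 <= t -> {ae leb3, forall x k, addF (yF v0 G) (BF (st v) (st v)) t k x =
      yF v0 G t k x + BF (addF (yF v0 G) (BF (st v) (st v))) (addF (yF v0 G) (BF (st v) (st v))) t k x}.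
    move=> t0; apply: (@aeW _ (RRR R) R leb3) => x k.
    by rewrite -(frep_B _ _ _ fv fv) B_hatE.
  have k0 : 0 < 1 / (1 - 4 * eta * eps) by rewrite divr_gt0 // subr_gt0.
  have fY := frep_sub fl fl'.
  have := cw_norm_ge0 2 (curve_sub (linear_part u0 F) (linear_part v0 G)).
  case E : (cw_norm 2 (curve_sub (linear_part u0 F) (linear_part v0 G))) => [Y| |] // Y0.
    rewrite -EFinM; apply: (fixed_point_diff eta0 Heta q1 Cu Cv fu fv nu nv fixS hv).
    by apply/(frep_norm Y fY); rewrite E.
  by rewrite gt0_muley ?lte_fin // leey.
Qed.
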